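(* Let $G$ be a near triangulation on $n$ vertices. Then $\iota(G) \leq 5n/12$. Moreover, if $G$ is a planar triangulation, then $\iota(G) < 3n/8$, and if $G$ is a planar triangulation with minimum degree $\delta(G)=5$, then $\iota(G) \leq n/3$.
   Context: For a graph $G$, a set $S\subseteq V(G)$ is dominating if every vertex of $G$ is in $S$ or adjacent to a vertex of $S$, and independent if no two vertices of $S$ are adjacent. $\iota(G)$ denotes the minimum cardinality of an independent dominating set of $G$. A planar triangulation is a plane graph in which every face is bounded by a triangle. A near triangulation (triangulated disk) is a 2-connected plane graph in which every face, except possibly the outer face, is bounded by a triangle. *)

(* Defs.v *)
From HB Require Import structures.
From mathcomp Require Import all_boot all_order all_algebra.
From mathcomp Require Import all_classical all_reals all_analysis.

Set Implicit Arguments.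
Unset Strict Implicit.
Unset Printing Implicit Defensive.

Import Order.TTheory GRing.Theory Num.Theory.
Import numFieldNormedType.Exports.
Local Open Scope classical_set_scope.
Local Open Scope ring_scope.

Record sgraph := SGraph {
  vertex :> finType;
  adj : rel vertex;
  adj_sym : symmetric adj;
  adj_irr : irreflexive adj }.

Section Graphs.
Variable G : sgraph.

Definition dominating (S : {set G}) : bool :=
  [forall v, (v \in S) || [exists u in S, adj u v]].

Definition independent (S : {set G}) : bool :=
  [forall u in S, forall v in S, ~~ adj u v].

Definition indep_dominating (S : {set G}) : bool :=
  independent S && dominating S.

Lemma ex_indep_dominating :
  exists k, [exists S : {set G}, indep_dominating S && (#|S| == k)].
Proof.
have ind0 : independent (finset.set0 : {set G}).
  by apply/forall_inP => u; rewrite inE.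
have [S /maxsetP [indS maxS] _] := maxset_exists ind0.
exists #|S|; apply/existsP; exists S; rewrite eqxx andbT /indep_dominating indS /=.
apply/forallP => v; apply/orP.
have [vS|vS] := boolP (v \in S); [by left | right].
apply: contraT => /existsPn nadj.
suff indvS : independent (v |: S)%SET.
  by move: vS; rewrite -(maxS _ indvS (finset.subsetUr _ _)) setU11.
have nadjS u : u \in S -> ~~ adj u v.
  by move=> uS; have := nadj u; rewrite uS.
apply/forall_inP => x /setU1P [->|xS]; apply/forall_inP => y /setU1P [->|yS].
- by rewrite adj_irr.
- by rewrite adj_sym nadjS.
- exact: nadjS.
- by move/forall_inP: indS => /(_ x xS) /forall_inP /(_ y yS).
Qed.

Definition iota_dom : nat := ex_minn ex_indep_dominating.

Definition degree (v : G) : nat := #|[set u | adj v u]%SET|.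

(* The default value #|G| is never smaller than a degree. *)
Definition min_degree : nat := \big[minn/#|G|]_(v : G) degree v.

Definition connected_minus (X : {set G}) : Prop :=
  forall u v : G, u \notin X -> v \notin X ->
    connect [rel x y | [&& adj x y, x \notin X & y \notin X]] u v.

Definition k_connected (k : nat) : Prop :=
  (k < #|G|)%N /\ forall X : {set G}, (#|X| < k)%N -> connected_minus X.

End Graphs.

Definition is_arc (R : realType) (A : set (R * R)) (p q : R * R) : Prop :=
  exists f : R -> R * R,
    [/\ {within `[0, 1], continuous f}, {in `[0, 1] &, injective f},
        f 0 = p, f 1 = q & f @` `[0, 1] = A].

(* Simple graphs drawn in the plane: vertices are points, edges are arcs
   meeting the other edges and the vertices only in their endpoints. The value
   of edge_set u v is irrelevant when u and v are not adjacent. *)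
Record plane_graph (R : realType) := PlaneGraph {
  pg_graph :> sgraph;
  pos : pg_graph -> R * R;
  edge_set : pg_graph -> pg_graph -> set (R * R);
  pos_inj : injective pos;
  edge_arc : forall u v, adj u v -> is_arc (edge_set u v) (pos u) (pos v);
  edge_sym : forall u v, adj u v -> edge_set u v = edge_set v u;
  edge_vertex : forall u v w, adj u v -> edge_set u v (pos w) ->
    w = u \/ w = v;
  edge_edge : forall u v x y, adj u v -> adj x y ->
    [set u; v]%SET <> [set x; y]%SET ->
    (edge_set u v `\` [set pos u; pos v]) `&` edge_set x y = set0 }.

Section PlaneGraphs.
Variables (R : realType) (G : plane_graph R).

Definition drawing : set (R * R) :=
  [set p | (exists v : G, p = pos v) \/
           (exists u v : G, adj u v /\ edge_set u v p)].

Definition face (F : set (R * R)) : Prop :=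
  exists2 p, ~ drawing p & F = connected_component (~` drawing) p.

Definition frontier (F : set (R * R)) : set (R * R) := closure F `\` interior F.

Definition bounded_by_triangle (F : set (R * R)) : Prop :=
  exists u v w : G, [/\ adj u v, adj v w, adj w u &
    frontier F = edge_set u v `|` edge_set v w `|` edge_set w u].

Definition planar_triangulation : Prop :=
  forall F, face F -> bounded_by_triangle F.

(* The outer face is the unbounded one. *)
Definition near_triangulation : Prop :=
  k_connected G 2 /\
  forall F, face F -> bounded_set F -> bounded_by_triangle F.

End PlaneGraphs.

(* Main.v *)
(** Topology. For a point p, the parity of the crossings of a path with the ray
    going right from p is locally a coboundary away from p. Two points lie in the
    same component of the complement of a compact set exactly when the difference
    of their parities is a coboundary on it, and these parities span all local
    cocycles. Hence the facial triangles of the bounded faces are dual, modulo 2,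
    to the winding parities of points of these faces: they are independent and
    span the cycle space. This is all that is used of the plane.

    Combinatorics. A near triangulation is closed by a cone over its boundary.
    MacLane-type counting bounds the number of edges of minors, which yields
    colourings with five colours, also after contracting edges; contraction at
    degree 4 vertices forces them to see three colours. Each colour class is
    extended to a maximal independent set S_i. The S_i containing v and those
    containing a neighbour of v are different, so the number s(v) of sets
    containing v satisfies s(u) + s(v) + s(w) <= 5 on every triangle, and a vertex
    of odd degree with s(v) = 2 lies on triangles missed by three of the S_i. A
    discharging count then bounds the (weighted) average size of the five sets. *)

From mathcomp Require Import all_boot zify.

Set Implicit Arguments.
Unset Strict Implicit.
Unset Printing Implicit Defensive.

(** * Chains modulo 2 *)

(** Degree 4 shapes the combinatorics. A vertex of degree [d] and load [s] exceeds its share by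
    [(6 - d) * (s - 1)]. The odd degrees 3 and 5 are paid for by missed triangles, but at an even
    degree no triangle need be missed, so at degree 4 the load itself must be kept small by the
    choice of the colouring. The octahedron, the one case where triangles of degree 4 vertices are
    not isolated, is treated separately. The constants: with [n] vertices and at most [2 * n - 4]
    faces, the five sizes add up to less than [5 * n / 3] if all degrees are at least 5, whence
    [n / 3]. Degree 4 vertices raise this to less than [13 * n / 7], and [13 / 35 < 3 / 8]. For a
    near triangulation the apex of the cone lies in no set and need not be dominated; the set with
    the colour of the apex gets weight 4 and the others weight 5, in all 24, against a weighted
    total of at most [10 * n], whence [5 / 12]. In the plane, separation is expressed only through
    parities: that an edge borders at most two bounded faces, for instance, is read off from winding
    parities on a 4-cycle. *)

Lemma xorD (I : finType) (P : pred I) (f g : I -> bool) :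
  \big[addb/false]_(i | P i) (f i (+) g i) =
  (\big[addb/false]_(i | P i) f i) (+) (\big[addb/false]_(i | P i) g i).
Proof. by rewrite big_split. Qed.

Lemma xor_andl (I : finType) (P : pred I) (b : bool) (f : I -> bool) :
  b && (\big[addb/false]_(i | P i) f i) = \big[addb/false]_(i | P i) (b && f i).
Proof. by case: b => //=; rewrite big1. Qed.

Lemma xor_andr (I : finType) (P : pred I) (b : bool) (f : I -> bool) :
  (\big[addb/false]_(i | P i) f i) && b = \big[addb/false]_(i | P i) (f i && b).
Proof. by rewrite andbC xor_andl; apply: eq_bigr => i _; rewrite andbC. Qed.

Lemma xor_pred1 (I : finType) (P : pred I) (i0 : I) (f : I -> bool) :
  \big[addb/false]_(i | P i) ((i == i0) && f i) = P i0 && f i0.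
Proof.
rewrite big_mkcond (bigD1 i0) //= big1 ?addbF ?eqxx; first by case: (P i0).
by move=> i /negbTE->; case: (P i).
Qed.

Lemma xor_sub (I : finType) (P Q : pred I) (f : I -> bool) :
  (forall i, P i -> f i -> Q i) -> (forall i, Q i -> P i) ->
  \big[addb/false]_(i | P i) f i = \big[addb/false]_(i | Q i) f i.
Proof.
move=> PQ QP; rewrite big_mkcond [RHS]big_mkcond; apply: eq_bigr => i _.
have := PQ i; have := QP i; case: (Q i); case: (P i) => //=; first by move=> /(_ isT).
by move=> _ /(_ isT); case: (f i) => // /(_ isT).
Qed.

Lemma xor_card (I : finType) (P : pred I) (f : I -> bool) :
  \big[addb/false]_(i | P i) f i = odd #|[set i | P i & f i]|.
Proof.
rewrite -sum1dep_card (big_morph odd oddD (erefl : odd 0 = false)) /=.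
rewrite big_mkcond [RHS]big_mkcond; apply: eq_bigr => i _ /=.
by case: (P i) => //=; case: (f i).
Qed.

Section SymDiff.
Variable I : finType.
Implicit Types A B : {set I}.
Definition sdiff A B := (A :\: B) :|: (B :\: A).
Lemma in_sdiff A B i : (i \in sdiff A B) = (i \in A) (+) (i \in B).
Proof. by rewrite !inE; case: (i \in A); case: (i \in B). Qed.
Lemma sdiffK A B : sdiff (sdiff A B) B = A.
Proof. by apply/setP => i; rewrite !in_sdiff -addbA addbb addbF. Qed.
Lemma sdiff_sub (A B C : {set I}) : A \subset C -> B \subset C -> sdiff A B \subset C.
Proof.
move=> /subsetP AC /subsetP BC; apply/subsetP => i; rewrite !inE.
by move=> /orP[]/andP[_]; [apply: AC | apply: BC].
Qed.
Lemma xor_sdiff A B (f : I -> bool) : \big[addb/false]_(i in sdiff A B) f i =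
  (\big[addb/false]_(i in A) f i) (+) (\big[addb/false]_(i in B) f i).
Proof.
rewrite big_mkcond [X in _ = X (+) _]big_mkcond [X in _ = _ (+) X]big_mkcond -big_split /=.
by apply: eq_bigr => i _; rewrite in_sdiff; case: (i \in A); case: (i \in B); case: (f i).
Qed.
End SymDiff.

(** Stands in for linear algebra over the field with two elements: ranks are compared by counting
    subsets and the fibres of a linear map. *)
Lemma card_le_fibers (S U : finType) (D : {set S}) (f : S -> U) (B : {set U}) z :
  (forall x, x \in D -> f x \in B) ->
  (forall y, y \in B -> #|[set x in D | f x == y]| <= z) -> #|D| <= z * #|B|.
Proof.
move=> DB H; rewrite -sum1_card (partition_big f (mem B)) //=.
apply: leq_trans (_ : \sum_(y in B) z <= _); last by rewrite sum_nat_const mulnC.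
apply: leq_sum => y yB; apply: leq_trans (H y yB); rewrite -sum1dep_card.
by apply: eq_leq; apply: eq_bigl => x.
Qed.

Section Edges.
Variables (V : finType) (adj : rel V).
Hypotheses (adjC : symmetric adj) (adjI : irreflexive adj).
Implicit Types (u v w x : V) (e t : {set V}) (C : {set V} -> bool) (X T : {set {set V}}).

Definition edges : {set {set V}} := [set [set p.1; p.2] | p : V * V & adj p.1 p.2].

Lemma edgesP e : reflect (exists u v, adj u v /\ e = [set u; v]) (e \in edges).
Proof.
apply: (iffP imsetP) => [[[u v]]|[u [v [uv ->]]]].
  by rewrite inE /= => uv ->; exists u, v.
by exists (u, v); rewrite ?inE.
Qed.

Lemma mem_edges u v : adj u v -> [set u; v] \in edges.
Proof. by move=> uv; apply/edgesP; exists u, v. Qed.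

Lemma adj_neq u v : adj u v -> u != v.
Proof. by move=> uv; apply/negP => /eqP E; rewrite E adjI in uv. Qed.

(** The boundary modulo 2 of the 1-chain [C], at the vertex [v]; chains with [dv C] zero are the
    cycles. *)
Definition dv C v := \big[addb/false]_(e in edges) ((v \in e) && C e).

(** The boundary modulo 2 of the 2-chain [X], at the edge [e]. *)
Definition bd X e := \big[addb/false]_(t in X) (e \subset t).

Definition is_tri t := (#|t| == 3) && [forall a in t, forall b in t, (a != b) ==> adj a b].

Lemma is_triP t : reflect
  (#|t| = 3 /\ forall a b, a \in t -> b \in t -> a != b -> adj a b) (is_tri t).
Proof.
apply: (iffP andP) => [[/eqP c /forall_inP H]|[c H]]; split=> //.
- by move=> a b at_ bt ne; have /forall_inP/(_ b bt)/implyP := H a at_; apply.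
- exact/eqP.
- by apply/forall_inP => a at_; apply/forall_inP => b bt; apply/implyP => ne; exact: H.
Qed.

Lemma subset_pair u v t : ([set u; v] \subset t) = (u \in t) && (v \in t).
Proof. by rewrite subUset !sub1set. Qed.

Lemma set2_eq u v u' v' : [set u; v] = [set u'; v'] ->
  (u = u' /\ v = v') \/ (u = v' /\ v = u').
Proof.
move=> E.
have : u \in [set u'; v'] by rewrite -E !inE eqxx.
have : v \in [set u'; v'] by rewrite -E !inE eqxx orbT.
have : u' \in [set u; v] by rewrite E !inE eqxx.
have : v' \in [set u; v] by rewrite E !inE eqxx orbT.
by rewrite !inE => /orP[]/eqP? /orP[]/eqP? /orP[]/eqP? /orP[]/eqP?; subst; auto.
Qed.

Lemma tri_third t u v : is_tri t -> u \in t -> v \in t -> u != v ->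
  exists w, [/\ t = [set u; v; w], w != u, w != v & w \in t].
Proof.
move=> /is_triP[c _] ut vt ne.
have /card_gt0P[w] : 0 < #|t :\ u :\ v|.
  have := cardsD1 u t; rewrite c ut add1n => -[c2].
  by have := cardsD1 v (t :\ u); rewrite -c2 !inE eq_sym ne vt add1n => -[<-].
rewrite !inE => /and3P[wv wu wt]; exists w; split=> //.
apply/esym/eqP; rewrite eqEcard; apply/andP; split.
  by apply/subsetP => z; rewrite !inE -orbA => /or3P[]/eqP->.
by rewrite c setUC cardsU1 cards2 !inE negb_or wu wv ne.
Qed.

(* A triangle through v contains exactly two edges through v. *)
Lemma dv_tri t v : is_tri t -> dv (fun e => e \subset t) v = false.
Proof.
move=> tT; have [c cl] := is_triP _ tT.
rewrite /dv xor_card; have [vt|vt] := boolP (v \in t); last first.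
  rewrite (_ : [set _ | _ & _] = set0) ?cards0 //; apply/setP => e; rewrite !inE.
  apply/negP => /andP[_ /andP[ve /subsetP/(_ v ve)]]; exact/negP.
have -> : [set e | e \in edges & (v \in e) && (e \subset t)] =
          [set [set v; w] | w in t :\ v].
  apply/setP => e; apply/idP/imsetP.
    rewrite !inE => /and3P[/edgesP[a [b [ab ->]]]].
    rewrite subset_pair !inE => /orP[]/eqP Ev /andP[at_ bt].
      by exists b; rewrite ?inE ?Ev // bt andbT eq_sym adj_neq.
    by exists a; rewrite ?inE ?Ev ?at_ ?andbT ?adj_neq // setUC.
  move=> [w]; rewrite !inE => /andP[wv wt] ->.
  by rewrite mem_edges ?subset_pair ?inE ?eqxx ?vt ?wt // cl // eq_sym.
rewrite card_in_imset; last first.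
  move=> a b; rewrite !inE => /andP[av _] /andP[bv _] /set2_eq[[_ //]|[Ev Ea]].
  by rewrite Ea eqxx in av.
by have := cardsD1 v t; rewrite c vt add1n => -[<-].
Qed.

Lemma dv_bd X v : (forall t, t \in X -> is_tri t) -> dv (bd X) v = false.
Proof.
move=> XT; rewrite /dv.
under eq_bigr => e _ do rewrite /bd xor_andl.
rewrite exchange_big big1 //= => t tX; exact: dv_tri (XT t tX).
Qed.

(** * Cycles bound when dual cochains are given *)

Section Kronecker.
Variables (T : {set {set V}}) (c : {set V} -> {set V} -> bool).
Hypothesis Ttri : forall t, t \in T -> is_tri t.
Hypothesis kron : forall t t', t \in T -> t' \in T ->
  \big[addb/false]_(e in edges) ((e \subset t') && c t e) = (t == t').
Hypothesis kspan : forall e0, e0 \in edges -> exists (X : {set {set V}}) (hv : V -> bool),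
  X \subset T /\ forall e, e \in edges ->
    (e == e0) = \big[addb/false]_(t in X) c t e (+) \big[addb/false]_(v in e) hv v.

(** By bilinearity, pairing with [c t] reads off the coefficient of [t] in a boundary. *)
Lemma kron_bd X t : X \subset T -> t \in T ->
  \big[addb/false]_(e in edges) (bd X e && c t e) = (t \in X).
Proof.
move=> /subsetP XT tT; under eq_bigr => e _ do rewrite /bd xor_andr.
rewrite exchange_big /=.
transitivity (\big[addb/false]_(t' in X) ((t' == t) && true)); last by rewrite xor_pred1 andbT.
by apply: eq_bigr => t' /XT t'T; rewrite kron // andbT eq_sym.
Qed.

(** The pairings of [C] with the cochains [c t] are the only possible coefficients of [X]. The
    remainder [D = C + bd X] is a cycle orthogonal to every [c t]; cycles are orthogonal to
    coboundaries, so by [kspan] it is orthogonal to the indicator of each edge and vanishes. *)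
Lemma kron_span C : (forall v, dv C v = false) ->
  exists X : {set {set V}}, X \subset T /\ forall e, e \in edges -> C e = bd X e.
Proof.
move=> evC.
pose X := [set t in T | \big[addb/false]_(e in edges) (C e && c t e)].
have XT : X \subset T by apply/subsetP => t; rewrite inE => /andP[].
pose D e := C e (+) bd X e.
have Dc t : t \in T -> \big[addb/false]_(e in edges) (D e && c t e) = false.
  move=> tT; under eq_bigr => e _ do rewrite /D andb_addl.
  by rewrite xorD kron_bd // inE tT /= addbb.
have Dv v : dv D v = false.
  rewrite /dv; under eq_bigr => e _ do rewrite /D andb_addr.
  rewrite xorD -/(dv C v) -/(dv (bd X) v) evC dv_bd // => t /(subsetP XT); exact: Ttri.
exists X; split=> // e0 e0E.
suff : D e0 = false by rewrite /D; case: (C e0); case: (bd X e0).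
have [Y [hv [YT E]]] := kspan e0E.
transitivity (\big[addb/false]_(e in edges) ((e == e0) && D e)).
  by rewrite xor_pred1 e0E.
transitivity ((\big[addb/false]_(e in edges) \big[addb/false]_(t in Y) (D e && c t e)) (+)
   (\big[addb/false]_(e in edges) \big[addb/false]_v (hv v && ((v \in e) && D e)))).
  rewrite -xorD; apply: eq_bigr => e eE; rewrite E // andb_addl; congr addb.
    by rewrite xor_andr; apply: eq_bigr => t _; rewrite andbC.
  rewrite xor_andr big_mkcond; apply: eq_bigr => v _.
  by case: (v \in e); rewrite /= ?andbF.
rewrite exchange_big big1 /= => [|t /(subsetP YT)]; last exact: Dc.
rewrite exchange_big big1 //= => v _.
by rewrite -xor_andl -/(dv D v) Dv andbF.
Qed.

Lemma kron_indep X : X \subset T -> (forall e, e \in edges -> bd X e = false) -> X = set0.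
Proof.
move=> XT H; apply/setP => t; rewrite inE; apply/negbTE/negP => tX.
have := kron_bd XT (subsetP XT _ tX); rewrite tX big1 // => e eE; by rewrite H.
Qed.
End Kronecker.
End Edges.

(** * Sparsity of minors *)

Section Sparse.
Variables (V : finType) (adj : rel V).
Hypotheses (adjC : symmetric adj) (adjI : irreflexive adj).
Variable T : {set {set V}}.
Hypothesis Ttri : forall t, t \in T -> is_tri adj t.
Hypothesis two : forall u v, adj u v -> #|[set t in T | [set u; v] \subset t]| = 2.
Hypothesis span : forall C, (forall v, dv adj C v = false) ->
  exists X : {set {set V}}, X \subset T /\ forall e, e \in edges adj -> C e = bd X e.
Local Notation edges := (edges adj).
Local Notation dv := (dv adj).
Implicit Types (u v w x : V) (e t : {set V}) (X A B : {set {set V}}).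

Lemma two_edge e : e \in edges -> #|[set t in T | e \subset t]| = 2.
Proof. by move=> /edgesP[u [v [uv ->]]]; exact: two. Qed.

Lemma bd_all e : e \in edges -> bd T e = false.
Proof. by move=> eE; rewrite /bd xor_card two_edge. Qed.

(** * Minors: branch sets, merged triangles, cycle space *)

Section Chain.
Variables (L : finType) (phi : V -> option L).

Definition fibrel (k : L) : rel V :=
  [rel x y | [&& adj x y, phi x == Some k & phi y == Some k]].

Definition internal (K : {set L}) e :=
  [exists k in K, [forall v in e, phi v == Some k]].

(** A path inside a branch set, read as a chain bounded by its two ends; edges used twice cancel in
    [sdiff]. *)
Lemma path_chain (K : {set L}) k v r : k \in K -> connect (fibrel k) v r ->
  exists Q : {set {set V}}, [/\ Q \subset edges, forall e, e \in Q -> internal K e &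
    forall x, \big[addb/false]_(e in Q) (x \in e) = (x == v) (+) (x == r)].
Proof.
move=> kK /connectP[p]; elim: p v => [|w p IH] v /=.
  move=> _ ->; exists set0; split; [exact: sub0set | by move=> e; rewrite inE |].
  by move=> x; rewrite big_set0 addbb.
move=> /andP[/and3P[vw pv pw] pp] Er; have [Q [QE Qi Qb]] := IH w pp Er.
exists (sdiff [set [set v; w]] Q); split.
- by apply: sdiff_sub => //; rewrite sub1set mem_edges.
- move=> e; rewrite !inE => /orP[/andP[_ /eqP->]|/andP[_ /Qi]] //.
  apply/existsP; exists k; rewrite kK /=; apply/forallP => x; apply/implyP.
  by rewrite !inE => /orP[]/eqP->.
- move=> x; rewrite xor_sdiff big_set1 Qb !inE.
  have ne := adj_neq adjI vw; have [->|nx] := eqVneq x v; first by rewrite (negbTE ne).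
  by rewrite /= addbA addbb.
Qed.
End Chain.

Section Bound.
Variables (L : finType) (K : {set L}) (phi : V -> option L).
Variable R : {set {set V}}.
Variable root : L -> V.
Hypothesis conn : forall k v, k \in K -> phi v = Some k -> connect (fibrel phi k) v (root k).

Definition touch e (k : L) := [exists v in e, phi v == Some k].

Hypothesis Redge : forall e, e \in R -> exists u v k l,
  [/\ adj u v, e = [set u; v], k \in K, l \in K & [/\ k != l, phi u = Some k & phi v = Some l]].
Variable g : nat.
Hypothesis girth : forall A, A \subset R -> A != set0 ->
  (forall k, k \in K -> \big[addb/false]_(e in A) touch e k = false) -> g <= #|A|.

Lemma R_edges e : e \in R -> e \in edges.
Proof. by move=> /Redge[u [v [k [l [uv -> _ _ _]]]]]; exact: mem_edges. Qed.

Lemma touch_sum e k : e \in R ->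
  \big[addb/false]_(v | phi v == Some k) (v \in e) = touch e k.
Proof.
move=> /Redge[u [v [k1 [l1 [uv -> _ _ [kl pu pv]]]]]].
have ne := adj_neq adjI uv.
transitivity ((\big[addb/false]_(x | phi x == Some k) ((x == u) && true)) (+)
   (\big[addb/false]_(x | phi x == Some k) ((x == v) && true))).
  rewrite -xorD; apply: eq_bigr => x _; rewrite !inE !andbT.
  have [->|_] := eqVneq x u; last by [].
  by rewrite (negbTE ne).
rewrite !xor_pred1 !andbT pu pv.
have -> : touch [set u; v] k = (phi u == Some k) || (phi v == Some k).
  apply/existsP/orP => [[x]|].
    by rewrite !inE => /andP[/orP[]/eqP->]; [left | right].
  by move=> []h; [exists u | exists v]; rewrite !inE eqxx ?orbT h.
have : ~~ ((phi u == Some k) && (phi v == Some k)).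
  by rewrite pu pv; apply/negP => /andP[/eqP[E1] /eqP[E2]]; rewrite E1 E2 eqxx in kl.
by rewrite -pu -pv; case: (_ == _); case: (_ == _).
Qed.

(** Edges that are neither chosen for the minor nor contracted inside a branch set. Merging the
    triangles on their two sides produces the faces of the minor, the [classes] below. *)
Definition deleted e := [&& e \in edges, e \notin R & ~~ internal phi K e].

Definition share : rel {set V} := [rel t t' | [&& t \in T, t' \in T &
  [exists e, [&& deleted e, e \subset t & e \subset t']]]].

Definition clss t := [set t' | connect share t t'].

Definition classes := [set clss t | t in T].

Lemma share_sym : connect_sym share.
Proof.
apply: sym_connect_sym => t t'; rewrite /share /= andbCA; congr [&& _, _ & _].
by apply: eq_existsb => e; rewrite [(e \subset t) && _]andbC.
Qed.

(** Among subsets of [T] these are the unions of classes, by [sclosed_connect] and [bd_classes]. *)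
Definition sclosed X := forall e, deleted e -> bd X e = false.

(** Exactly two triangles contain a deleted edge, so a boundary that vanishes there uses both or
    neither. *)
Lemma sclosed_share X t t' : X \subset T -> sclosed X -> share t t' -> (t \in X) = (t' \in X).
Proof.
move=> XT cX /and3P[tT t'T /existsP[e /and3P[de et et']]].
have [->//|ne] := eqVneq t t'.
have /and3P[eE _ _] := de.
have E : [set s in T | e \subset s] = [set t; t'].
  apply/esym/eqP; rewrite eqEcard two_edge // cards2 ne andbT.
  by apply/subsetP => s; rewrite !inE => /orP[]/eqP->; rewrite ?tT ?t'T.
have := cX e de; rewrite /bd.
rewrite (_ : \big[addb/false]_(s in X) _ = (t \in X) (+) (t' \in X)).
  by case: (t \in X); case: (t' \in X).
transitivity ((\big[addb/false]_(s in X) ((s == t) && true)) (+)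
              (\big[addb/false]_(s in X) ((s == t') && true))); last first.
  by rewrite !xor_pred1 !andbT.
rewrite -xorD; apply: eq_bigr => s sX; rewrite !andbT.
have : (s \in [set s in T | e \subset s]) = (s \in [set t; t']) by rewrite E.
rewrite !inE (subsetP XT) //= => ->.
by have [->|_] := eqVneq s t; rewrite ?(negbTE ne).
Qed.

Lemma sclosed_connect X t t' : X \subset T -> sclosed X -> connect share t t' ->
  (t \in X) = (t' \in X).
Proof.
move=> XT cX /connectP[p]; elim: p t => [|s p IH] t /=; first by move=> _ ->.
by move=> /andP[ts sp] E; rewrite (sclosed_share XT cX ts); exact: IH.
Qed.

Lemma clss_sub t : t \in T -> clss t \subset T.
Proof.
move=> tT; apply/subsetP => t'; rewrite inE => /connectP[p].
elim: p t tT => [|s p IH] t tT /=; first by move=> _ ->.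
by move=> /andP[/and3P[_ sT _] sp] E; exact: IH sp E.
Qed.

Lemma clss_closed t : t \in T -> sclosed (clss t).
Proof.
move=> tT e de; have /and3P[eE _ _] := de.
have /cards2P[s [s' [ne E]]] : #|[set s in T | e \subset s]| == 2 by rewrite two_edge.
have hs : s \in [set s in T | e \subset s] by rewrite E !inE eqxx.
have hs' : s' \in [set s in T | e \subset s] by rewrite E !inE eqxx orbT.
move: hs hs'; rewrite !inE => /andP[sT es] /andP[s'T es'].
have ss' : share s s' by rewrite /share /= sT s'T; apply/existsP; exists e; rewrite de es es'.
have Ecl : (s \in clss t) = (s' \in clss t).
  rewrite !inE; apply/idP/idP => h; apply: connect_trans h _; first exact: connect1.
  by rewrite share_sym connect1.
rewrite /bd.
transitivity ((\big[addb/false]_(r in clss t) ((r == s) && true)) (+)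
              (\big[addb/false]_(r in clss t) ((r == s') && true))); last first.
  by rewrite !xor_pred1 !andbT Ecl addbb.
rewrite -xorD; apply: eq_bigr => r rX; rewrite !andbT.
have : (r \in [set s in T | e \subset s]) = (r \in [set s; s']) by rewrite E.
rewrite !inE (subsetP (clss_sub tT)) //= => ->.
by have [->|_] := eqVneq r s; rewrite ?(negbTE ne).
Qed.

Lemma bd_classes X e : X \subset T -> sclosed X ->
  bd X e = \big[addb/false]_(k in classes | k \subset X) bd k e.
Proof.
move=> XT cX; rewrite /bd (partition_big clss (fun k => (k \in classes) && (k \subset X))) /=.
  apply: eq_bigr => k /andP[/imsetP[s sT ->] sX]; apply: eq_bigl => t.
  rewrite inE; apply/andP/idP => [[tX /eqP E]|st].
    have : t \in clss t by rewrite inE connect0.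
    by rewrite E inE.
  split; first by rewrite -(sclosed_connect XT cX st) (subsetP sX) // inE connect0.
  apply/eqP/setP => r; rewrite !inE.
  by rewrite (same_connect share_sym st).
move=> t tX; apply/andP; split; first by apply: imset_f; exact: (subsetP XT).
by apply/subsetP => s; rewrite inE => ts; rewrite -(sclosed_connect XT cX ts).
Qed.

(** The boundary of a face of the minor, as a set of edges of the minor. *)
Definition cbd (k : {set {set V}}) := [set e in R | bd k e].

Definition nclasses := [set k in classes | cbd k != set0].

(** Adding up the degrees of the cycle [bd k] over a branch set counts internal edges twice; what is
    left are the edges of [R] that leave the branch set. *)
Lemma cbd_even k l : k \in classes -> l \in K ->
  \big[addb/false]_(e in cbd k) touch e l = false.
Proof.
move=> /imsetP[t tT ->] lK; set k' := clss t.
have : \big[addb/false]_(x | phi x == Some l) dv (bd k') x = false.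
  rewrite big1 // => x _; apply: dv_bd => // s /(subsetP (clss_sub tT)); exact: Ttri.
rewrite /dv exchange_big /= => H0; rewrite -[RHS]H0 {H0}.
transitivity (\big[addb/false]_(e in R) (bd k' e && touch e l)).
  rewrite [RHS]big_mkcond [LHS]big_mkcond; apply: eq_bigr => e _; rewrite inE.
  by case: (e \in R); case: (bd k' e).
apply/esym; transitivity (\big[addb/false]_(e in edges)
   (bd k' e && \big[addb/false]_(x | phi x == Some l) (x \in e))).
  by apply: eq_bigr => e _; rewrite xor_andl; apply: eq_bigr => x _; rewrite andbC.
transitivity (\big[addb/false]_(e in R)
   (bd k' e && \big[addb/false]_(x | phi x == Some l) (x \in e))).
  apply: xor_sub => e; last exact: R_edges.
  move=> eE /andP[be]; apply: contraLR => nR; apply/negbT.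
  have [|ni] := boolP (internal phi K e); last first.
    by rewrite (clss_closed tT) ?/deleted ?eE ?nR // in be.
  move=> /existsP[m /andP[mK /forallP H]].
  have [u [v [uv Ee]]] := edgesP _ _ eE.
  have [Em|ne] := eqVneq m l; last first.
    rewrite big1 // => x /eqP px; apply/negbTE/negP => xe.
    by have := H x; rewrite xe px /= => /eqP[E]; rewrite E eqxx in ne.
  have nuv := adj_neq adjI uv.
  transitivity ((\big[addb/false]_(x | phi x == Some l) ((x == u) && true)) (+)
   (\big[addb/false]_(x | phi x == Some l) ((x == v) && true))).
    rewrite -xorD; apply: eq_bigr => x _; rewrite Ee !inE !andbT.
    by have [->|_] := eqVneq x u; rewrite ?(negbTE nuv).
  rewrite !xor_pred1 !andbT.
  by have := H u; have := H v; rewrite Ee !inE !eqxx orbT /= -Em => -> ->.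
by apply: eq_bigr => e eR; rewrite touch_sum.
Qed.

(** Double counting: an edge of [R] lies on two triangles, hence on the boundary of at most two
    classes, while [girth] gives each nonempty boundary at least [g] edges. *)
Lemma nclasses_card : g * #|nclasses| <= 2 * #|R|.
Proof.
apply: leq_trans (_ : \sum_(k in nclasses) #|cbd k| <= _).
  rewrite mulnC -sum_nat_const; apply: leq_sum => k; rewrite inE => /andP[kc ne].
  apply: girth => // [|l lK]; first by apply/subsetP => e; rewrite inE => /andP[].
  exact: cbd_even.
under eq_bigr => k _ do rewrite -sum1dep_card big_mkcondr /=.
rewrite exchange_big /= mulnC -sum_nat_const; apply: leq_sum => e eR.
rewrite -big_mkcondr sum1dep_card.
apply: leq_trans (_ : #|clss @: [set t in T | e \subset t]| <= _); last first.
  by apply: leq_trans (leq_imset_card _ _) _; rewrite two_edge // R_edges.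
apply: subset_leq_card; apply/subsetP => k; rewrite !inE => /andP[/andP[/imsetP[t tT ->] _] be].
have [s /andP[ts es]] : exists s, (s \in clss t) && (e \subset s).
  apply/existsP; apply: contraTT be => /existsPn no; rewrite /bd big1 // => s st.
  by have := no s; rewrite st => /negbTE.
have sT := subsetP (clss_sub tT) s ts.
apply/imsetP; exists s; first by rewrite inE sT es.
apply/setP => r; rewrite !inE; rewrite inE in ts; exact: (same_connect share_sym ts).
Qed.

(** The cycle space of the minor. *)
Definition qeven := [set A in powerset R |
  [forall k in K, \big[addb/false]_(e in A) touch e k == false]].

Lemma qevenP A : reflect (A \subset R /\
  forall k, k \in K -> \big[addb/false]_(e in A) touch e k = false) (A \in qeven).
Proof.
rewrite !inE; apply: (iffP andP) => -[AR H]; split=> //.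
  by move=> k kK; move/forall_inP: H => /(_ k kK)/eqP.
by apply/forall_inP => k kK; apply/eqP; exact: H.
Qed.

(** A cycle of the minor may be broken inside the branch sets. Each of its ends [v] is joined to the
    root of its branch set by a chain of internal edges; the result is a genuine cycle, and it
    bounds by [span]. *)
Lemma qeven_lift A : A \in qeven -> exists X : {set {set V}},
  [/\ X \subset T, sclosed X & forall e, e \in R -> (e \in A) = bd X e].
Proof.
move=> /qevenP[AR evA].
pose o v := \big[addb/false]_(e in A) (v \in e).
have o_out v : o v -> exists2 k, k \in K & phi v = Some k.
  move=> ov; have [e /andP[eA ve]] : exists e, (e \in A) && (v \in e).
    apply/existsP; apply: contraTT ov => /existsPn no; rewrite /o big1 // => e eA.
    by have := no e; rewrite eA => /negbTE.
  have [u [w [k [l [_ Ee kK lK [_ pu pw]]]]]] := Redge (subsetP AR _ eA).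
  by move: ve; rewrite Ee !inE => /orP[]/eqP->; [exists k | exists l].
pose rt v := if phi v is Some k then root k else v.
pose cP v (Q : {set {set V}}) := [&& Q \subset edges, [forall e in Q, internal phi K e] &
  [forall x, \big[addb/false]_(e in Q) (x \in e) == (x == v) (+) (x == rt v)]].
pose Q v := odflt set0 [pick Q | cP v Q].
have QP v : o v -> [/\ Q v \subset edges, forall e, e \in Q v -> internal phi K e &
    forall x, \big[addb/false]_(e in Q v) (x \in e) = (x == v) (+) (x == rt v)].
  move=> /o_out[k kK pv]; rewrite /Q; case: pickP => [Q' /and3P[h1 h2 h3]|no] /=.
    split=> // [e eQ|x]; first by move/forall_inP: h2; apply.
    by move/forallP: h3 => /(_ x)/eqP.
  have [Q' [h1 h2 h3]] := path_chain kK (conn kK pv).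
  have /negP[] := negbT (no Q'); apply/and3P; split=> //; first exact/forall_inP.
  by apply/forallP => x; rewrite h3 /rt pv.
pose J e := \big[addb/false]_v (o v && (e \in Q v)).
have Jint e : J e -> internal phi K e.
  move=> Je; have [v /andP[ov eQ]] : exists v, o v && (e \in Q v).
    apply/existsP; apply: contraTT Je => /existsPn no; rewrite /J big1 // => v _.
    exact/negbTE.
  by have [_ H _] := QP v ov; exact: H.
have Rint e : e \in R -> internal phi K e = false.
  move=> /Redge[u [v [k [l [_ -> kK lK [kl pu pv]]]]]].
  apply/negbTE/negP => /existsP[m /andP[_ /forallP H]].
  have := H u; have := H v; rewrite !inE !eqxx orbT /= pu pv => /eqP[E1] /eqP[E2].
  by rewrite E1 E2 eqxx in kl.
have evJ x : dv J x = o x.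
  rewrite /dv.
  transitivity (\big[addb/false]_v (o v && ((x == v) (+) (x == rt v)))).
    transitivity (\big[addb/false]_(e in edges) \big[addb/false]_v (o v && ((e \in Q v) && (x \in e)))).
      by apply: eq_bigr => e _; rewrite /J xor_andl; apply: eq_bigr => v _;
        case: (x \in e); case: (o v); rewrite ?andbT ?andbF.
    rewrite exchange_big; apply: eq_bigr => v _ /=; rewrite -xor_andl.
    have [ov|//] := boolP (o v); rewrite /=; have [h1 _ <-] := QP v ov.
    rewrite [RHS]big_mkcond [LHS]big_mkcond; apply: eq_bigr => e _.
    have [eQ|] := boolP (e \in Q v); last by case: (e \in edges).
    by rewrite (subsetP h1 _ eQ).
  under eq_bigr => v _ do rewrite andb_addr.
  rewrite xorD; transitivity (o x (+) false); last by rewrite addbF.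
  congr addb.
    transitivity (\big[addb/false]_(v | true) ((v == x) && o v)); last by rewrite xor_pred1.
    by apply: eq_bigr => v _; rewrite andbC eq_sym.
  (* The chains reach each root as often as the cycle has ends in its branch set, an even number of
     times, so the roots cancel. *)
  transitivity (\big[addb/false]_(k in K) \big[addb/false]_(v | phi v == Some k) (o v && (x == root k))).
    rewrite (exchange_big_dep xpredT) //=; apply: eq_bigr => v _.
    have [ov|nov] := boolP (o v); last by rewrite big1.
    have [k kK pv] := o_out v ov; rewrite /rt pv /=.
    transitivity (\big[addb/false]_(k' in K) ((k' == k) && (x == root k'))).
      by rewrite xor_pred1 kK.
    rewrite [RHS]big_mkcond [LHS]big_mkcond; apply: eq_bigr => k' _.
    have [->|ne] := eqVneq k' k; first by rewrite eqxx andbT.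
    rewrite (_ : (Some k == Some k') = false) ?andbF /=; first by case: (k' \in K).
    by apply/negbTE/negP => /eqP[E]; rewrite E eqxx in ne.
  rewrite big1 // => k kK; rewrite -xor_andr.
  rewrite (_ : \big[addb/false]_(v | _) o v = false) // /o exchange_big /=.
  rewrite -[RHS](evA k kK); apply: eq_bigr => e eA; apply: touch_sum; exact: (subsetP AR).
pose C e := (e \in A) (+) J e.
have [v|X [XT XE]] := span (C := C).
  rewrite /dv; under eq_bigr => e _ do rewrite /C andb_addr.
  rewrite xorD -/(dv J v) evJ (_ : \big[addb/false]_(e in edges) _ = o v) ?addbb //.
  rewrite /o [RHS]big_mkcond [LHS]big_mkcond; apply: eq_bigr => e _.
  have [eA|] := boolP (e \in A); last by rewrite andbF; case: (e \in edges).
  by rewrite (R_edges (subsetP AR _ eA)) andbT.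
exists X; split=> //.
  move=> e /and3P[eE eR ei]; rewrite -XE // /C.
  rewrite (negbTE (contra (subsetP AR e) eR)) /=; apply/negbTE; exact: contra (Jint e) ei.
move=> e eR; rewrite -XE ?R_edges // /C.
rewrite (_ : J e = false) ?addbF //; apply/negbTE/negP => /Jint; by rewrite Rint.
Qed.

Lemma touch_pair u v k l m : phi u = Some k -> phi v = Some l ->
  touch [set u; v] m = (m == k) || (m == l).
Proof.
move=> pu pv; apply/existsP/orP => [[x]|].
  by rewrite !inE => /andP[/orP[]/eqP-> /eqP]; rewrite ?pu ?pv => -[->]; [left | right].
by move=> [/eqP->|/eqP->]; [exists u | exists v]; rewrite !inE eqxx ?orbT ?pu ?pv /=.
Qed.

Lemma touch_ends e : e \in R -> exists k l,
  [/\ k \in K, l \in K, k != l & forall m, touch e m = (m == k) || (m == l)].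
Proof.
move=> /Redge[u [v [k [l [_ -> kK lK [kl pu pv]]]]]].
by exists k, l; split=> // m; exact: touch_pair.
Qed.

Lemma touch_handshake e : e \in R -> \big[addb/false]_(k in K) touch e k = false.
Proof.
move=> /touch_ends[k [l [kK lK kl E]]].
transitivity ((\big[addb/false]_(m in K) ((m == k) && true)) (+)
   (\big[addb/false]_(m in K) ((m == l) && true))); last by rewrite !xor_pred1 kK lK.
rewrite -xorD; apply: eq_bigr => m _; rewrite E !andbT.
by have [->|_] := eqVneq m k; rewrite ?(negbTE kl).
Qed.

(** Rank and nullity: degree parities at all labels but [k0] form a linear map on the subsets of
    [R]. A nonempty fibre is a translate of [qeven], since the parity at [k0] follows from the
    handshake identity. *)
Lemma qeven_card_ge k0 : k0 \in K -> 2 ^ #|R| <= #|qeven| * 2 ^ #|K|.-1.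
Proof.
move=> k0K; rewrite -card_powerset.
have -> : 2 ^ #|K|.-1 = #|powerset (K :\ k0)|.
  by rewrite card_powerset; have := cardsD1 k0 K; rewrite k0K add1n => ->.
pose f A := [set k in K :\ k0 | \big[addb/false]_(e in A) touch e k].
apply: (card_le_fibers (f := f)).
  by move=> A _; rewrite inE; apply/subsetP => k; rewrite inE => /andP[].
move=> y _; set S := [set A in powerset R | f A == y].
have [->|/set0Pn[A0 A0S]] := eqVneq S set0; first by rewrite cards0.
have -> : #|S| = #|[set sdiff A A0 | A in S]|.
  by rewrite card_imset //; apply: (@can_inj _ _ _ (fun B => sdiff B A0)) => B; exact: sdiffK.
apply: subset_leq_card; apply/subsetP => _ /imsetP[A AS ->].
move: A0S AS; rewrite !inE => /andP[A0R /eqP E0] /andP[AR /eqP E].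
have ev k : k \in K -> k != k0 -> \big[addb/false]_(e in sdiff A A0) touch e k = false.
  move=> kK ne; rewrite xor_sdiff.
  have : (k \in f A) = (k \in f A0) by rewrite E E0.
  by rewrite !inE ne kK /= => ->; rewrite addbb.
have sR : sdiff A A0 \subset R by exact: sdiff_sub.
rewrite sR /=; apply/forall_inP => k kK; apply/eqP.
have [->|ne] := eqVneq k k0; last exact: ev.
have : \big[addb/false]_(m in K) \big[addb/false]_(e in sdiff A A0) touch e m = false.
  by rewrite exchange_big big1 //= => e eS; apply: touch_handshake; exact: (subsetP sR).
rewrite (bigD1 k0) //= (big1 _ (fun m => (m \in K) && (m != k0))) ?addbF //.
by move=> m /andP[]; exact: ev.
Qed.

(** The class boundaries span the cycle space, and they satisfy one relation because [T] has zero
    boundary: passing from [X] to its complement in [T] avoids the class [k0]. *)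
Lemma qeven_card_le : #|qeven| <= 2 ^ #|nclasses|.-1.
Proof.
pose F (S : {set {set {set V}}}) := [set e in R | \big[addb/false]_(k in S) bd k e].
have key A : A \in qeven -> exists2 X : {set {set V}}, X \subset T /\ sclosed X &
     A = F [set k in nclasses | k \subset X].
  move=> AQ; have [X [XT cX XE]] := qeven_lift AQ; exists X => //.
  apply/setP => e; rewrite inE; have [eR|eR] := boolP (e \in R); last first.
    by apply/negbTE; move/qevenP: AQ => [/subsetP AR _]; exact: contra (AR e) eR.
  rewrite XE //= bd_classes //.
  rewrite big_mkcond [RHS]big_mkcond; apply: eq_bigr => k _; rewrite !inE.
  have [kc|//] := boolP (k \in classes); rewrite /=.
  have [E0|_] := eqVneq (cbd k) set0; last by [].
  have : e \notin cbd k by rewrite E0 inE.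
  by rewrite inE eR /= => /negbTE ->; case: (k \subset X).
have [E0|/set0Pn[k0 k0N]] := eqVneq nclasses set0.
  rewrite E0 cards0; have -> : 2 ^ 0.-1 = #|[set F set0]| by rewrite cards1.
  apply: subset_leq_card; apply/subsetP => A /key[X _ ->]; rewrite inE; apply/eqP; congr F.
  by apply/setP => k; rewrite E0 !inE.
have -> : 2 ^ #|nclasses|.-1 = #|powerset (nclasses :\ k0)|.
  by rewrite card_powerset; have := cardsD1 k0 nclasses; rewrite k0N add1n => ->.
apply: leq_trans (leq_imset_card F _).
apply: subset_leq_card; apply/subsetP => A AQ; have [X [XT cX] EA] := key A AQ.
suff [Y [YT cY EY nY]] : exists Y : {set {set V}}, [/\ Y \subset T, sclosed Y,
     A = F [set k in nclasses | k \subset Y] & ~~ (k0 \subset Y)].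
  apply/imsetP; exists [set k in nclasses | k \subset Y] => //; rewrite inE.
  apply/subsetP => k; rewrite !inE => /andP[-> kY]; rewrite andbT.
  by apply: contra nY => /eqP <-.
have [k0X|] := boolP (k0 \subset X); last by exists X.
have k0c : k0 \in classes by move: k0N; rewrite inE => /andP[].
have [t0 t0T Ek0] := imsetP k0c.
have t0k : t0 \in k0 by rewrite Ek0 inE connect0.
have cY : sclosed (T :\: X).
  move=> e de; have /and3P[eE _ _] := de.
  have : bd (sdiff T X) e = false by rewrite /bd xor_sdiff -/(bd T e) -/(bd X e) bd_all // cX.
  by rewrite /sdiff (_ : X :\: T = set0) ?setU0 //; apply/eqP; rewrite setD_eq0.
have YT : T :\: X \subset T by exact: subsetDl.
exists (T :\: X); split=> //; last first.
  by apply/negP => /subsetP/(_ t0 t0k); rewrite inE (subsetP k0X).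
rewrite EA; apply/setP => e; rewrite !inE; have [eR|//] := boolP (e \in R) => /=.
have expand (Z : {set {set V}}) : Z \subset T -> sclosed Z ->
    \big[addb/false]_(k in [set k in nclasses | k \subset Z]) bd k e = bd Z e.
  move=> ZT cZ; rewrite bd_classes //.
  rewrite big_mkcond [RHS]big_mkcond; apply: eq_bigr => k _; rewrite !inE.
  have [kc|//] := boolP (k \in classes); rewrite /=.
  have [E0|_] := eqVneq (cbd k) set0; last by [].
  have : e \notin cbd k by rewrite E0 inE.
  by rewrite inE eR /= => /negbTE ->; case: (k \subset Z).
rewrite !expand //.
have : bd (sdiff T X) e = bd X e by rewrite /bd xor_sdiff -/(bd T e) bd_all // R_edges.
by rewrite /sdiff (_ : X :\: T = set0) ?setU0 //; apply/eqP; rewrite setD_eq0.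
Qed.

(** Euler's inequality [|R| - |K| + 1 <= f - 1], with [f] the number of faces of nonempty boundary,
    combined with [g * f <= 2 * |R|]. The second alternative is [f = 0], when the minor is a
    forest. *)
Theorem sparse_bound : 0 < #|K| ->
  g * (#|R| + 2) <= 2 * #|R| + g * #|K| \/ #|R| < #|K|.
Proof.
move=> /card_gt0P[k0 k0K]; have K0 : 0 < #|K| by apply/card_gt0P; exists k0.
have h1 := qeven_card_ge k0K; have h2 := qeven_card_le; have h3 := nclasses_card.
have : 2 ^ #|R| <= 2 ^ (#|nclasses|.-1 + #|K|.-1).
  by rewrite expnD; apply: leq_trans h1 _; rewrite leq_mul2r h2 orbT.
rewrite leq_exp2l // => h4.
have [n0|n0] := posnP #|nclasses|; first by right; rewrite n0 in h4; lia.
left; nia.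
Qed.

Lemma even_other A e k : \big[addb/false]_(e in A) touch e k = false -> e \in A -> touch e k ->
  exists e', [/\ e' \in A, e' != e & touch e' k].
Proof.
move=> ev eA te; move: ev; rewrite (bigD1 e) //= te => ev.
have [e' /and3P[h1 h2 h3]] : exists e', [&& e' \in A, e' != e & touch e' k]; last by exists e'.
apply/existsP; apply: contraFT ev => /existsPn no; rewrite big1 // => e' /andP[e'A ne].
by have := no e'; rewrite e'A ne => /negbTE.
Qed.

Hypothesis simple : forall e e', e \in R -> e' \in R ->
  (forall k, k \in K -> touch e k = touch e' k) -> e = e'.

Lemma same_ends e e' k l : e \in R -> e' \in R -> k != l ->
  touch e k -> touch e l -> touch e' k -> touch e' l -> e = e'.
Proof.
move=> eR e'R kl.
have [a [b [_ _ _ H]]] := touch_ends eR; have [a' [b' [_ _ _ H']]] := touch_ends e'R.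
rewrite !H !H' => /orP[]/eqP? /orP[]/eqP? /orP[]/eqP? /orP[]/eqP?; subst; rewrite ?eqxx // in kl;
  by apply: simple => // m _; rewrite H H' // orbC.
Qed.

(** An even set contains, besides [e], a further edge at each end of [e]; without parallel edges
    these two differ. *)
Lemma simple_girth A : A \subset R -> A != set0 ->
  (forall k, k \in K -> \big[addb/false]_(e in A) touch e k = false) -> 3 <= #|A|.
Proof.
move=> /subsetP AR /set0Pn[e eA] ev.
have [k [l [kK lK kl H]]] := touch_ends (AR e eA).
have ek : touch e k by rewrite H eqxx.
have el : touch e l by rewrite H eqxx orbT.
have [e2 [e2A n2 t2]] := even_other (ev k kK) eA ek.
have [e3 [e3A n3 t3]] := even_other (ev l lK) eA el.
have n23 : e2 != e3.
  apply/negP => /eqP E; subst e3; move/eqP: n2; apply.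
  by apply: (@same_ends _ _ k l) => //; exact: AR.
apply: leq_trans (_ : #|[set e; e2; e3]| <= _); last first.
  by apply: subset_leq_card; apply/subsetP => x; rewrite !inE -orbA => /or3P[]/eqP->.
by rewrite setUC cardsU1 cards2 !inE negb_or ![e3 == _]eq_sym n23 ![e == _]eq_sym n2 n3.
Qed.

(** A fourth edge comes from the far end [l2] of the second one. Were it equal to the third, the
    labels [k], [l], [l2] would be pairwise on different sides. *)
Lemma bipartite_girth (side : pred L) A :
  (forall e k l, e \in R -> k != l -> touch e k -> touch e l -> side k != side l) ->
  A \subset R -> A != set0 ->
  (forall k, k \in K -> \big[addb/false]_(e in A) touch e k = false) -> 4 <= #|A|.
Proof.
move=> bip /subsetP AR /set0Pn[e eA] ev.
have [k [l [kK lK kl H]]] := touch_ends (AR e eA).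
have ek : touch e k by rewrite H eqxx.
have el : touch e l by rewrite H eqxx orbT.
have [e2 [e2A n2 t2]] := even_other (ev k kK) eA ek.
have [e3 [e3A n3 t3]] := even_other (ev l lK) eA el.
have n23 : e2 != e3.
  apply/negP => /eqP E; subst e3; move/eqP: n2; apply.
  by apply: (@same_ends _ _ k l) => //; exact: AR.
have [l2 l2K [l2k t2']] : exists2 l2, l2 \in K & l2 != k /\ touch e2 l2.
  have [a [b [aK bK ab H2]]] := touch_ends (AR e2 e2A).
  move: t2; rewrite H2 => /orP[]/eqP Ek; subst k.
    by exists b; rewrite // eq_sym ab H2 eqxx orbT.
  by exists a; rewrite // ab H2 eqxx.
have [e4 [e4A n4 t4]] := even_other (ev l2 l2K) e2A t2'.
have s1 := bip e k l (AR _ eA) kl ek el.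
have s2 := bip e2 k l2 (AR _ e2A) (_ : k != l2) t2 t2'.
rewrite eq_sym l2k in s2; have {}s2 := s2 isT.
have l2l : l2 != l.
  apply/negP => /eqP E; subst l2; move/eqP: n2; apply.
  by apply: (@same_ends _ _ k l) => //; exact: AR.
have n4e : e4 != e.
  apply/negP => /eqP E; subst e4; move: t4; rewrite H => /orP[]/eqP E; subst l2.
    by rewrite eqxx in l2k.
  by rewrite eqxx in l2l.
have n43 : e4 != e3.
  apply/negP => /eqP E; subst e4.
  have := bip e3 l l2 (AR _ e3A) (_ : l != l2) t3 t4; rewrite eq_sym l2l => /(_ isT).
  by move: s1 s2; case: (side k); case: (side l); case: (side l2).
apply: leq_trans (_ : #|e4 |: [set e; e2; e3]| <= _); last first.
  by apply: subset_leq_card; apply/subsetP => x; rewrite !inE -orbA => /or4P[]/eqP->.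
rewrite cardsU1 !inE !negb_or n4e n4 n43.
by rewrite setUC cardsU1 cards2 !inE negb_or ![e3 == _]eq_sym n23 ![e == _]eq_sym n2 n3.
Qed.
End Bound.
End Sparse.

(** * Colouring with five colours *)

Section Handshake.
Variables (V : finType) (adj : rel V).
Hypotheses (adjC : symmetric adj) (adjI : irreflexive adj).

Definition nb v := [set u | adj v u].

Lemma in_nb u v : (u \in nb v) = adj v u.
Proof. by rewrite inE. Qed.

Lemma nb_edges v : #|nb v| = #|[set e in edges adj | v \in e]|.
Proof.
have -> : [set e in edges adj | v \in e] = [set [set v; u] | u in nb v].
  apply/setP => e; apply/idP/imsetP.
    move=> /setIdP[/edgesP[a [b [ab ->]]]].
    rewrite !inE => /orP[]/eqP->; first by exists b; rewrite ?in_nb.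
    by exists a; rewrite ?in_nb ?[adj b a]adjC // setUC.
  move=> [u]; rewrite in_nb => vu ->; apply/setIdP; split; first exact: mem_edges.
  by rewrite !inE eqxx.
rewrite card_in_imset // => a b; rewrite !in_nb => va vb /set2_eq[[_ //]|[Ev Ea]].
by rewrite -Ev adjI in vb.
Qed.

Lemma handshake : \sum_v #|nb v| = 2 * #|edges adj|.
Proof.
under eq_bigr => v _ do rewrite nb_edges -sum1dep_card big_mkcondr /=.
rewrite exchange_big /= mulnC -sum_nat_const; apply: eq_bigr => e /edgesP[a [b [ab ->]]].
rewrite -big_mkcond sum1dep_card (_ : [set _ | _] = [set a; b]).
  by rewrite cards2 (adj_neq adjI ab).
by apply/setP => x; rewrite !inE.
Qed.
End Handshake.

(** * Planar edge bounds and five colours for minors *)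

Section Planarity.
Variables (V : finType) (adj : rel V).
Hypotheses (adjC : symmetric adj) (adjI : irreflexive adj).
Variable T : {set {set V}}.
Hypothesis Ttri : forall t, t \in T -> is_tri adj t.
Hypothesis two : forall u v, adj u v -> #|[set t in T | [set u; v] \subset t]| = 2.
Hypothesis span : forall C, (forall v, dv adj C v = false) ->
  exists X : {set {set V}}, X \subset T /\ forall e, e \in edges adj -> C e = bd X e.

(** [sparse_bound] at girth 4: the branch sets are single vertices of [X] and [Y], other vertices
    are deleted, and only edges between the two sides are kept. The bound [3 <= #|X| + #|Y|] settles
    the forest alternative. *)
Lemma bip_bound (X Y : {set V}) : [disjoint X & Y] -> 3 <= #|X| + #|Y| ->
  \sum_(x in X) #|[set y in Y | adj x y]| + 4 <= 2 * (#|X| + #|Y|).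
Proof.
move=> dXY m3.
have XY v : v \in X -> v \in Y = false by move=> vX; rewrite (disjointFr dXY).
pose K := X :|: Y.
have cK : #|K| = #|X| + #|Y| by rewrite cardsU disjoint_setI0 // cards0 subn0.
pose phi v := if v \in K then Some v else None.
pose E2 := [set p : V * V | [&& p.1 \in X, p.2 \in Y & adj p.1 p.2]].
pose R := [set [set p.1; p.2] | p in E2].
have cR : #|R| = \sum_(x in X) #|[set y in Y | adj x y]|.
  rewrite card_in_imset; last first.
    move=> [a b] [a' b']; rewrite !inE /= => /and3P[aX bY _] /and3P[a'X b'Y _].
    move=> /set2_eq[[-> -> //]|[E _]]; by rewrite -E XY in b'Y.
  rewrite -sum1dep_card (eq_bigl (fun p : V * V => (p.1 \in X) && ((p.2 \in Y) && adj p.1 p.2))) //.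
  rewrite -(pair_big_dep (mem X) (fun x y => (y \in Y) && adj x y) (fun _ _ => 1)) /=.
  by apply: eq_bigr => x _; rewrite sum1dep_card.
have phiK v : v \in K -> phi v = Some v by rewrite /phi => ->.
have RP e : e \in R -> exists u v k l, [/\ adj u v, e = [set u; v], k \in K, l \in K &
    [/\ k != l, phi u = Some k & phi v = Some l]].
  move=> /imsetP[[a b]]; rewrite inE /= => /and3P[aX bY ab] ->.
  exists a, b, a, b; rewrite !phiK ?inE ?aX ?bY ?orbT //; split=> //; split=> //.
  exact: adj_neq.
have tch e k : touch phi e k -> k \in K /\ k \in e.
  move=> /existsP[v /andP[ve]]; rewrite /phi; case: ifP => // vK /eqP[<-] //.
have tchP a b k : a \in X -> b \in Y -> touch phi [set a; b] k = (k == a) || (k == b).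
  by move=> aX bY; rewrite (@touch_pair _ _ _ a b a b) // phiK // inE ?aX ?bY ?orbT.
have smp e e' : e \in R -> e' \in R -> (forall k, k \in K -> touch phi e k = touch phi e' k) -> e = e'.
  move=> /imsetP[[a b]]; rewrite inE /= => /and3P[aX bY _] ->.
  move=> /imsetP[[a' b']]; rewrite inE /= => /and3P[a'X b'Y _] -> H.
  apply/setP => k; rewrite !inE -!tchP //.
  have [kK|kK] := boolP (k \in K); first exact: H.
  by rewrite !tchP //; apply/idP/idP => /orP[]/eqP E; subst k; rewrite !inE ?aX ?bY ?a'X ?b'Y ?orbT in kK.
have bip e k l : e \in R -> k != l -> touch phi e k -> touch phi e l -> (k \in X) != (l \in X).
  move=> /imsetP[[a b]]; rewrite inE /= => /and3P[aX bY _] -> kl; rewrite !tchP //.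
  have bX : b \in X = false by apply: contraTF bY => bX; rewrite XY.
  by move=> /orP[]/eqP? /orP[]/eqP?; subst; rewrite ?eqxx ?aX ?bX // in kl *.
have K0 : 0 < #|K| by lia.
have conn k v : k \in K -> phi v = Some k -> connect (fibrel adj phi k) v (id k).
  by move=> _; rewrite /phi; case: ifP => // _ [->]; exact: connect0.
have gi (A : {set {set V}}) : A \subset R -> A != set0 -> (forall k, k \in K ->
   \big[addb/false]_(e in A) touch phi e k = false) -> 4 <= #|A|.
  by move=> h1 h2 h3; exact: (bipartite_girth RP smp bip h1 h2 h3).
have := sparse_bound adjI Ttri two span conn RP gi K0; rewrite cK cR; lia.
Qed.

(** A branch set is named after one of its own vertices, to which all others are joined inside it;
    [None] marks deleted vertices. *)
Definition minor_model (phi : V -> option V) := forall v k, phi v = Some k ->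
  phi k = Some k /\ connect (fibrel adj phi k) v k.

Definition labels (phi : V -> option V) := [set k | phi k == Some k].

Definition qadj (phi : V -> option V) : rel V := fun k l => (k != l) &&
  [exists u, exists v, [&& adj u v, phi u == Some k & phi v == Some l]].

Lemma qadjC phi : symmetric (qadj phi).
Proof.
move=> k l; rewrite /qadj eq_sym; congr andb.
by apply/existsP/existsP => -[u /existsP[v /and3P[uv pu pv]]]; exists v; apply/existsP; exists u;
  rewrite adjC uv pu pv.
Qed.

Lemma qadjI phi : irreflexive (qadj phi).
Proof. by move=> k; rewrite /qadj eqxx. Qed.

Lemma qadjP phi k l : reflect (k != l /\ exists u v, [/\ adj u v, phi u = Some k & phi v = Some l])
  (qadj phi k l).
Proof.
apply: (iffP andP) => -[kl].
  by move=> /existsP[u /existsP[v /and3P[uv /eqP pu /eqP pv]]]; split=> //; exists u, v.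
by move=> [u [v [uv pu pv]]]; split=> //; apply/existsP; exists u; apply/existsP; exists v; rewrite uv pu pv !eqxx.
Qed.

Lemma qadj_labels phi k l : minor_model phi -> qadj phi k l -> k \in labels phi /\ l \in labels phi.
Proof.
move=> mm /qadjP[_ [u [v [_ /mm[pk _] /mm[pl _]]]]].
by rewrite !inE pk pl !eqxx.
Qed.

(** [sparse_bound] at girth 3. Parallel edges are avoided by picking one edge [rep q] of the graph
    for every edge [q] of the minor. *)
Lemma minor_bound phi : minor_model phi -> 3 <= #|labels phi| ->
  #|edges (qadj phi)| + 6 <= 3 * #|labels phi|.
Proof.
move=> mm m3; set K := labels phi; set Q := edges (qadj phi).
rewrite -/K in m3.
pose lab e := [set k | touch phi e k].
pose rep q : {set V} := odflt set0 [pick e in edges adj | lab e == q].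
have labP u v k l : phi u = Some k -> phi v = Some l -> lab [set u; v] = [set k; l].
  by move=> pu pv; apply/setP => m; rewrite !inE (@touch_pair _ _ _ u v k l).
have repP q : q \in Q -> exists u v k l, [/\ qadj phi k l, rep q = [set u; v], adj u v, q = [set k; l]
     & [/\ phi u = Some k, phi v = Some l & lab (rep q) = q]].
  move=> /edgesP[k [l [kl Eq]]].
  have : rep q \in edges adj /\ lab (rep q) = q.
    rewrite /rep; case: pickP => [e /andP[eE /eqP le]|no] //=.
    have /qadjP[_ [u [v [uv pu pv]]]] := kl.
    by have := no [set u; v]; rewrite mem_edges // (labP _ _ k l) // Eq eqxx.
  move=> [/edgesP[u [v [uv Er]]] Elab].
  have /qadjP[nkl _] := kl.
  have hk : touch phi [set u; v] k.
    have : k \in lab (rep q) by rewrite Elab Eq !inE eqxx.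
    by rewrite Er inE.
  have hl : touch phi [set u; v] l.
    have : l \in lab (rep q) by rewrite Elab Eq !inE eqxx orbT.
    by rewrite Er inE.
  move/existsP: hk => [x /andP[]]; rewrite !inE => /orP[]/eqP-> /eqP px;
  move/existsP: hl => [y /andP[]]; rewrite !inE => /orP[]/eqP-> /eqP py.
  - by move: py; rewrite px => -[E]; rewrite E eqxx in nkl.
  - by exists u, v, k, l; split.
  - by exists u, v, l, k; split; rewrite // ?[qadj phi l k]qadjC // Eq setUC.
  - by move: py; rewrite px => -[E]; rewrite E eqxx in nkl.
pose R := [set rep q | q in Q].
have cR : #|R| = #|Q|.
  rewrite card_in_imset // => q q' /repP[u [v [k [l [_ _ _ _ [_ _ h]]]]]] /repP[u' [v' [k' [l' [_ _ _ _ [_ _ h']]]]]] E.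
  by rewrite -h -h' E.
have RP e : e \in R -> exists u v k l, [/\ adj u v, e = [set u; v], k \in K, l \in K &
    [/\ k != l, phi u = Some k & phi v = Some l]].
  move=> /imsetP[q /repP[u [v [k [l [kl Er uv _ [pu pv _]]]]]] ->].
  have [kK lK] := qadj_labels mm kl; have /qadjP[nkl _] := kl.
  by exists u, v, k, l.
have smp e e' : e \in R -> e' \in R -> (forall k, k \in K -> touch phi e k = touch phi e' k) -> e = e'.
  move=> eR e'R H.
  have sub e0 : e0 \in R -> lab e0 \subset K.
    move=> /RP[u [v [k [l [_ -> kK lK [_ pu pv]]]]]].
    by rewrite (labP _ _ k l) // subset_pair kK lK.
  have E : lab e = lab e'.
    apply/setP => k; have [kK|kK] := boolP (k \in K); first by rewrite !inE H.
    by rewrite !(contraNF (subsetP (sub _ _) k) kK).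
  move: E; move/imsetP: eR => [q /repP[_ [_ [_ [_ [_ _ _ _ [_ _ h]]]]]] ->].
  move/imsetP: e'R => [q' /repP[_ [_ [_ [_ [_ _ _ _ [_ _ h']]]]]] ->].
  by rewrite h h' => ->.
have conn k v : k \in K -> phi v = Some k -> connect (fibrel adj phi k) v (id k).
  by move=> _ /mm[].
have K0 : 0 < #|K| by lia.
have gi (A : {set {set V}}) : A \subset R -> A != set0 -> (forall k, k \in K ->
   \big[addb/false]_(e in A) touch phi e k = false) -> 3 <= #|A|.
  by move=> h1 h2 h3; exact: (simple_girth RP smp h1 h2 h3).
have := sparse_bound adjI Ttri two span conn RP gi K0; rewrite cR; lia.
Qed.

Lemma fresh_color (A : {set 'I_5}) : #|A| <= 4 -> exists i, i \notin A.
Proof.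
move=> cA; apply/existsP; apply: contraTT cA => /existsPn H; rewrite -ltnNge.
have -> : A = setT by apply/setP => i; rewrite inE; apply/negPn; exact: H.
by rewrite cardsT card_ord.
Qed.

Lemma degree_le5 phi : minor_model phi -> 3 <= #|labels phi| ->
  exists2 k, k \in labels phi & #|nb (qadj phi) k| <= 5.
Proof.
move=> mm m3.
have [k /andP[kK dk]|no] := pickP [pred k in labels phi | #|nb (qadj phi) k| <= 5].
  by exists k.
have h1 := minor_bound mm m3.
have h2 := handshake (@qadjC phi) (@qadjI phi).
have : 6 * #|labels phi| <= \sum_v #|nb (qadj phi) v|.
  rewrite mulnC -sum_nat_const [leqRHS](bigID (mem (labels phi))) /=.
  apply: leq_trans (leq_addr _ _); apply: leq_sum => k kK.
  by have /= := no k; rewrite kK /= => /negbT; rewrite -ltnNge.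
lia.
Qed.

Lemma fibrel_sym (phi : V -> option V) k : connect_sym (fibrel adj phi k).
Proof.
by apply: sym_connect_sym => x y; rewrite /fibrel /= adjC [(phi x == _) && _]andbC.
Qed.

Lemma fibrel_eq (phi psi : V -> option V) k :
  (forall v, (phi v == Some k) = (psi v == Some k)) -> fibrel adj phi k =2 fibrel adj psi k.
Proof. by move=> H x y; rewrite /fibrel /= !H. Qed.

Definition restrict (phi : V -> option V) (K : {set V}) v :=
  if phi v is Some k then (if k \in K then Some k else None) else None.

Lemma restrictE phi (K : {set V}) v k : (restrict phi K v == Some k) = (k \in K) && (phi v == Some k).
Proof.
rewrite /restrict; case: (phi v) => [l|]; last by rewrite andbF.
case: ifP => lK; last first.
  by apply/esym/negbTE/negP => /andP[kK /eqP[E]]; rewrite -E lK in kK.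
by apply/idP/andP => [/eqP[<-]|[_ /eqP[->]]].
Qed.

Lemma restrict_model phi (K : {set V}) : minor_model phi -> minor_model (restrict phi K).
Proof.
move=> mm v k /eqP; rewrite restrictE => /andP[kK /eqP pv]; have [pk ck] := mm v k pv.
split; first by apply/eqP; rewrite restrictE kK pk /=.
rewrite (eq_connect (@fibrel_eq _ phi k _)) // => w.
by rewrite restrictE kK.
Qed.

Lemma restrict_labels phi (K : {set V}) : labels (restrict phi K) = labels phi :&: K.
Proof. by apply/setP => k; rewrite !inE restrictE andbC. Qed.

Lemma restrict_qadj phi (K : {set V}) k l : k \in K -> l \in K -> qadj (restrict phi K) k l = qadj phi k l.
Proof.
move=> kK lK; rewrite /qadj; congr andb; apply: eq_existsb => u; apply: eq_existsb => v.
by rewrite !restrictE kK lK.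
Qed.

(** Otherwise [k] and its neighbours would span a minor with 15 edges on 6 labels, where
    [minor_bound] allows 12. *)
Lemma nb_nonadjacent phi k : minor_model phi -> #|nb (qadj phi) k| = 5 ->
  exists y z, [/\ qadj phi k y, qadj phi k z, y != z & ~~ qadj phi y z].
Proof.
move=> mm d5; pose N := nb (qadj phi) k.
have [/existsP[y /andP[yN /existsP[z /and3P[zN yz nyz]]]]|no] :=
  boolP [exists y in N, [exists z in N, (y != z) && ~~ qadj phi y z]].
  by exists y, z; split=> //; rewrite -in_nb.
have full y z : y \in N -> z \in N -> y != z -> qadj phi y z.
  move=> yN zN yz; apply: contraNT no => nyz; apply/existsP; exists y; rewrite yN.
  by apply/existsP; exists z; rewrite zN yz.
pose K := k |: N.
have kN : k \notin N by rewrite in_nb qadjI.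
have cK : #|K| = 6 by rewrite cardsU1 kN d5.
have KL : K \subset labels phi.
  have [y yN] : exists y, y \in N by apply/card_gt0P; rewrite d5.
  apply/subsetP => z; rewrite !inE => /orP[/eqP->|].
    by move: yN; rewrite in_nb => /(qadj_labels mm)[]; rewrite inE.
  by rewrite -in_nb in_nb => /(qadj_labels mm)[_]; rewrite inE.
have mr := restrict_model (K := K) mm.
have EL : labels (restrict phi K) = K by rewrite restrict_labels; apply/setIidPr.
have := minor_bound mr; rewrite EL cK => /(_ isT).
have := handshake (@qadjC (restrict phi K)) (@qadjI (restrict phi K)).
suff : 30 <= \sum_v #|nb (qadj (restrict phi K)) v| by lia.
rewrite (bigID (mem K)) /=; apply: leq_trans (leq_addr _ _).
apply: leq_trans (_ : \sum_(v in K) 5 <= _); first by rewrite sum_nat_const cK.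
apply: leq_sum => v vK; apply: leq_trans (_ : #|K :\ v| <= _).
  by have := cardsD1 v K; rewrite vK cK; lia.
apply: subset_leq_card; apply/subsetP => w; rewrite in_setD1 in_nb => /andP[wv wK].
rewrite restrict_qadj //.
have in_K x : x \in K -> x = k \/ x \in N by move=> /setU1P.
have vK' := in_K v vK; have wK' := in_K w wK.
case: vK' wK' => [Ev|vN] [Ew|wN].
- by rewrite Ev Ew eqxx in wv.
- by rewrite Ev -in_nb.
- by rewrite Ew qadjC -in_nb.
- by apply: full => //; rewrite eq_sym.
Qed.

(** Contracts the path [y], [k], [z]. The edges [a b] and [a' b'] that witness the two adjacencies
    connect the three old branch sets. *)
Lemma merge_model phi k y z : minor_model phi -> qadj phi k y -> qadj phi k z -> y != z ->
  minor_model (fun v => if (phi v == Some k) || (phi v == Some z) then Some y else phi v).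
Proof.
move=> mm ky kz yz; set psi := fun v => _.
have /qadjP[nky [a [b [ab pa pb]]]] := ky.
have /qadjP[nkz [a' [b' [ab' pa' pb']]]] := kz.
have psiy v : (psi v == Some y) = [|| phi v == Some k, phi v == Some z | phi v == Some y].
  rewrite /psi; case E1: (phi v == Some k) => //=; first by rewrite eqxx.
  by case E2: (phi v == Some z) => //=; rewrite eqxx.
have sub m : m \in [:: k; z; y] -> subrel (connect (fibrel adj phi m)) (connect (fibrel adj psi y)).
  move=> mm3; apply: connect_sub => u v /and3P[uv /eqP pu /eqP pv]; apply: connect1.
  rewrite /fibrel /= uv !psiy pu pv /=; move: mm3; rewrite !inE => /or3P[]/eqP->; by rewrite eqxx ?orbT.
have symc := fibrel_sym psi y.
have ky' v : phi v = Some k -> connect (fibrel adj psi y) v y.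
  move=> pv; apply: connect_trans (sub k _ _ _ (proj2 (mm v k pv))) _; first by rewrite !inE eqxx.
  rewrite symc; apply: connect_trans (_ : connect _ b _); last first.
    apply: connect_trans (_ : connect _ a _).
      by apply: connect1; rewrite /fibrel /= adjC ab !psiy pa pb !eqxx ?orbT.
    by apply: sub (proj2 (mm a k pa)); rewrite !inE eqxx.
  by rewrite symc; apply: sub (proj2 (mm b y pb)); rewrite !inE eqxx ?orbT.
move=> v l; rewrite {1}/psi; case: ifP => [/orP[]/eqP pv [<-]|/negbT nkz' pv].
- split; last exact: ky'.
  by apply/eqP; rewrite psiy (proj1 (mm b y pb)) eqxx !orbT.
- split; first by apply/eqP; rewrite psiy (proj1 (mm b y pb)) eqxx !orbT.
  apply: connect_trans (sub z _ _ _ (proj2 (mm v z pv))) _; first by rewrite !inE eqxx orbT.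
  apply: connect_trans (_ : connect _ b' _).
    by rewrite symc; apply: sub (proj2 (mm b' z pb')); rewrite !inE eqxx orbT.
  apply: connect_trans (ky' _ pa').
  by apply: connect1; rewrite /fibrel /= adjC ab' !psiy pa' pb' !eqxx ?orbT.
have [pl cl] := mm v l pv.
move: nkz'; rewrite pv negb_or => /andP[lk lz].
have [Ely|nly] := eqVneq l y.
  rewrite Ely in pl cl *; split; first by apply/eqP; rewrite psiy pl eqxx !orbT.
  by apply: sub cl; rewrite !inE eqxx !orbT.
split; first by rewrite /psi pl (negbTE lk) (negbTE lz).
rewrite (eq_connect (@fibrel_eq _ phi l _)) // => w; rewrite /psi.
case: ifP => // /orP[]/eqP->; rewrite ?[Some k == _]eq_sym ?[Some z == _]eq_sym ?(negbTE lk) ?(negbTE lz);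
  by apply/eqP => -[E]; rewrite E eqxx in nly.
Qed.

(** Induction on the number of branch sets. A label of degree at most 4 is removed and coloured
    last. At degree 5, contracting [k] with two nonadjacent neighbours forces these to share a
    colour, which again leaves one for [k]. *)
Lemma five_coloring phi : minor_model phi ->
  exists c : V -> 'I_5, forall k l, qadj phi k l -> c k != c l.
Proof.
have [n] := ubnP #|labels phi|; elim: n phi => // n IH phi lt mm.
have [small|big] := leqP #|labels phi| 5.
  exists (fun k => inord (index k (enum (labels phi)))) => k l kl.
  have [kL lL] := qadj_labels mm kl; have /qadjP[ne _] := kl.
  apply: contraNneq ne => /(congr1 val) /=.
  have idx m : m \in labels phi -> index m (enum (labels phi)) < 5.
    by move=> mL; apply: leq_trans small; rewrite cardE index_mem mem_enum.
  rewrite !inordK ?idx // => E; apply/eqP.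
  by rewrite -(nth_index k (s := enum (labels phi)) (x := k)) ?mem_enum // E nth_index // mem_enum.
have [k kL dk] := degree_le5 mm (leq_trans (isT : 3 <= 6) big).
have [dk4|dk5] := leqP #|nb (qadj phi) k| 4.
  have [||c' cP] := IH (restrict phi (labels phi :\ k)).
  - rewrite restrict_labels (setIidPr (subsetDl _ _)).
    by have := cardsD1 k (labels phi); rewrite kL; lia.
  - exact: restrict_model.
  have [i iN] := fresh_color (leq_trans (leq_imset_card c' (mem (nb (qadj phi) k))) dk4).
  have iP l : qadj phi k l -> i != c' l.
    by move=> kl; apply: contraNneq iN => ->; apply: imset_f; rewrite in_nb.
  exists (fun x => if x == k then i else c' x) => a b ab.
  have [aL bL] := qadj_labels mm ab; have /qadjP[ne _] := ab.
  case: (eqVneq a k) (eqVneq b k) => [Ea|na] [Eb|nb].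
  - by rewrite Ea Eb eqxx in ne.
  - by rewrite Ea in ab; exact: iP.
  - by rewrite Eb qadjC in ab; rewrite eq_sym; exact: iP.
  - by apply: cP; rewrite restrict_qadj ?in_setD1 ?na ?nb.
have d5 : #|nb (qadj phi) k| = 5 by lia.
have [y [z [ky kz yz nyz]]] := nb_nonadjacent mm d5.
have mp := merge_model mm ky kz yz; set psi := (fun v => _) in mp.
have [_ yL] := qadj_labels mm ky; have [_ zL] := qadj_labels mm kz.
have /qadjP[nky _] := ky; have /qadjP[nkz _] := kz.
have [|c' cP] := IH psi _ mp.
  apply: leq_trans (_ : #|labels phi| <= _) => //.
  have := cardsD1 k (labels phi); rewrite kL add1n => ->; rewrite ltnS.
  apply: subset_leq_card; apply/subsetP => l; rewrite in_setD1 [l \in labels psi]inE /psi.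
  have pkk : phi k == Some k by rewrite inE in kL.
  case: ifP => [h /eqP[E]|/negbT]; last first.
    rewrite negb_or => /andP[h1 h2] h3; rewrite inE h3 andbT; apply: contraNneq h1 => ->.
    exact: pkk.
  rewrite -E inE; move: yL; rewrite inE => ->; by rewrite eq_sym nky.
(* [z] is absorbed into the branch set named [y] and inherits its colour. *)
pose m x := if x == z then y else x.
pose c1 x := c' (m x).
have cN : #|c1 @: nb (qadj phi) k| <= 4.
  have -> : c1 @: nb (qadj phi) k = c1 @: (nb (qadj phi) k :\ z).
    apply/eqP; rewrite eqEsubset; apply/andP; split; last by apply: imsetS; exact: subsetDl.
    apply/subsetP => i /imsetP[x xN ->].
    have [->|xz] := eqVneq x z; last by apply: imset_f; rewrite in_setD1 xz.
    apply/imsetP; exists y; first by rewrite in_setD1 yz in_nb.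
    by rewrite /c1 /m eqxx (negbTE yz).
  apply: leq_trans (leq_imset_card _ _) _.
  by have := cardsD1 z (nb (qadj phi) k); rewrite in_nb kz d5; lia.
have [i iN] := fresh_color cN.
have iP l : qadj phi k l -> i != c1 l.
  by move=> kl; apply: contraNneq iN => ->; apply: imset_f; rewrite in_nb.
have psiE w l : l != k -> phi w = Some l -> psi w = Some (m l).
  move=> lk pw; rewrite /psi pw /m; case: (eqVneq l z) => [->|lz].
    by rewrite eqxx orbT.
  by rewrite !(inj_eq Some_inj) (negbTE lk) (negbTE lz).
exists (fun x => if x == k then i else c1 x) => a b ab.
have /qadjP[ne [u [v [uv pu pv]]]] := ab.
case: (eqVneq a k) (eqVneq b k) => [Ea|na] [Eb|nb].
- by rewrite Ea Eb eqxx in ne.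
- by rewrite Ea in ab; exact: iP.
- by rewrite Eb qadjC in ab; rewrite eq_sym; exact: iP.
apply: cP; apply/qadjP; split; last by exists u, v; split; [| exact: psiE | exact: psiE].
rewrite /m; case: (eqVneq a z) (eqVneq b z) => [Ea|az] [Eb|bz] //.
- by rewrite Ea Eb eqxx in ne.
- by apply: contraNneq nyz => ->; rewrite qadjC -Ea.
- by apply: contraNneq nyz => <-; rewrite -Eb.
Qed.

(** As [v] shares a branch set with [f v], the colour of [f v] occurs on no other neighbour of [v]
    outside [M]. The values of [c] on [M] itself are arbitrary. *)
Lemma contract_coloring (M : {set V}) (f : V -> V) :
  (forall v, v \in M -> adj v (f v) /\ f v \notin M) ->
  exists c : V -> 'I_5,
    (forall u v, u \notin M -> v \notin M -> adj u v -> c u != c v) /\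
    (forall v z, v \in M -> z \notin M -> adj v z -> z != f v -> c z != c (f v)).
Proof.
move=> fP; pose phi v := Some (if v \in M then f v else v).
have mm : minor_model phi.
  move=> v k [E].
  have kM : k \notin M by rewrite -E; case: ifP => [/fP[]|->].
  have pk : phi k = Some k by rewrite /phi (negbTE kM).
  split=> //; move: E; case: ifP => [vM E|_ ->]; last exact: connect0.
  by apply: connect1; rewrite /fibrel /= pk -E (proj1 (fP v vM)) {1}/phi vM !eqxx.
have [c cP] := five_coloring mm; exists c; split.
  move=> u v uM vM uv; apply: cP; apply/qadjP; split; first exact: adj_neq.
  by exists u, v; rewrite /phi (negbTE uM) (negbTE vM).
move=> v z vM zM vz nz; apply: cP; apply/qadjP; split=> //.
by exists z, v; rewrite /phi (negbTE zM) vM adjC.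
Qed.

Lemma edge_bound : #|V| >= 3 -> #|edges adj| + 6 <= 3 * #|V|.
Proof.
move=> m3; have mm : minor_model Some by move=> v k [->].
have EL : #|labels Some| = #|V| by rewrite -cardsT; apply: eq_card => k; rewrite !inE eqxx.
have := minor_bound mm; rewrite EL => /(_ m3); congr (_ + 6 <= _).
apply: eq_card => e; apply/edgesP/edgesP => -[u [v [uv ->]]]; exists u, v; split=> //.
  by have /qadjP[_ [u' [v' [? [<-] [<-]]]]] := uv.
by apply/qadjP; split; [exact: adj_neq | exists u, v].
Qed.

End Planarity.

(** * Links in triangulations *)

Lemma max_indep (V : finType) (adj : rel V) (W I : {set V}) : symmetric adj -> irreflexive adj ->
  I \subset W -> (forall u v, u \in I -> v \in I -> ~~ adj u v) ->
  exists J : {set V}, [/\ I \subset J, J \subset W, (forall u v, u \in J -> v \in J -> ~~ adj u v) &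
    forall w, w \in W -> w \in J \/ exists2 u, u \in J & adj u w].
Proof.
move=> adjC adjI IW indI.
pose P (A : {set V}) := (A \subset W) && [forall u in A, forall v in A, ~~ adj u v].
have PP (A : {set V}) : reflect (A \subset W /\ forall u v, u \in A -> v \in A -> ~~ adj u v) (P A).
  apply: (iffP andP) => -[AW H]; split=> //.
    by move=> u v uA vA; move/forall_inP: H => /(_ u uA)/forall_inP/(_ v vA).
  by apply/forall_inP => u uA; apply/forall_inP => v vA; exact: H.
have PI : P I by apply/PP.
have [J /maxsetP[/PP[JW indJ] maxJ] IJ] := maxset_exists PI.
exists J; split=> // w wW.
have [wJ|wJ] := boolP (w \in J); [by left | right].
have [/existsP[u /andP[uJ uw]]|/existsPn no] := boolP [exists u, (u \in J) && adj u w].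
  by exists u.
suff E : w |: J = J by rewrite -E setU11 in wJ.
apply: maxJ; last exact: subsetUr.
apply/PP; split; first by rewrite subUset sub1set wW.
have no' u : u \in J -> ~~ adj u w by move=> uJ; have := no u; rewrite uJ.
move=> x y /setU1P[->|xJ] /setU1P[->|yJ].
- by rewrite adjI.
- by rewrite adjC no'.
- exact: no'.
- exact: indJ.
Qed.

Lemma neq_sym (A : eqType) (x y : A) : x != y -> y != x.
Proof. by rewrite eq_sym. Qed.

Section Triangulation.
Variables (V : finType) (adj : rel V).
Hypotheses (adjC : symmetric adj) (adjI : irreflexive adj).
Variable T : {set {set V}}.
Hypothesis Ttri : forall t, t \in T -> is_tri adj t.
Hypothesis two : forall u v, adj u v -> #|[set t in T | [set u; v] \subset t]| = 2.
Implicit Types (u v w x y z p q : V) (t : {set V}).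
Local Notation nb := (nb adj).

Definition tr u v w := [set u; v; w] \in T.

Lemma tr12 u v w : tr u v w = tr v u w.
Proof. by rewrite /tr (setUC [set u]). Qed.

Lemma tr23 u v w : tr u v w = tr u w v.
Proof. by rewrite /tr setUAC. Qed.

Lemma tr13 u v w : tr u v w = tr w v u.
Proof. by rewrite tr12 tr23 tr12. Qed.

Lemma tri_adj t u v : t \in T -> u \in t -> v \in t -> u != v -> adj u v.
Proof. by move=> /Ttri/is_triP[_ H]; exact: H. Qed.

Lemma tr_neq u v w : tr u v w -> [/\ u != v, v != w & u != w].
Proof.
move=> /Ttri/is_triP[c _].
have c2 a b : #|[set a; b] : {set V}| <= 2 by rewrite cards2; case: (_ != _).
split; apply/negP => /eqP E; move: c; rewrite E.
- by rewrite setUid => c; have := c2 v w; rewrite c.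
- by rewrite -setUA setUid => c; have := c2 u w; rewrite c.
- by rewrite setUAC setUid => c; have := c2 w v; rewrite c.
Qed.

Lemma tr_adj u v w : tr u v w -> [/\ adj u v, adj v w & adj u w].
Proof.
move=> H; have [uv vw uw] := tr_neq H.
by split; apply: (tri_adj H) => //; rewrite !inE eqxx ?orbT.
Qed.

Lemma tri_tr t u v : t \in T -> u \in t -> v \in t -> u != v ->
  exists w, t = [set u; v; w] /\ tr u v w.
Proof.
move=> tT ut vt uv; have [w [E _ _ _]] := tri_third (Ttri tT) ut vt uv.
by exists w; rewrite /tr -E.
Qed.

Lemma tri_tr1 t u : t \in T -> u \in t -> exists v w, t = [set u; v; w] /\ tr u v w.
Proof.
move=> tT ut; have /is_triP[c _] := Ttri tT.
have /card_gt0P[v] : 0 < #|t :\ u| by have := cardsD1 u t; rewrite ut c; lia.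
rewrite !inE => /andP[vu vt]; exists v.
by apply: tri_tr; rewrite // eq_sym.
Qed.

Lemma card_lk u v : adj u v -> #|[set w | tr u v w]| = 2.
Proof.
move=> uv; rewrite -(two uv).
rewrite -(card_in_imset (f := fun w => [set u; v; w]) (D := mem [set w | tr u v w])); last first.
  move=> a b; rewrite !inE => ha hb E; have [_ va ua] := tr_neq ha.
  have : a \in [set u; v; b] by rewrite -E !inE eqxx orbT.
  by rewrite !inE ![a == _]eq_sym (negbTE va) (negbTE ua) /= eq_sym => /eqP.
apply: eq_card => t; apply/imsetP/setIdP.
  by move=> [w]; rewrite inE => h ->; split=> //; rewrite subset_pair !inE !eqxx ?orbT.
move=> [tT]; rewrite subset_pair => /andP[ut vt].
have [w [E h]] := tri_tr tT ut vt (adj_neq adjI uv).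
by exists w; rewrite ?inE.
Qed.

Lemma lk2 u v x y w : tr u v x -> tr u v y -> x != y -> tr u v w -> w = x \/ w = y.
Proof.
move=> hx hy xy hw; have [uv _ _] := tr_adj hx.
have E : [set x; y] = [set w | tr u v w].
  apply/eqP; rewrite eqEcard card_lk // cards2 xy andbT.
  by apply/subsetP => a; rewrite !inE => /orP[]/eqP->.
have : w \in [set x; y] by rewrite E inE.
by rewrite !inE => /orP[]/eqP; auto.
Qed.

Lemma apexes u v : adj u v -> exists x y, [/\ tr u v x, tr u v y & x != y].
Proof.
move=> /card_lk/eqP/cards2P[x [y [ne E]]]; exists x, y; split=> //.
  by have : x \in [set w | tr u v w]; [rewrite E !inE eqxx | rewrite inE].
by have : y \in [set w | tr u v w]; [rewrite E !inE eqxx orbT | rewrite inE].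
Qed.

Lemma other_apex u v x : tr u v x -> exists2 y, tr u v y & y != x.
Proof.
move=> h; have [uv _ _] := tr_adj h; have [a [b [ha hb ab]]] := apexes uv.
have [E|ne] := eqVneq a x; last by exists a.
by exists b; rewrite // -E eq_sym.
Qed.

Lemma star_sum v u : u != v -> \sum_(t in T | v \in t) (u \in t) = 2 * adj v u.
Proof.
move=> uv; have [a|na] := boolP (adj v u).
  rewrite muln1 -(two a) -sum1dep_card big_mkcondr [RHS]big_mkcondr /=.
  by apply: eq_bigr => t _; rewrite subset_pair; case: (v \in t); case: (u \in t).
rewrite big1 // => t /andP[tT vt]; case ut: (u \in t) => //.
by rewrite (tri_adj tT vt ut) // eq_sym in na.
Qed.

Lemma card_inter t (S : {set V}) : #|t :&: S| = \sum_(u in S) (u \in t).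
Proof.
rewrite -sum1_card big_mkcond [RHS]big_mkcond; apply: eq_bigr => u _.
by rewrite inE; case: (u \in t); case: (u \in S).
Qed.

(** A neighbour of [v] lies on exactly two of the triangles at [v], any other vertex on none. *)
Lemma star_count v (S : {set V}) : v \notin S ->
  \sum_(t in T | v \in t) #|t :&: S| = 2 * #|S :&: nb v|.
Proof.
move=> vS; under eq_bigr => t _ do rewrite card_inter.
rewrite exchange_big /= setIC card_inter big_distrr /=; apply: eq_bigr => u uS.
by rewrite star_sum ?in_nb //; apply: contraNneq vS => <-.
Qed.

Lemma star_deg v : #|[set t in T | v \in t]| = #|nb v|.
Proof.
have := @star_count v (~: [set v]); rewrite !inE eqxx => /(_ isT).
rewrite (_ : ~: [set v] :&: nb v = nb v); last first.
  by apply/setP => u; rewrite !inE; have [->|] := eqVneq u v; rewrite ?adjI.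
rewrite (eq_bigr (fun _ => 2)); last first.
  move=> t /andP[tT vt]; have /is_triP[c _] := Ttri tT.
  by have := cardsD1 v t; rewrite vt c setDE add1n => -[<-].
by rewrite sum_nat_cond_const => E; lia.
Qed.

Lemma sum_star (f : V -> nat) : \sum_(t in T) \sum_(v in t) f v = \sum_v #|nb v| * f v.
Proof.
under eq_bigr => t _ do rewrite big_mkcond /=.
rewrite exchange_big /=; apply: eq_bigr => v _.
rewrite -star_deg -sum1dep_card big_distrl /= [RHS]big_mkcondr.
by apply: eq_bigr => t _; rewrite mul1n.
Qed.

(** Each of the [#|nb v|] triangles contributes one to [star_count]. This is where parities of
    degrees enter the discharging. *)
Lemma hit_even v (S : {set V}) : v \notin S -> (forall t, t \in T -> v \in t -> #|t :&: S| = 1) ->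
  #|nb v| = 2 * #|S :&: nb v|.
Proof.
move=> vS H; rewrite -star_count // -star_deg -sum1dep_card.
by apply: eq_bigr => t /andP[tT vt]; rewrite H.
Qed.

Lemma deg_ge3 v u : adj v u -> 3 <= #|nb v|.
Proof.
move=> vu; have [x [y [hx hy xy]]] := apexes vu.
have [_ ux vx] := tr_adj hx; have [_ uy vy] := tr_adj hy.
have -> : 3 = #|[set u; x; y]|.
  by rewrite setUC cardsU1 cards2 !inE negb_or ![y == _]eq_sym xy
      (adj_neq adjI uy) (adj_neq adjI ux).
by apply: subset_leq_card; apply/subsetP => z; rewrite !inE -orbA => /or3P[]/eqP->.
Qed.

(** Walking from apex to apex closes up after four steps: closing after three would leave a fourth
    neighbour [e], and an apex [x] of the edge [v e] would be a fifth. *)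
Lemma link4 v a b : #|nb v| = 4 -> tr v a b -> exists c d,
  [/\ tr v b c, tr v c d, tr v d a, uniq [:: a; b; c; d] & forall u, adj v u = (u \in [:: a; b; c; d])].
Proof.
move=> d4 hab; have [va ab vb] := tr_adj hab.
have hba : tr v b a by rewrite tr23.
have [c hbc ca] := other_apex hba; have [_ bc vc] := tr_adj hbc.
have hcb : tr v c b by rewrite tr23.
have [d hcd db] := other_apex hcb; have [_ cd vd] := tr_adj hcd.
have [d' had' d'b] := other_apex hab; have [_ ad' vd'] := tr_adj had'.
have nab := adj_neq adjI ab; have nbc := adj_neq adjI bc; have ncd := adj_neq adjI cd.
have da : d != a.
  apply/eqP => E; rewrite E in hcd.
  have Ed' : d' = c.
    have hac : tr v a c by rewrite tr23.
    by have [E'|//] := lk2 hab hac nbc had'; rewrite E' eqxx in d'b.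
  have /card_gt0P[e] : 0 < #|nb v :\: [set a; b; c]|.
    have := cardsID [set a; b; c] (nb v); rewrite d4.
    have : #|nb v :&: [set a; b; c]| <= 3.
      apply: leq_trans (subset_leq_card (subsetIr _ _)) _.
      by rewrite setUC cardsU1 cards2; case: (_ \notin _); case: (_ != _).
    by move: (#|_ :&: _|) (#|_ :\: _|) => m n; clear; lia.
  rewrite !inE !negb_or => /andP[/andP[/andP[ea eb] ec] ve].
  have [x [y [hx hy xy]]] := apexes ve.
  have main x' : tr v e x' -> x' \notin [:: a; b; c].
    move=> h'; rewrite !inE; apply/or3P => -[]/eqP Ex; rewrite Ex tr23 in h'.
    - have hac : tr v a c by rewrite tr23.
      by have [Ee|Ee] := lk2 hab hac nbc h'; rewrite Ee eqxx in eb ec.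
    - have [Ee|Ee] := lk2 hba hbc (neq_sym ca) h'; by rewrite Ee eqxx in ea ec.
    - by have [Ee|Ee] := lk2 hcb hcd (neq_sym nab) h'; rewrite Ee eqxx in ea eb.
  have sub : [set a; b; c; e; x] \subset nb v.
    have [_ _ vx] := tr_adj hx.
    by apply/subsetP => z; rewrite !inE -!orbA => /or4P[/eqP->|/eqP->|/eqP->|/orP[]/eqP->].
  have := subset_leq_card sub; rewrite d4.
  have := main x hx; rewrite !inE !negb_or => /and3P[xa xb xc].
  have [_ ex _] := tr_adj hx.
  rewrite setUC cardsU1 !inE !negb_or xa xb xc [x == e]eq_sym (adj_neq adjI ex) /=.
  rewrite setUC cardsU1 !inE !negb_or ea eb ec /=.
  by rewrite setUC cardsU1 !inE !negb_or ca [c == b]eq_sym nbc cards2 nab.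
have uq : uniq [:: a; b; c; d].
  by rewrite /= !inE !negb_or nab nbc ncd ![a == _]eq_sym ca da [b == d]eq_sym db.
have nbE u : adj v u = (u \in [:: a; b; c; d]).
  have -> : adj v u = (u \in nb v) by rewrite in_nb.
  have E : [set:: [:: a; b; c; d]] = nb v.
    apply/eqP; rewrite eqEcard; apply/andP; split.
      by apply/subsetP => z; rewrite !inE => /or4P[]/eqP->.
    by rewrite d4 cardsE (card_uniqP uq).
  by rewrite -E inE.
exists c, d; split=> //.
suff -> : d = d' by rewrite tr23.
have : adj v d' by [].
rewrite nbE !inE => /or4P[]/eqP E.
- by rewrite -E adjI in ad'.
- by rewrite E eqxx in d'b.
- rewrite E tr23 in had'.
  by have [Ee|Ee] := lk2 hcb hcd (neq_sym db) had'; [rewrite Ee eqxx in nab | rewrite Ee eqxx in da].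
- by [].
Qed.

End Triangulation.

Ltac trp := first [done | by rewrite tr12 | by rewrite tr23 | by rewrite tr13 |
  by rewrite tr12 tr23 | by rewrite tr23 tr12].

(** * Vertices of degree 4 *)

Section Degree4.
Variables (V : finType) (adj : rel V).
Hypotheses (adjC : symmetric adj) (adjI : irreflexive adj).
Variable T : {set {set V}}.
Hypothesis Ttri : forall t, t \in T -> is_tri adj t.
Hypothesis two : forall u v, adj u v -> #|[set t in T | [set u; v] \subset t]| = 2.
Hypothesis span : forall C, (forall v, dv adj C v = false) ->
  exists X : {set {set V}}, X \subset T /\ forall e, e \in edges adj -> C e = bd X e.
Implicit Types (u v w x y z p q : V) (t : {set V}).
Local Notation nb := (nb adj).
Local Notation tr := (tr T).
Local Notation tr_adj := (tr_adj Ttri).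
Local Notation lk2 := (lk2 adjI Ttri two).
Local Notation link4 := (link4 adjI Ttri two).

Definition D4 := [set v | #|nb v| == 4].
Definition triples := [set t in T | t \subset D4].

Lemma D4P v : v \in D4 -> #|nb v| = 4.
Proof. by rewrite inE => /eqP. Qed.

Lemma triples_tr v w x : tr v w x -> v \in D4 -> w \in D4 -> x \in D4 -> [set v; w; x] \in triples.
Proof.
move=> h hv hw hx; apply/setIdP; split=> //; apply/subsetP => y.
by rewrite !in_setU !in_set1 -orbA => /or3P[]/eqP->.
Qed.

Section Octahedron.
Hypothesis indec : forall X : {set {set V}}, X \subset T ->
  (forall e, e \in edges adj -> bd X e = false) -> X = set0 \/ X = T.
Hypothesis cov : forall v, exists2 t, t \in T & v \in t.

(* The link of z closes up the seven triangles around v, w, x, and the eight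
   triangles obtained form a sphere. *)
Lemma octahedron v w x z : tr v w x -> v \in D4 -> w \in D4 -> x \in D4 -> z \in D4 ->
  tr v x z -> z != w -> #|V| = 6.
Proof.
move=> hvwx /D4P dv /D4P dw /D4P dx /D4P dz hvxz zw.
have [c [z1 [h1 h2 h3 uqv nbv]]] := link4 dv hvwx.
have Ec : c = z.
  have hh : tr v x w by trp.
  by have [E|//] := lk2 hh hvxz (neq_sym zw) h1; move: uqv; rewrite E /= !inE eqxx !orbT.
subst c.
have hxwv : tr x w v by trp.
have [c [z2 [k1 k2 k3 uqx nbx]]] := link4 dx hxwv.
have Ec : c = z.
  have hh : tr x v w by trp.
  have hh' : tr x v z by trp.
  by have [E|//] := lk2 hh hh' (neq_sym zw) k1; move: uqx; rewrite E /= !inE eqxx !orbT.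
subst c.
have hwxv : tr w x v by trp.
have [c [d [l1 l2 l3 uqw nbw]]] := link4 dw hwxv.
have nuv : [&& w != x, w != z, w != z1, x != z, x != z1 & z != z1].
  by move: uqv; rewrite /= !inE !negb_or -!andbA => /and5P[-> -> -> -> /and3P[-> -> _]].
have nux : [&& w != v, w != z, w != z2, v != z, v != z2 & z != z2].
  by move: uqx; rewrite /= !inE !negb_or -!andbA => /and5P[-> -> -> -> /and3P[-> -> _]].
case/and5P: nuv => nwx nwz nwz1 nxz /andP[nxz1 nzz1].
case/and5P: nux => nwv _ nwz2 nvz /andP[nvz2 nzz2].
have nuw : [&& x != v, x != c, x != d, v != c, v != d & c != d].
  by move: uqw; rewrite /= !inE !negb_or -!andbA => /and5P[-> -> -> -> /and3P[-> -> _]].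
case/and5P: nuw => nxv nxc nxd nvc /andP[nvd ncd].
have Ec : c = z1.
  have hh : tr w v z1 by trp.
  have hh' : tr w v x by trp.
  by have [E|//] := lk2 hh' hh nxz1 l1; rewrite E eqxx in nxc.
have Ed : d = z2.
  have hh : tr w x z2 by trp.
  have hh' : tr w x d by trp.
  by have [E|//] := lk2 hwxv hh nvz2 hh'; rewrite E eqxx in nvd.
subst c d.
have hzxv : tr z x v by trp.
have [c [d [m1 m2 m3 uqz nbz]]] := link4 dz hzxv.
have nuz : [&& x != v, x != c, x != d, v != c, v != d & c != d].
  by move: uqz; rewrite /= !inE !negb_or -!andbA => /and5P[-> -> -> -> /and3P[-> -> _]].
case/and5P: nuz => _ nxc' nxd' nvc' /andP[nvd' ncd'].
have Ec : c = z1.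
  have hh : tr z v z1 by trp.
  have hh' : tr z v x by trp.
  by have [E|//] := lk2 hh' hh nxz1 m1; rewrite E eqxx in nxc'.
have Ed : d = z2.
  have hh : tr z x z2 by trp.
  have hh' : tr z x d by trp.
  by have [E|//] := lk2 hzxv hh nvz2 hh'; rewrite E eqxx in nvd'.
subst c d.
pose D := [set v; w; x; z].
have DP d : d \in D -> [\/ d = v, d = w, d = x | d = z].
  by rewrite !inE -!orbA => /or4P[]/eqP; [constructor 1 | constructor 2 | constructor 3 | constructor 4].
have vD : v \in D by rewrite !inE eqxx.
have wD : w \in D by rewrite !inE eqxx ?orbT.
have xD : x \in D by rewrite !inE eqxx ?orbT.
have zD : z \in D by rewrite !inE eqxx ?orbT.
(* Triangles meeting [D] have only [z1 z2] as an edge outside [D], and this edge lies on two of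
   them, so their total boundary vanishes. *)
have key d a b : d \in D -> a \notin D -> b \notin D -> tr d a b -> [set a; b] = [set z1; z2].
  move=> dD aD bD h; have [da ab db] := tr_adj h; have nab := adj_neq adjI ab.
  have fin : a \in [:: z1; z2] -> b \in [:: z1; z2] -> [set a; b] = [set z1; z2].
    rewrite !inE => /orP[]/eqP Ea /orP[]/eqP Eb; subst a b; rewrite ?eqxx // in nab *.
    by rewrite setUC.
  have fin1 y : a \in [:: y] -> b \in [:: y] -> [set a; b] = [set z1; z2].
    by rewrite !inE => /eqP Ea /eqP Eb; rewrite Ea Eb eqxx in nab.
  have ex y : y \notin D -> [/\ y != v, y != w, y != x & y != z].
    by rewrite !inE !negb_or -!andbA => /and4P[].
  have [a1 a2 a3 a4] := ex a aD; have [b1 b2 b3 b4] := ex b bD.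
  have [E|E|E|E] := DP d dD; subst d; move: da db; rewrite ?nbv ?nbw ?nbx ?nbz !inE
    ?(negbTE a1) ?(negbTE a2) ?(negbTE a3) ?(negbTE a4)
    ?(negbTE b1) ?(negbTE b2) ?(negbTE b3) ?(negbTE b4) /= => ha hb.
  - by apply: (fin1 z1); rewrite inE.
  - by apply: fin; rewrite !inE.
  - by apply: (fin1 z2); rewrite inE.
  - by apply: fin; rewrite !inE.
pose X := [set t in T | ~~ [disjoint t & D]].
have XT : X \subset T by apply/subsetP => t; rewrite inE => /andP[].
have XP t : t \in T -> reflect (exists2 d, d \in t & d \in D) (t \in X).
  move=> tT; apply: (iffP setIdP) => [[_]|[d dt dD]].
    by rewrite -setI_eq0 => /set0Pn[d /setIP[dt dD]]; exists d.
  by split=> //; apply/pred0Pn; exists d; rewrite /= dt dD.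
have bdX e : e \in edges adj -> bd X e = false.
  move=> /edgesP[a [b [ab ->]]]; rewrite /bd xor_card.
  have full : (forall t, t \in T -> [set a; b] \subset t -> t \in X) ->
      odd #|[set t | t \in X & [set a; b] \subset t]| = false.
    move=> H; rewrite (_ : [set _ | _ & _] = [set t in T | [set a; b] \subset t]) ?two //.
    apply/setP => t; rewrite !inE; apply/andP/andP => -[h h']; split=> //; first by case/andP: h.
    by have := H t h h'; rewrite inE.
  have [aD|aD] := boolP (a \in D).
    by apply: full => t tT; rewrite subset_pair => /andP[at_ _]; apply/XP => //; exists a.
  have [bD|bD] := boolP (b \in D).
    by apply: full => t tT; rewrite subset_pair => /andP[_ bt]; apply/XP => //; exists b.
  have [E|ne] := eqVneq [set a; b] [set z1; z2].
    apply: full => t tT; rewrite E subset_pair => /andP[h1' h2'].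
    have n12 : z1 != z2 by have [_ /(adj_neq adjI) ] := tr_adj l2.
    have [d [Et h]] := tri_tr Ttri tT h1' h2' n12.
    have hw' : tr z1 z2 w by trp.
    have hz' : tr z1 z2 z by trp.
    apply/XP => //; exists d; first by rewrite Et !inE eqxx orbT.
    by have [->|->] := lk2 hw' hz' nwz h.
  rewrite (_ : [set _ | _ & _] = set0) ?cards0 //; apply/setP => t; rewrite in_set0 inE.
  apply/negP => /andP[tX]; rewrite subset_pair => /andP[at_ bt].
  have tT := subsetP XT t tX; have /XP[//|d dt dD] := tX.
  have [d' [Et h]] := tri_tr Ttri tT at_ bt (adj_neq adjI ab).
  have Ed : d = d'.
    move: dt; rewrite Et !inE -orbA => /or3P[]/eqP E //; by rewrite E in dD; rewrite dD in aD bD.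
  move/negP: ne; apply; apply/eqP; apply: (key d') => //; first by rewrite -Ed.
  by trp.
have ET : X = T.
  have [X0|//] := indec XT bdX.
  have : [set v; w; x] \in X by apply/XP => //; exists v; rewrite ?inE ?eqxx.
  by rewrite X0 inE.
have uq6 : uniq [:: v; w; x; z; z1; z2].
  have [ha1 _ ha2] := tr_adj h2; have [hb1 hb2 _] := tr_adj l2; have [_ hc1 hc2] := tr_adj k2.
  have n1 := adj_neq adjI ha2; have n2 := adj_neq adjI hb2; have n3 := adj_neq adjI hc2.
  by rewrite /= !inE !negb_or n1 n2 n3 nvz nvz2 nwx nwz nwz1 nwz2 nxz nxz1 nzz1 nzz2 ![v == _]eq_sym nwv nxv.
have /= <- := card_uniqP uq6; rewrite -cardsT; apply: eq_card => u; rewrite !inE.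
have [t tT ut] := cov u; have /XP[//|d dt dD] : t \in X by rewrite ET.
have [<-|ne] := eqVneq d u.
  by have [->|->|->|->] := DP d dD; rewrite eqxx ?orbT.
have := tri_adj Ttri tT dt ut ne.
have [E|E|E|E] := DP d dD; rewrite E ?nbv ?nbw ?nbx ?nbz !inE => /or4P[]/eqP->; by rewrite eqxx ?orbT.
Qed.

(** On the 4-cycle around [v] the vertices [w] and [x] are consecutive, so a further degree 4
    neighbour [z] spans a face with [v] and one of them, as [octahedron] requires. *)
Lemma octahedral_or_isolated : #|V| = 6 /\ (exists t, t \in triples) \/
  forall t v z, t \in triples -> v \in t -> z \in D4 -> adj v z -> z \in t.
Proof.
have [/existsP[t /andP[tt /existsP[v /existsP[z /and4P[vt zD vz zt]]]]]|no] :=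
  boolP [exists t in triples, [exists v, exists z, [&& v \in t, z \in D4, adj v z & z \notin t]]]; last first.
  right=> t v z tt vt zD vz; apply: contraNT no => zt.
  apply/existsP; exists t; rewrite tt /=; apply/existsP; exists v; apply/existsP; exists z.
  by rewrite vt zD vz.
left; split; last by exists t.
have /setIdP[tT /subsetP tD] := tt.
have [w [x [Et h]]] := tri_tr1 Ttri tT vt.
have wD : w \in D4 by apply: tD; rewrite Et !inE eqxx orbT.
have xD : x \in D4 by apply: tD; rewrite Et !inE eqxx orbT.
have vD := tD v vt.
have [c [d [h1 h2 h3 uq nbE]]] := link4 (D4P vD) h.
move: (vz) zt; rewrite nbE Et !inE !negb_or => /or4P[]/eqP E /andP[/andP[_ zw] zx].
- by rewrite E eqxx in zw.
- by rewrite E eqxx in zx.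
- by rewrite -E in h1; exact: (octahedron h vD wD xD zD h1 zw).
- by rewrite -E in h3; apply: (@octahedron v x w z) => //; trp.
Qed.
End Octahedron.

(** * Colourings adapted to degree 4 vertices *)

Section Coloring.
Hypothesis isol : forall t v z, t \in triples -> v \in t -> z \in D4 -> adj v z -> z \in t.

(* Vertices of a maximal independent set of degree 4 vertices are contracted
   into one of their neighbours before colouring with five colours. *)
Lemma good_coloring : exists c : V -> 'I_5, [/\ forall u v, adj u v -> c u != c v,
  forall v, v \in D4 -> exists a b d, [/\ adj v a, adj v b, adj v d &
    [/\ c a != c b, c b != c d & c a != c d]] &
  forall v w p q, v \in D4 -> w \in D4 -> tr v w p -> tr v w q -> p != q ->
    p \notin D4 -> q \notin D4 -> c p != c q].
Proof.
have [M [_ /subsetP MD indM maxM]] := max_indep adjC adjI (sub0set D4)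
  (fun u v (h : u \in set0) => match negP (negbT (in_set0 u)) h with end).
have nM v z : v \in M -> adj v z -> z \notin M.
  by move=> vM vz; apply/negP => zM; have := indM v z vM zM; rewrite vz.
have D4nb v : v \in D4 -> exists u, adj v u.
  move=> /D4P d; have /card_gt0P[u] : 0 < #|nb v| by rewrite d.
  by rewrite in_nb; exists u.
(* The first component is the neighbour into which [v] is contracted, next to a degree 4 neighbour
   on the link if there is one. The second is the vertex beyond the opposite edge when [v] lies in a
   triple. *)
have ex v : exists p : V * V, v \in M -> [/\ adj v p.1,
    (exists2 w, w \in D4 & adj v w) -> (exists2 w, w \in D4 & tr v w p.1) &
    forall w x, w \in D4 -> x \in D4 -> tr v w x -> tr w x p.2 /\ p.2 != v].
  have [vM|] := boolP (v \in M); last by exists (v, v).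
  have vD := MD v vM.
  have [f [vf fP]] : exists f, adj v f /\
    ((exists2 w, w \in D4 & adj v w) -> (exists2 w, w \in D4 & tr v w f)).
    have [/existsP[w /andP[wD vw]]|no] := boolP [exists w, (w \in D4) && adj v w].
      have [f [_ [hf _ _]]] := apexes adjI Ttri two vw; have [_ _ vf] := tr_adj hf.
      by exists f; split=> // _; exists w.
    have [u vu] := D4nb v vD; exists u; split=> // -[w wD vw].
    by move/existsP: no; case; exists w; rewrite wD.
  suff [q qP] : exists q, forall w x, w \in D4 -> x \in D4 -> tr v w x -> tr w x q /\ q != v.
    by exists (f, q).
  have [/existsP[w /existsP[x /and3P[wD xD h]]]|no] :=
    boolP [exists w, exists x, [&& w \in D4, x \in D4 & tr v w x]]; last first.
    exists v => w x wD xD h; case/negP: no; apply/existsP; exists w; apply/existsP; exists x.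
    by rewrite wD xD h.
  have h' : tr w x v by trp.
  have [q hq qv] := other_apex adjI Ttri two h'; exists q => w' x' w'D x'D k; split=> //.
  have tt := triples_tr h vD wD xD.
  have [vw' w'x' vx'] := tr_adj k; have nw := adj_neq adjI w'x'.
  have inwx y : y \in D4 -> adj v y -> y = w \/ y = x.
    move=> yD vy; have : y \in [set v; w; x].
      by apply: (isol tt (v := v)) => //; rewrite !in_setU !in_set1 eqxx.
    rewrite !inE -orbA => /or3P[]/eqP; auto => E; by rewrite E adjI in vy.
  have [E1|E1] := inwx w' w'D vw'; have [E2|E2] := inwx x' x'D vx'; subst; rewrite ?eqxx // in nw *.
  by trp.
have [pf pfP] := fin_all_exists ex.
have [|c0 [c0P c0f]] := contract_coloring adjC adjI Ttri two span (M := M) (f := fun v => (pf v).1).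
  by move=> v vM; have [h _ _] := pfP v vM; split=> //; exact: nM h.
pose N v := c0 @: nb v.
(* If the neighbours of [v] show at most three colours, a fourth can be forbidden at [v]; it is
   reserved for the other two vertices of a triple. *)
pose F v := N v :|: (if #|N v| <= 3 then [set c0 (pf v).2] else set0).
have FP v : v \in M -> #|F v| <= 4.
  move=> /MD/D4P d; have dN : #|N v| <= 4 by exact: leq_trans (leq_imset_card _ _) (eq_leq d).
  rewrite /F; case: ifP => h; last by rewrite setU0.
  by apply: leq_trans (leq_card_setU _ _) _; rewrite cards1; lia.
have exg v : exists i, v \in M -> i \notin F v.
  have [vM|] := boolP (v \in M); last by exists ord0.
  by have [i iF] := fresh_color (FP v vM); exists i.
have [g gP] := fin_all_exists exg.
pose c v := if v \in M then g v else c0 v.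
have cN v : v \notin M -> c v = c0 v by rewrite /c => /negbTE->.
have gN v u : v \in M -> adj v u -> c v != c u.
  move=> vM vu; rewrite (cN u) ?(nM v) // /c vM.
  have := gP v vM; rewrite !inE negb_or => /andP[h _]; apply: contraNneq h => ->.
  by apply: imset_f; rewrite in_nb.
have prop u v : adj u v -> c u != c v.
  move=> uv; have [uM|uM] := boolP (u \in M); first exact: gN.
  have [vM|vM] := boolP (v \in M); first by rewrite eq_sym; apply: gN; rewrite // adjC.
  by rewrite !cN //; exact: c0P.
have cf v x : v \in M -> adj v x -> x != (pf v).1 -> c x != c (pf v).1.
  move=> vM vx ne; have [vf _ _] := pfP v vM.
  by rewrite !cN ?(nM v) //; apply: c0f => //; exact: nM vx.
(* The link of [v] is the 4-cycle [f], [w'], [x], [y]; contraction made the colours of the opposite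
   vertices [f] and [x] differ. *)
have around v w : v \in M -> w \in D4 -> adj v w -> exists w' x y, let f := (pf v).1 in
   [/\ w' \in D4, tr v w' f, tr v w' x, tr v y x & [/\ tr v y f, f != x, c f != c x &
      forall u, adj v u -> [\/ u = f, u = w', u = x | u = y]]].
  move=> vM wD vw; have [vf h _] := pfP v vM; have [|w' w'D hw'] := h; first by exists w.
  have hfw : tr v (pf v).1 w' by trp.
  have [x [y [h1 h2 h3 uq nbE]]] := link4 (D4P (MD v vM)) hfw.
  exists w', x, y; split=> //; first by trp.
  have fx : (pf v).1 != x by move: uq; rewrite /= !inE !negb_or -!andbA => /and3P[].
  split=> //; first by rewrite eq_sym cf //; [case: (tr_adj h1) | rewrite eq_sym].
  move=> u; rewrite nbE !inE => /or4P[]/eqP; by [constructor 1 | constructor 2 | constructor 3 | constructor 4].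
have see_pole v u p r : tr v u p -> tr v u r -> c p != c r -> exists a b d, [/\ adj u a, adj u b, adj u d &
    [/\ c a != c b, c b != c d & c a != c d]].
  move=> hp hr ne; have [vu up vp] := tr_adj hp; have [_ ur vr] := tr_adj hr.
  exists v, p, r; split; rewrite 1?[adj u v]adjC //; split=> //; exact: prop.
have polesM v w p q : v \in M -> w \in D4 -> tr v w p -> tr v w q -> p != q ->
    p \notin D4 -> q \notin D4 -> c p != c q.
  move=> vM wD hp hq pq pD qD; have [vw _ _] := tr_adj hp.
  have [w' [x [y [w'D h1 h2 h3 [h4 fx cfx U]]]]] := around v w vM wD vw.
  have fin a b : tr v w a -> tr v w b -> a != b -> c a != c b -> c p != c q.
    move=> ha hb ab cab; have [E1|E1] := lk2 ha hb ab hp; have [E2|E2] := lk2 ha hb ab hq;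
      rewrite E1 E2; rewrite E1 E2 in pq; first [exact: cab | by rewrite eqxx in pq | by rewrite eq_sym].
  have no : ~ tr v w w'.
    by move=> h; have [E|E] := lk2 hp hq pq h; rewrite -E w'D in pD qD.
  have [E|E|E|E] := U w vw; subst w.
  - by case: no; rewrite tr23.
  - exact: fin h1 h2 fx cfx.
  - by case: no; rewrite tr23.
  - by apply: fin h3 h4 _ _; rewrite eq_sym.
exists c; split=> // [u uD|v w p q vD wD hp hq pq pD qD].
  have [uM|uM] := boolP (u \in M).
    have [uf _ _] := pfP u uM; have [w [x [hw hx wx]]] := apexes adjI Ttri two uf.
    have hw' : tr u w (pf u).1 by trp.
    have [uw' wf _] := tr_adj hw'; have [y hy yf] := other_apex adjI Ttri two hw'.
    have [_ wy uy] := tr_adj hy.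
    exists (pf u).1, y, w; split=> //; split; [by rewrite eq_sym; exact: cf | |]; rewrite 1?eq_sym; exact: prop.
  have [uM'|[v vM vu]] := maxM u uD; first by rewrite uM' in uM.
  have [w [x [y [wD h1 h2 h3 [h4 fx cfx U]]]]] := around v u vM uD vu.
  have cxf : c x != c (pf v).1 by rewrite eq_sym.
  (* Here [v], [w], [u] is a triple. Either the neighbours [w] and [z3] of [u] differ in colour, or
     [v] sees that colour twice and so avoids the reserved colour of [z2]. *)
  have trip : tr v w u -> exists a b d, [/\ adj u a, adj u b, adj u d &
    [/\ c a != c b, c b != c d & c a != c d]].
    move=> h; have vD := MD v vM.
    have huvw : tr u v w by trp.
    have [z2 [z3 [k1 k2 k3 uq nbE]]] := link4 (D4P uD) huvw.
    have [uv vw uw] := tr_adj huvw; have [_ wz2 uz2] := tr_adj k1; have [uz3 z3v _] := tr_adj k3.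
    have vz3 : adj v z3 by rewrite adjC.
    have [ne|E] := eqVneq (c z3) (c w); last first.
      by exists v, w, z3; split=> //; split; [exact: prop | rewrite eq_sym | exact: prop].
    move: uq; rewrite /= !inE !negb_or -!andbA => /and5P[nvw nvz2 nvz3 nwz2 /and3P[nwz3 nz23 _]].
    have N3 : #|N v| <= 3.
      have dv4 := D4P vD.
      have dN : #|N v| <= 4 by exact: leq_trans (leq_imset_card _ _) (eq_leq dv4).
      suff ne4 : #|N v| != 4 by move: dN; rewrite leq_eqVlt (negbTE ne4).
      apply/negP => N4; have /imset_injP inj : #|c0 @: nb v| == #|nb v| by rewrite dv4.
      have := inj w z3; rewrite !in_nb vw vz3 => /(_ isT isT).
      by rewrite -!cN ?(nM v) // ne => /(_ erefl) E; rewrite E eqxx in nwz3.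
    have [_ _ /(_ w u wD uD h)[hq qv]] := pfP v vM.
    have hwuv : tr w u v by trp.
    have hwuz : tr w u z2 by trp.
    have Eq : (pf v).2 = z2.
      by have [E'|//] := lk2 hwuv hwuz nvz2 hq; rewrite E' eqxx in qv.
    have z2D : z2 \notin D4.
      apply/negP => z2D; have tt := triples_tr h vD wD uD.
      have : z2 \in [set v; w; u].
        by apply: (isol tt (v := w)) => //; rewrite !in_setU !in_set1 eqxx orbT.
      rewrite !inE -orbA => /or3P[]/eqP E'; rewrite E' ?eqxx // in nvz2 nwz2 uz2.
      by rewrite adjI in uz2.
    have z2M : z2 \notin M by apply: contra z2D; exact: MD.
    have cvz : c v != c z2.
      rewrite (cN z2) // /c vM; have := gP v vM; rewrite /F N3 Eq !inE negb_or => /andP[_].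
      by [].
    by exists v, w, z2; split=> //; split=> //; exact: prop.
  have [E|E|E|E] := U u vu; subst u.
  - exact: trip.
  - exact: see_pole h1 h2 cfx.
  - exact: trip.
  - exact: see_pole h3 h4 cxf.
have [vM|vM] := boolP (v \in M); first exact: polesM hp hq pq pD qD.
have [wM|wM] := boolP (w \in M).
  by apply: (polesM w v) => //; trp.
(* With neither [v] nor [w] in [M], maximality gives [w] a neighbour in [M]. It must be opposite to
   [v] on the link of [w], so the edge from [w] to it has the same apexes [p] and [q]. *)
have [wM'|[v' v'M v'w]] := maxM w wD; first by rewrite wM' in wM.
have hwvp : tr w v p by trp.
have hwvq : tr w v q by trp.
have [r [d [k1 k2 k3 uq nbE]]] := link4 (D4P wD) hwvp.
have Ed : d = q.
  have hh : tr w v d by trp.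
  have [E|//] := lk2 hwvp hwvq pq hh.
  by move: uq; rewrite E /= !inE eqxx !orbT /= andbF.
subst d.
have : adj w v' by rewrite adjC.
rewrite nbE !inE => /or4P[]/eqP E; subst v'.
- by rewrite v'M in vM.
- by rewrite (MD _ v'M) in pD.
- by apply: (polesM r w) => //; trp.
- by rewrite (MD _ v'M) in qD.
Qed.
End Coloring.
End Degree4.

(** * Discharging *)

Section Families.
Variables (V : finType) (adj : rel V).
Hypotheses (adjC : symmetric adj) (adjI : irreflexive adj).
Variable T : {set {set V}}.
Hypothesis Ttri : forall t, t \in T -> is_tri adj t.
Hypothesis two : forall u v, adj u v -> #|[set t in T | [set u; v] \subset t]| = 2.
Hypothesis span : forall C, (forall v, dv adj C v = false) ->
  exists X : {set {set V}}, X \subset T /\ forall e, e \in edges adj -> C e = bd X e.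
Hypothesis cov : forall v, exists2 t, t \in T & v \in t.
Implicit Types (u v w x y z p q : V) (t : {set V}) (i j : 'I_5).
Local Notation nb := (nb adj).
Local Notation tr := (tr T).
Local Notation tr_adj := (tr_adj Ttri).
Local Notation D4 := (D4 adj).
Local Notation triples := (triples adj T).

Lemma face_count : #|T| + 4 <= 2 * #|V| \/ #|V| < 3.
Proof.
have [v3|] := leqP 3 #|V|; [left | by right].
have h1 := edge_bound adjC adjI Ttri two span v3.
have h2 := handshake adjC adjI.
have : \sum_(t in T) \sum_(v in t) 1 = 3 * #|T|.
  rewrite mulnC -sum_nat_const; apply: eq_bigr => t /Ttri/is_triP[c _].
  by rewrite sum1_card c.
rewrite (sum_star adjI Ttri two); under eq_bigr do rewrite muln1.
by move=> h3; move: h1; rewrite h3 in h2; move: h2; clear; move: #|T| #|V| #|edges adj| => a b c; lia.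
Qed.

Variable c : V -> 'I_5.
Hypothesis cP : forall u v, adj u v -> c u != c v.

(** [W] will be the whole vertex set or the complement of one distinguished vertex; domination is
    asked for inside [W] only. *)
Lemma dominating_family (W : {set V}) : exists S : 'I_5 -> {set V}, forall i,
  [/\ S i \subset W, (forall v, v \in W -> c v = i -> v \in S i),
      (forall u v, u \in S i -> v \in S i -> ~~ adj u v) &
      forall w, w \in W -> w \in S i \/ exists2 u, u \in S i & adj u w].
Proof.
suff H i : exists S : {set V}, [/\ S \subset W, (forall v, v \in W -> c v = i -> v \in S),
      (forall u v, u \in S -> v \in S -> ~~ adj u v) &
      forall w, w \in W -> w \in S \/ exists2 u, u \in S & adj u w].
  exact: fin_all_exists H.
pose I := [set v in W | c v == i].
have [||J [IJ JW ind dom]] := @max_indep V adj W I adjC adjI.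
- by apply/subsetP => v /setIdP[].
- move=> u v /setIdP[_ /eqP cu] /setIdP[_ /eqP cv]; apply/negP => /cP.
  by rewrite cu cv eqxx.
exists J; split=> // v vW cv; apply: (subsetP IJ); apply/setIdP; split=> //; exact/eqP.
Qed.

Variables (W : {set V}) (S : 'I_5 -> {set V}).
Hypothesis Sc : forall i v, v \in W -> c v = i -> v \in S i.
Hypothesis SI : forall i u v, u \in S i -> v \in S i -> ~~ adj u v.

Definition owners v := [set i | v \in S i].
(** Written s(v) in the overview. *)
Definition load v := #|owners v|.

Lemma P_disjoint u v i : adj u v -> i \in owners u -> i \in owners v -> False.
Proof. by rewrite !inE => uv /SI h /h; rewrite uv. Qed.

Lemma cP_P v : v \in W -> c v \in owners v.
Proof. by move=> vW; rewrite inE; exact: Sc. Qed.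

Lemma s_gt0 v : v \in W -> 0 < load v.
Proof. by move=> vW; apply/card_gt0P; exists (c v); exact: cP_P. Qed.

Lemma s_nb v u i : u \in W -> adj v u -> i \in owners v -> i != c u.
Proof.
move=> uW vu iP; apply/negP => /eqP E; apply: (P_disjoint vu iP).
by rewrite E; exact: cP_P.
Qed.

Lemma card5 (A odd_heavy : {set 'I_5}) : [disjoint A & odd_heavy] -> #|A| + #|odd_heavy| <= 5.
Proof.
move=> d; have := subset_leq_card (subsetT (A :|: odd_heavy)); rewrite cardsT card_ord.
by rewrite cardsU disjoint_setI0 // cards0 subn0.
Qed.

(** By [s_nb] the owners of [v] and the colours seen by [v] in [W] are disjoint subsets of the five
    indices. *)
Lemma s_colors v (A : {set V}) : A \subset W -> (forall u, u \in A -> adj v u) -> load v + #|c @: A| <= 5.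
Proof.
move=> /subsetP AW Av; apply: card5; rewrite -setI_eq0; apply/eqP/setP => i; rewrite in_set0 in_setI.
apply/negP => /andP[iP /imsetP[u uA E]]; have := s_nb (AW u uA) (Av u uA) iP.
by rewrite E eqxx.
Qed.

Lemma card_c2 u w : adj u w -> #|c @: [set u; w]| = 2.
Proof. by move=> uw; rewrite imsetU !imset_set1 cards2 cP. Qed.

Lemma s_le3 v u w : tr v u w -> u \in W -> w \in W -> load v <= 3.
Proof.
move=> h uW wW; have [vu uw vw] := tr_adj h.
have := @s_colors v [set u; w]; rewrite card_c2 // => H.
have : load v + 2 <= 5.
  apply: H; first by rewrite subset_pair uW wW.
  by move=> z; rewrite !inE => /orP[]/eqP->.
by rewrite -[5]/(3 + 2) leq_add2r.
Qed.

Lemma s_see3 v a b d : a \in W -> b \in W -> d \in W -> adj v a -> adj v b -> adj v d ->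
  c a != c b -> c b != c d -> c a != c d -> load v <= 2.
Proof.
move=> aW bW dW va vb vd ab bd ad.
have := @s_colors v [set a; b; d]; rewrite !imsetU !imset_set1.
rewrite [X in #|pred_of_set X|]setUC cardsU1 cards2 !inE negb_or ![c d == _]eq_sym ab bd ad => H.
have : load v + 3 <= 5.
  apply: H; last by move=> z; rewrite !inE -orbA => /or3P[]/eqP->.
  by apply/subsetP => z; rewrite !inE -orbA => /or3P[]/eqP->.
by rewrite -[5]/(2 + 3) leq_add2r.
Qed.

(* Around v only two colours occur, so every triangle at v meets the vertices of colour c u. *)
Lemma s3_even v u : nb v \subset W -> 3 <= load v -> adj v u ->
  #|nb v| = 2 * #|[set z | c z == c u] :&: nb v|.
Proof.
move=> /subsetP nW s3 vu; apply: (hit_even adjI Ttri two).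
  by rewrite inE cP.
move=> t tT vt; apply/eqP/cards1P.
have [a [b [Et h]]] := tri_tr1 Ttri tT vt; have [va ab vb] := tr_adj h.
have inW z : adj v z -> z \in W by move=> vz; apply: nW; rewrite in_nb.
have cab := cP ab.
have [E|ne] := eqVneq (c a) (c u).
  exists a; apply/setP => z; rewrite Et !inE; apply/andP/eqP => [[/orP[/orP[]|]/eqP-> //]|->].
  - by rewrite (negbTE (cP vu)).
  - by rewrite -E eq_sym (negbTE cab).
  - by rewrite E !eqxx orbT.
have [E|ne'] := eqVneq (c b) (c u).
  exists b; apply/setP => z; rewrite Et !inE; apply/andP/eqP => [[/orP[/orP[]|]/eqP-> //]|->].
  - by rewrite (negbTE (cP vu)).
  - by rewrite (negbTE ne).
  - by rewrite E !eqxx orbT.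
have := @s_see3 v a b u; rewrite !inW // => H.
by have := leq_trans s3 (H isT isT isT va vb vu cab ne' ne).
Qed.

Lemma s_odd v : nb v \subset W -> odd #|nb v| -> load v <= 2.
Proof.
move=> nW od; rewrite leqNgt; apply/negP => s3.
have [t tT vt] := cov v; have [a [b [_ h]]] := tri_tr1 Ttri tT vt; have [va _ _] := tr_adj h.
by move: od; rewrite (s3_even nW s3 va) mul2n odd_double.
Qed.

Definition miss t := #|[set i | t :&: S i == set0]|.

Lemma tri_le1 t i : t \in T -> #|t :&: S i| <= 1.
Proof.
move=> tT; apply/card_le1P => a /setIP[at_ aS] b; rewrite !inE; apply/andP/eqP => [[bt bS]|-> //].
by apply/eqP/negP => /negP ne; have := SI bS aS; rewrite (tri_adj Ttri tT bt at_ ne).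
Qed.

Lemma sum_s_tri t : \sum_(v in t) load v = \sum_i #|t :&: S i|.
Proof.
under eq_bigr => v _ do rewrite /load -sum1dep_card big_mkcond /=.
rewrite exchange_big /=; apply: eq_bigr => i _; rewrite setIC card_inter.
by apply: eq_bigr => v _; case: (v \in S i).
Qed.

Lemma sum_s_miss t : t \in T -> \sum_(v in t) load v + miss t = 5.
Proof.
move=> tT; rewrite sum_s_tri /miss -sum1dep_card [X in _ + X]big_mkcond /= -big_split /=.
rewrite (eq_bigr (fun _ => 1)) ?sum1_card ?card_ord // => i _.
rewrite -cards_eq0; have := tri_le1 i tT.
by case: (#|_|) => [|[|]].
Qed.

Lemma sum_s_le5 t : t \in T -> \sum_(v in t) load v <= 5.
Proof. by move=> /sum_s_miss <-; exact: leq_addr. Qed.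

Lemma sum_tr u v w (f : V -> nat) : tr u v w -> \sum_(z in [set u; v; w]) f z = f u + f v + f w.
Proof.
move=> h; have [n1 n2 n3] := tr_neq Ttri h.
rewrite setUC big_setU1 /=; last by rewrite !inE negb_or ![w == _]eq_sym n3 n2.
by rewrite big_setU1 ?inE //= big_set1 addnC.
Qed.

(** * Discharging on a closed triangulation *)

Section Whole.
Hypothesis WT : forall v, v \in W.

Definition odd_heavy := [set v | odd #|nb v| && (load v == 2)].

Lemma nbW v : nb v \subset W. Proof. by apply/subsetP. Qed.

Lemma nb_ge3 v : 3 <= #|nb v|.
Proof.
have [t tT vt] := cov v; have [a [b [_ h]]] := tri_tr1 Ttri tT vt; have [va _ _] := tr_adj h.
exact: (deg_ge3 adjI Ttri two va).
Qed.

(** Each of the three sets that avoid [v] misses a triangle at [v]: otherwise it would meet all of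
    them exactly once, and [hit_even] would make the degree even. *)
Lemma miss_B v : v \in odd_heavy -> 3 <= \sum_(t in T | v \in t) miss t.
Proof.
rewrite inE => /andP[od /eqP s2].
under eq_bigr => t _ do rewrite /miss -sum1dep_card big_mkcond /=.
rewrite exchange_big /=.
apply: leq_trans (_ : \sum_(i | i \notin owners v) 1 <= _).
  rewrite sum1_card; have := cardC (mem (owners v)); rewrite card_ord.
  have -> : #|[predC owners v]| = #|[pred i | i \notin owners v]| by apply: eq_card.
  by rewrite -/(load v) s2; lia.
rewrite [leqRHS](bigID (fun i => i \notin owners v)) /=; apply: leq_trans (leq_addr _ _).
apply: leq_sum => i iP; rewrite lt0n; apply/negP => /eqP H.
move/eqP: H; rewrite sum_nat_eq0 => /forall_inP H.
have : #|nb v| = 2 * #|S i :&: nb v|.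
  apply: (hit_even adjI Ttri two); first by rewrite inE in iP.
  move=> t tT vt; have := H t; rewrite tT vt => /(_ isT); have := tri_le1 i tT.
  by rewrite -cards_eq0; case: (#|_|) => [|[|]].
by move=> E; move: od; rewrite E mul2n odd_double.
Qed.

(** The charges do not overlap: a triangle with two vertices of load 2 has total load 5 and is
    missed by no set. *)
Lemma sum_miss : 3 * #|odd_heavy| <= \sum_(t in T) miss t.
Proof.
rewrite mulnC -sum_nat_const; apply: leq_trans (leq_sum _ (fun v => @miss_B v)) _.
under eq_bigr => v _ do rewrite big_mkcondr /=.
rewrite exchange_big /=; apply: leq_sum => t tT; rewrite -big_mkcondr /=.
have [->|m0] := posnP (miss t); first by rewrite big1.
rewrite sum_nat_cond_const -[leqRHS]mul1n leq_mul2r; apply/orP; right.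
apply/card_le1_eqP => a b /setIdP[aB at_] /setIdP[bB bt]; apply/eqP; apply: contraT => ne.
have [w [Et h]] := tri_tr Ttri tT bt at_ ne.
have := sum_s_miss tT; rewrite Et (sum_tr _ h) -Et.
have := s_gt0 (WT w); move: aB bB; rewrite !inE => /andP[_ /eqP->] /andP[_ /eqP->].
by move: m0; clear; lia.
Qed.

Lemma s_le3W v : load v <= 3.
Proof.
have [t tT vt] := cov v; have [a [b [_ h]]] := tri_tr1 Ttri tT vt.
exact: s_le3 h (WT a) (WT b).
Qed.

(** With degree [d] and load [s], the excess [(6 - d) * (s - 1)] is at most 3 on [odd_heavy], at
    most [2 * (s - 1)] at degree 4, and at most 0 elsewhere. Summed over all vertices, [d * s] gives
    [5 * #|T|] less the misses, and [d] gives [3 * #|T|]. *)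
Lemma weight_bound :
  6 * \sum_v load v <= 2 * #|T| + 6 * #|V| + \sum_(v in D4) 2 * (load v).-1.
Proof.
have h1 : \sum_(t in T) \sum_(v in t) load v + \sum_(t in T) miss t = 5 * #|T|.
  by rewrite -big_split /= mulnC -sum_nat_const; apply: eq_bigr => t; exact: sum_s_miss.
have h2 : \sum_(t in T) \sum_(v in t) 1 = 3 * #|T|.
  rewrite mulnC -sum_nat_const; apply: eq_bigr => t /Ttri/is_triP[k _].
  by rewrite sum1_card k.
rewrite !(sum_star adjI Ttri two) in h1 h2.
have h3 := sum_miss.
(* The pointwise bound, rearranged so that no natural subtraction of a degree occurs. Degree 3 with
   load 2 needs the whole charge of 3. *)
have : \sum_v (6 * load v + #|nb v| * 1) <= \sum_v (#|nb v| * load v + 6 +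
   (3 * (v \in odd_heavy) + (if v \in D4 then 2 * (load v).-1 else 0))).
  apply: leq_sum => v _; have d3 := nb_ge3 v; have s0 := s_gt0 (WT v); have s3 := s_le3W v.
  have od := s_odd (nbW v).
  rewrite [v \in odd_heavy]inE [v \in D4]inE.
  case: (leqP 6 #|nb v|) => [d6|d5].
    by move: d6 s0; clear; move: #|nb v| (load v) => d k; nia.
  move: d3 d5 s0 s3 od; clear; case: #|nb v| => [|[|[|[|[|[|]]]]]] // _ _;
    case: (load v) => [|[|[|[|]]]] //= _ _ od; by have := od isT.
have eB : \sum_v 3 * (v \in odd_heavy) = 3 * #|odd_heavy|.
  by rewrite -sum1_card big_distrr /= [RHS]big_mkcond; apply: eq_bigr => v _; case: (v \in odd_heavy).
have e6 : \sum_(v : V) 6 = 6 * #|V|.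
  by rewrite mulnC -cardsT -sum_nat_const; apply: eq_bigl => v; rewrite inE.
rewrite big_split /= [X in _ <= X]big_split /= [X in _ <= X + _]big_split /=.
rewrite [X in _ <= _ + X]big_split /= eB e6 -big_mkcond -big_distrr /=.
move: h1 h2 h3; clear.
move: (\sum_(v in D4) _) (\sum_v _ * load v) (\sum_v load v) (\sum_v #|nb v| * 1) (\sum_(t in T) miss t).
by move=> a b d e f; move: #|T| #|odd_heavy| #|V| => x y z; lia.
Qed.

(** * Counting the excess at degree 4 *)

Section Count.
Hypothesis see3 : forall v, v \in D4 -> exists a b d, [/\ adj v a, adj v b, adj v d &
    [/\ c a != c b, c b != c d & c a != c d]].
Hypothesis poles : forall v w p q, v \in D4 -> w \in D4 -> tr v w p -> tr v w q -> p != q ->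
    p \notin D4 -> q \notin D4 -> c p != c q.
Hypothesis isol : forall t v z, t \in triples -> v \in t -> z \in D4 -> adj v z -> z \in t.

(** Only a load of at least 2 creates excess; vertices in triples are counted together with their
    triple. *)
Definition singles := [set v in D4 | (2 <= load v) && [forall t in triples, v \notin t]].

(** Adjacent ones would have disjoint sets of at least two owners each, both disjoint from the two
    different colours of [p] and [q]: six indices out of five. *)
Lemma singles_indep v w : v \in singles -> w \in singles -> ~~ adj v w.
Proof.
move=> /setIdP[vD /andP[sv /forall_inP nv]] /setIdP[wD /andP[sw nw]]; apply/negP => vw.
have [p [q [hp hq pq]]] := apexes adjI Ttri two vw.
have nD x : tr v w x -> x \notin D4.
  move=> h; apply/negP => xD; have := nv _ (triples_tr h vD wD xD).
  by rewrite !inE eqxx.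
have cpq := poles vD wD hp hq pq (nD p hp) (nD q hq).
have [_ wp vp] := tr_adj hp; have [_ wq vq] := tr_adj hq.
have d1 : [disjoint owners v & owners w].
  rewrite -setI_eq0; apply/eqP/setP => i; rewrite in_set0 in_setI; apply/negP => /andP[].
  exact: P_disjoint vw.
have d2 : [disjoint owners v :|: owners w & [set c p; c q]].
  rewrite -setI_eq0; apply/eqP/setP => i; rewrite in_set0 in_setI; apply/negP => /andP[].
  rewrite in_setU => h; rewrite !inE => h'.
  have [z [vz wz E]] : exists z, [/\ adj v z, adj w z & i = c z].
    by case/orP: h' => /eqP; [exists p | exists q].
  case/orP: h => h.
    by have := s_nb (WT z) vz h; rewrite E eqxx.
  by have := s_nb (WT z) wz h; rewrite E eqxx.
have := card5 d2; rewrite cardsU disjoint_setI0 // cards0 subn0 cards2 cpq -!/(load _).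
by move: sv sw; clear; lia.
Qed.

(** Inclusion and exclusion: three stars of 4 triangles, less two triangles on each of three edges,
    plus the triple itself, [12 - 6 + 1]. *)
Lemma card_meet_triple t : t \in triples -> 7 <= #|[set t' in T | ~~ [disjoint t & t']]|.
Proof.
move=> /setIdP[tT tD]; set k := #|[set t' in T | _]|.
have [v vt] : exists v, v \in t.
  by apply/card_gt0P; have /is_triP[-> _] := Ttri tT.
have [w [x [Et h]]] := tri_tr1 Ttri tT vt; have [vw wx vx] := tr_adj h.
have [nvw nwx nvx] := tr_neq Ttri h.
have d4 z : z \in t -> #|[set t' in T | z \in t']| = 4.
  by move=> zt; rewrite (star_deg adjI Ttri two) (D4P (subsetP tD z zt)).
have := d4 v; have := d4 w; have := d4 x; rewrite Et !inE !eqxx !orbT => /(_ isT) cx /(_ isT) cw /(_ isT) cv.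
have := two vw; have := two wx; have := two vx.
move: cx cw cv; rewrite -!sum1dep_card.
rewrite !big_mkcondr /= => cx cw cv cvx cwx cvw.
have ct : \sum_(t' in T) (t' == t) = 1.
  rewrite (bigD1 t) //= eqxx big1 // => t' /andP[_ /negbTE->] //.
have : \sum_(t' in T) ((v \in t') + (w \in t') + (x \in t') + (t' == t)) <=
   \sum_(t' in T) ((~~ [disjoint t & t']) + (([set v; w] \subset t') + ([set w; x] \subset t') + ([set v; x] \subset t'))).
  apply: leq_sum => t' t'T; rewrite !subset_pair.
  have E : (t' == t) = [&& v \in t', w \in t' & x \in t'].
    apply/eqP/and3P => [->|[h1 h2 h3]]; first by rewrite Et !inE !eqxx !orbT.
    apply/esym/eqP; rewrite eqEcard; have /is_triP[-> _] := Ttri tT; have /is_triP[-> _] := Ttri t'T.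
    by rewrite andbT Et; apply/subsetP => z; rewrite !inE -orbA => /or3P[]/eqP->.
  have M : v \in t' \/ w \in t' \/ x \in t' -> ~~ [disjoint t & t'].
    by move=> H; apply/pred0Pn; case: H => [|[]] H; [exists v | exists w | exists x];
      rewrite /= H Et !inE eqxx ?orbT.
  rewrite E; case Hv: (v \in t') M; case Hw: (w \in t'); case Hx: (x \in t') => M //=;
    by rewrite M; auto.
rewrite !big_split /= ct.
have b2 (p : pred {set V}) : \sum_(t' in T) (if p t' then 1 else 0) = \sum_(t' in T) p t'.
  by apply: eq_bigr => t' _; case: (p t').
rewrite -!b2 cx cw cv cvx cwx cvw -big_mkcondr /= sum1dep_card.
by rewrite -/k; move: (k); clear; lia.
Qed.

(** A triangle is charged at most once: singles are pairwise nonadjacent, and by [isol] no degree 4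
    vertex outside a triple is adjacent to it. *)
Lemma cluster_count : 4 * #|singles| + 7 * #|triples| <= #|T|.
Proof.
apply: leq_trans (_ : \sum_(t in T) (\sum_(v in singles) (v \in t) +
   \sum_(t' in triples) ~~ [disjoint t' & t]) <= _).
  rewrite big_split /=; apply: leq_add.
    rewrite exchange_big /= mulnC -sum_nat_const; apply: leq_sum => v /setIdP[/D4P vD _].
    rewrite -vD -(star_deg adjI Ttri two) -sum1dep_card big_mkcondr /=.
    by apply: leq_sum => t _; case: (v \in t).
  rewrite exchange_big /= mulnC -sum_nat_const; apply: leq_sum => t /card_meet_triple.
  rewrite -sum1dep_card big_mkcondr /= => /leq_trans; apply.
  by apply: leq_sum => t' _; case: (~~ _).
rewrite -sum1_card; apply: leq_sum => t tT.
have tadj u v : u \in t -> v \in t -> u = v \/ adj u v.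
  by move=> ut vt; have [|ne] := eqVneq u v; [left | right; exact: (tri_adj Ttri tT)].
have one (A : {set {set V}}) : {in A &, forall a b, a = b} -> #|A| <= 1 by move=> H; apply/card_le1_eqP => a b aA bA; exact: H.
have E1 : \sum_(v in singles) (v \in t) = #|t :&: singles| by rewrite card_inter.
have E2 : \sum_(t' in triples) ~~ [disjoint t' & t] = #|[set t' in triples | ~~ [disjoint t' & t]]|.
  by rewrite -sum1dep_card big_mkcondr; apply: eq_bigr => t' _; case: (~~ _).
rewrite E1 E2.
have c1 : #|t :&: singles| <= 1.
  apply/card_le1_eqP => a b /setIP[at_ aS] /setIP[bt bS].
  by have [//|ab] := tadj a b at_ bt; have := singles_indep aS bS; rewrite ab.
have mem t' w z : t' \in triples -> w \in t' -> w \in t -> z \in t -> z \in D4 -> z \in t'.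
  move=> t'3 wt' wt zt zD; have [<- //|wz] := tadj w z wt zt; exact: isol wz.
have c2 : #|[set t' in triples | ~~ [disjoint t' & t]]| <= 1.
  apply: one => t1 t2 /setIdP[t1T /pred0Pn[w /andP[/= wt1 wt]]] /setIdP[t2T /pred0Pn[z /andP[/= zt2 zt]]].
  have /setIdP[t1T' /subsetP t1D] := t1T; have /setIdP[t2T' /subsetP t2D] := t2T.
  have zt1 : z \in t1 by apply: (mem t1 w) => //; exact: t2D.
  apply/esym/eqP; rewrite eqEcard.
  have /is_triP[-> _] := Ttri t1T'; have /is_triP[-> cl] := Ttri t2T'; rewrite andbT.
  apply/subsetP => y yt2; have [-> //|ne] := eqVneq y z.
  by apply: (isol t1T zt1); [exact: t2D | apply: cl; rewrite // eq_sym].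
have [->|/card_gt0P[t' /setIdP[t'3 /pred0Pn[w /andP[/= wt' wt]]]]] := posnP #|[set t' in triples | ~~ [disjoint t' & t]]|.
  by rewrite addn0.
suff -> : t :&: singles = set0 by rewrite cards0 add0n.
apply/setP => v; rewrite in_set0; apply/negP => /setIP[vt vS].
have /setIdP[vD /andP[_ /forall_inP/(_ t' t'3)]] := vS.
by rewrite (mem t' w v).
Qed.

(** A vertex that sees three colours has load at most 2, hence excess at most 1. In a triple the
    loads add up to at most 5, hence the excesses to at most 2. *)
Lemma sum_D4 : \sum_(v in D4) (load v).-1 <= #|singles| + 2 * #|triples|.
Proof.
apply: leq_trans (_ : \sum_(v in D4) ((v \in singles) + \sum_(t in triples) (if v \in t then (load v).-1 else 0)) <= _).
  apply: leq_sum => v vD.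
  have [/existsP[t /andP[tt vt]]|no] := boolP [exists t in triples, v \in t].
    by rewrite (bigD1 t) //= vt; apply: leq_trans (leq_addl _ _); exact: leq_addr.
  have s2 : load v <= 2.
    have [a [b [d [va vb vd [ab bd ad]]]]] := see3 vD.
    exact: s_see3 (WT a) (WT b) (WT d) va vb vd ab bd ad.
  have [s2'|s1] := leqP 2 (load v).
    suff -> : v \in singles by move: s2; clear; case: (load v) => [|[|[|]]].
    apply/setIdP; split=> //; rewrite s2' /=; apply/forall_inP => t tt.
    by apply: contra no => vt; apply/existsP; exists t; rewrite tt.
  by move: s1; case: (load v) => [|[|]].
rewrite big_split /=; apply: leq_add.
  rewrite -sum1_card [leqRHS]big_mkcond /= big_mkcond /=.
  by apply: leq_sum => v _; case: (v \in singles); case: (v \in D4).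
rewrite exchange_big /= mulnC -sum_nat_const; apply: leq_sum => t /setIdP[tT tD].
apply: leq_trans (_ : \sum_(v in t) (load v).-1 <= _).
  rewrite -big_mkcondr /= big_mkcond [leqRHS]big_mkcond /=.
  by apply: leq_sum => v _; case: (v \in D4); case: (v \in t).
have [v vt] : exists v, v \in t.
  by apply/card_gt0P; have /is_triP[-> _] := Ttri tT.
have [w [x [Et h]]] := tri_tr1 Ttri tT vt.
have := sum_s_le5 tT; rewrite Et !(sum_tr _ h).
have := s_gt0 (WT v); have := s_gt0 (WT w); have := s_gt0 (WT x); clear.
by move: (load v) (load w) (load x) => a b d; lia.
Qed.
End Count.
End Whole.
End Families.

(** Serves the octahedron, where two opposite vertices dominate. *)
Lemma small_indep_dom (V : finType) (adj : rel V) v : symmetric adj -> irreflexive adj ->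
  #|V| = 6 -> #|nb adj v| = 4 -> exists z, [/\ z != v, ~~ adj v z &
    forall u, u = v \/ u = z \/ adj v u].
Proof.
move=> adjC adjI c6 d4.
have vN : v \notin nb adj v by rewrite in_nb adjI.
have c5 : #|v |: nb adj v| = 5 by rewrite cardsU1 vN d4.
have : #|~: (v |: nb adj v)| == 1.
  by apply/eqP; have := cardsC (v |: nb adj v); rewrite c5 c6; clear; lia.
move=> /cards1P[z Ez].
have := set11 z; rewrite -Ez in_setC in_setU1 in_nb negb_or => /andP[zv nvz].
exists z; split=> // u.
have [uN|uN] := boolP (u \in v |: nb adj v).
  by move: uN; rewrite in_setU1 in_nb => /orP[/eqP|]; auto.
by right; left; apply/set1P; rewrite -Ez in_setC.
Qed.

(** * Bounds for closed triangulations *)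

Section TriangulationBounds.
Variables (V : finType) (adj : rel V).
Hypotheses (adjC : symmetric adj) (adjI : irreflexive adj).
Variable T : {set {set V}}.
Hypothesis Ttri : forall t, t \in T -> is_tri adj t.
Hypothesis two : forall u v, adj u v -> #|[set t in T | [set u; v] \subset t]| = 2.
Hypothesis span : forall C, (forall v, dv adj C v = false) ->
  exists X : {set {set V}}, X \subset T /\ forall e, e \in edges adj -> C e = bd X e.
Hypothesis cov : forall v, exists2 t, t \in T & v \in t.
Hypothesis V0 : 0 < #|V|.

Definition is_ids (S : {set V}) := (forall u v, u \in S -> v \in S -> ~~ adj u v) /\
  forall w, w \in S \/ exists2 u, u \in S & adj u w.

Lemma faces_le : #|T| + 4 <= 2 * #|V|.
Proof.
have [//|lt3] := face_count adjC adjI Ttri two span.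
have /card_gt0P[v _] := V0; have [t tT vt] := cov v.
have [a [b [_ h]]] := tri_tr1 Ttri tT vt; have [va _ _] := tr_adj Ttri h.
have := leq_trans (deg_ge3 adjI Ttri two va) (max_card _).
by rewrite leqNgt lt3.
Qed.

Lemma average (S : 'I_5 -> {set V}) m : \sum_i #|S i| < 5 * m.+1 -> exists i, #|S i| <= m.
Proof.
move=> lt; apply/existsP; apply: contraTT lt => /existsPn H; rewrite -leqNgt.
have -> : 5 * m.+1 = \sum_(i < 5) m.+1 by rewrite sum_nat_const card_ord.
by apply: leq_sum => i _; rewrite ltnNge; exact: H.
Qed.

Lemma sum_S (S : 'I_5 -> {set V}) : \sum_v load S v = \sum_i #|S i|.
Proof.
under eq_bigr => v _ do rewrite /load -sum1dep_card big_mkcond /=.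
by rewrite exchange_big /=; apply: eq_bigr => i _; rewrite -big_mkcond sum1_card.
Qed.

(** A plain five-colouring is enough, so the set of contracted vertices is empty: the degree 4 term
    vanishes, and [6 * \sum_i #|S i| <= 2 * #|T| + 6 * #|V| < 10 * #|V|]. *)
Lemma ids_deg5 m : (forall v, 5 <= #|nb adj v|) -> #|V| < 3 * m.+1 -> exists S, is_ids S /\ #|S| <= m.
Proof.
move=> d5 lt.
have [|c [cP _]] := contract_coloring adjC adjI Ttri two span (M := set0) (f := id).
  by move=> v; rewrite inE.
have {}cP u v : adj u v -> c u != c v by apply: cP; rewrite inE.
have [S SP] := dominating_family adjC adjI cP setT.
have Sc i v : v \in setT -> c v = i -> v \in S i by have [_ h _ _] := SP i; exact: h.
have SI i u v : u \in S i -> v \in S i -> ~~ adj u v by have [_ _ h _] := SP i; exact: h.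
have wb := weight_bound adjI Ttri two cov cP Sc SI (fun v => in_setT v).
have e0 : \sum_(v in D4 adj) 2 * (load S v).-1 = 0.
  by apply: big1 => v /D4P E; have := d5 v; rewrite E.
have := faces_le; rewrite e0 sum_S in wb => fl.
have [|i Si] := @average S m; first by move: wb fl lt; clear; move: #|T| #|V| (\sum_i #|S i|) => a b d; lia.
exists (S i); split=> //; have [_ _ h1 h2] := SP i; split=> // w; exact: h2 (in_setT w).
Qed.

Hypothesis indec : forall X : {set {set V}}, X \subset T ->
  (forall e, e \in edges adj -> bd X e = false) -> X = set0 \/ X = T.

(** Since [4 * #|singles| + 7 * #|triples| <= #|T|], the degree 4 term is at most [4 * #|T| / 7].
    The five sizes then add up to less than [13 * #|V| / 7], which is below [15 * #|V| / 8]. *)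
Lemma ids_triangulation m : 3 * #|V| <= 8 * m.+1 -> exists S, is_ids S /\ #|S| <= m.
Proof.
move=> lt; have [[c6 [t tt]]|isol] := octahedral_or_isolated adjI Ttri two indec cov.
  have m2 : 2 <= m by move: lt; rewrite c6; clear; lia.
  have /setIdP[tT /subsetP tD] := tt.
  have [v vt] : exists v, v \in t by apply/card_gt0P; have /is_triP[-> _] := Ttri tT.
  have [z [zv nvz H]] := small_indep_dom adjC adjI c6 (D4P (tD v vt)).
  exists [set v; z]; split; last by rewrite cards2 eq_sym zv.
  split=> [a b|w].
    by rewrite !inE => /orP[]/eqP-> /orP[]/eqP->; rewrite ?adjI // adjC.
  by have [->|[->|vw]] := H w; [left; rewrite !inE eqxx | left; rewrite !inE eqxx orbT |
    right; exists v; rewrite ?inE ?eqxx].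
have [c [cP see3 poles]] := good_coloring adjC adjI Ttri two span isol.
have [S SP] := dominating_family adjC adjI cP setT.
have Sc i v : v \in setT -> c v = i -> v \in S i by have [_ h _ _] := SP i; exact: h.
have SI i u v : u \in S i -> v \in S i -> ~~ adj u v by have [_ _ h _] := SP i; exact: h.
have wb := weight_bound adjI Ttri two cov cP Sc SI (fun v => in_setT v).
have cc := cluster_count adjI Ttri two Sc SI (fun v => in_setT v) poles isol.
have sd := sum_D4 Ttri Sc SI (fun v => in_setT v) see3.
have := faces_le; rewrite sum_S -big_distrr /= in wb => fl.
have [|i Si] := @average S m.
  move: wb fl lt cc sd; clear.
  move: #|T| #|V| (\sum_i #|S i|) #|singles _ _ _| #|triples _ _| (\sum_(v in _) _) => a b d e f g; lia.
exists (S i); split=> //; have [_ _ h1 h2] := SP i; split=> // w; exact: h2 (in_setT w).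
Qed.
End TriangulationBounds.

(** * Triangulations with a distinguished vertex *)

Section Punctured.
Variables (V : finType) (adj : rel V).
Hypotheses (adjC : symmetric adj) (adjI : irreflexive adj).
Variable T : {set {set V}}.
Hypothesis Ttri : forall t, t \in T -> is_tri adj t.
Hypothesis two : forall u v, adj u v -> #|[set t in T | [set u; v] \subset t]| = 2.
Hypothesis span : forall C, (forall v, dv adj C v = false) ->
  exists X : {set {set V}}, X \subset T /\ forall e, e \in edges adj -> C e = bd X e.
Hypothesis cov : forall v, exists2 t, t \in T & v \in t.
Variable o : V.
Implicit Types (u v w x y z p q : V) (t : {set V}) (i j : 'I_5).
Local Notation nb := (nb adj).
Local Notation tr := (tr T).
Local Notation tr_adj := (tr_adj Ttri).
Local Notation D4 := (D4 adj).
Local Notation triples := (triples adj T).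
Local Notation W := [set~ o].

Lemma inner_tri v u : adj v u -> exists2 w, tr v u w & w \in W.
Proof.
move=> vu; have [x [y [hx hy xy]]] := apexes adjI Ttri two vu.
have [E|ne] := eqVneq x o; last by exists x; rewrite ?inE.
by exists y; rewrite // !inE -E eq_sym.
Qed.

Lemma inner_nb v : exists2 u, adj v u & u \in W.
Proof.
have [t tT vt] := cov v; have [a [b [_ h]]] := tri_tr1 Ttri tT vt; have [va ab vb] := tr_adj h.
have [E|ne] := eqVneq a o; last by exists a; rewrite ?inE.
by exists b; rewrite // !inE -E eq_sym (adj_neq adjI ab).
Qed.

Lemma inner_tri1 v : exists u w, [/\ tr v u w, u \in W & w \in W].
Proof.
by have [u vu uW] := inner_nb v; have [w h wW] := inner_tri vu; exists u, w.
Qed.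

Lemma card_sum (A : {set V}) (p : pred V) : #|[set x in A | p x]| = \sum_(x in A) p x.
Proof. by rewrite -sum1dep_card big_mkcondr /=; apply: eq_bigr => x _; case: (p x). Qed.

(** * Loads away from the distinguished vertex *)

Section Weights.
Variable c : V -> 'I_5.
Hypothesis cP : forall u v, adj u v -> c u != c v.
Hypothesis see3 : forall v, v \in D4 -> exists a b d, [/\ adj v a, adj v b, adj v d &
    [/\ c a != c b, c b != c d & c a != c d]].
Variable S : 'I_5 -> {set V}.
Hypothesis SW : forall i, S i \subset W.
Hypothesis Sc : forall i v, v \in W -> c v = i -> v \in S i.
Hypothesis SI : forall i u v, u \in S i -> v \in S i -> ~~ adj u v.
Local Notation load := (load S).
Local Notation owners := (owners S).

(** Load 3 is an excess and load 1 a saving against the mean 2. Neighbours of [X3] in [W] turn out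
    to have load 1; the sets below split both sides by their position relative to [o] and to its
    colour. *)
Definition X3 := [set v in W | load v == 3].
Definition X1 := [set v in W | load v == 1].
Definition NX3 := [set y in W | [exists x in X3, adj x y]].
Definition X3in := [set x in X3 | ~~ adj o x].
(** In the bipartite count a vertex of degree 3 falls one edge short of the other neighbours of [o];
    the missing unit is recovered from [S (c o)] in [S5_card]. *)
Definition Bd1 := [set x in X3 | adj o x && (#|nb x| == 3)].
Definition Bd2 := [set x in X3 | adj o x && (#|nb x| != 3)].
Definition X3in0 := [set x in X3in | c o \notin owners x].
Definition NX3o := [set y in NX3 | c y == c o].
Definition NX3b := [set y in NX3 | adj o y].

Lemma s13 v : v \in W -> 0 < load v <= 3.
Proof.
move=> vW; rewrite (s_gt0 Sc vW) /=; have [u [w [h uW wW]]] := inner_tri1 v.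
exact: (s_le3 Ttri cP Sc SI h uW wW).
Qed.

Lemma X3P v : v \in X3 -> v \in W /\ load v = 3.
Proof. by move=> /setIdP[vW /eqP]. Qed.

Lemma YP y : y \in NX3 -> y \in W /\ exists2 x, x \in X3 & adj x y.
Proof. by move=> /setIdP[yW /existsP[x /andP[xX xy]]]; split=> //; exists x. Qed.

Lemma Y_mem x y : x \in X3 -> y \in W -> adj x y -> y \in NX3.
Proof. by move=> xX yW xy; apply/setIdP; split=> //; apply/existsP; exists x; rewrite xX. Qed.

(** A triangle inside [W] has total load at most 5, so next to load 3 both other loads are 1. *)
Lemma Y_X1 : NX3 \subset X1.
Proof.
apply/subsetP => y /YP[yW [x xX xy]]; apply/setIdP; split=> //.
have [xW s3] := X3P xX; have [w h wW] := inner_tri xy.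
have := sum_s_le5 Ttri SI h; rewrite (sum_tr Ttri _ h) s3.
have := s_gt0 Sc yW; have := s_gt0 Sc wW; clear.
by move: (load y) (load w) => a b; lia.
Qed.

Lemma X3_Y x : x \in X3 -> x \notin NX3.
Proof.
move=> /X3P[_ s3]; apply/negP => /(subsetP Y_X1)/setIdP[_]; by rewrite s3.
Qed.

Lemma X3_indep x y : x \in X3 -> y \in X3 -> ~~ adj x y.
Proof.
move=> xX yX; apply/negP => xy; have [yW _] := X3P yX.
by have := X3_Y yX; rewrite (Y_mem xX yW xy).
Qed.

Lemma nb_X3 x : x \in X3 -> [set y in o |: NX3 | adj x y] = nb x.
Proof.
move=> xX; apply/setP => y; rewrite in_nb; apply/setIdP/idP => [[]//|xy]; split=> //.
rewrite in_setU1; have [//|ne] := eqVneq y o.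
by rewrite (Y_mem xX) // !inE.
Qed.

(** The link lies in [W], so load 3 forces an even degree. Degree 4 is excluded because such a
    vertex sees three colours and has load at most 2. *)
Lemma I_deg x : x \in X3in -> [/\ nb x \subset W, 6 <= #|nb x| & forall u, adj x u ->
  #|nb x| = 2 * #|[set z | c z == c u] :&: nb x|].
Proof.
move=> /setIdP[xX nox]; have [xW s3] := X3P xX.
have nW : nb x \subset W.
  by apply/subsetP => y; rewrite in_nb !inE => xy; apply: contraNneq nox => <-; rewrite adjC.
have ev u : adj x u -> #|nb x| = 2 * #|[set z | c z == c u] :&: nb x|.
  by apply: (s3_even adjI Ttri two cP Sc SI nW); rewrite s3.
split=> //; have [u xu _] := inner_nb x.
have d3 := deg_ge3 adjI Ttri two xu; have d2 := ev u xu.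
have d4 : #|nb x| != 4.
  apply/negP => d4; have xD : x \in D4 by rewrite inE.
  have [a [b [d [xa xb xd [ab bd ad]]]]] := see3 xD.
  have inW z : adj x z -> z \in W by move=> xz; apply: (subsetP nW); rewrite in_nb.
  have := s_see3 Sc SI (inW a xa) (inW b xb) (inW d xd) xa xb xd ab bd ad.
  by rewrite s3.
by move: d3 d2 d4; clear; move: #|nb x| #|_ :&: _| => a b; lia.
Qed.

(** Three owners, two colours on an edge of the link, and [c o] cannot be six different indices. *)
Lemma sees_o x : x \in X3 -> c o \notin owners x -> exists2 u, u \in W & adj x u /\ c u = c o.
Proof.
move=> xX oP; have [xW s3] := X3P xX.
have [u [w [h uW wW]]] := inner_tri1 x; have [xu uw xw] := tr_adj h.
have [E|nu] := eqVneq (c u) (c o); first by exists u.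
have [E|nw] := eqVneq (c w) (c o); first by exists w.
have d : [disjoint owners x & [set c u; c w; c o]].
  rewrite -setI_eq0; apply/eqP/setP => i; rewrite in_set0 in_setI; apply/negP => /andP[iP].
  rewrite !inE -orbA => /or3P[]/eqP E.
  - by have := s_nb Sc SI uW xu iP; rewrite E eqxx.
  - by have := s_nb Sc SI wW xw iP; rewrite E eqxx.
  - by rewrite E (negbTE oP) in iP.
have := card5 d; rewrite -/(load x) s3 setUC cardsU1 cards2 (cP uw) !inE negb_or.
by rewrite ![c o == _]eq_sym nu nw.
Qed.

Lemma card_X3 : #|X3| = #|X3in| + #|Bd1| + #|Bd2|.
Proof.
rewrite (card_sum X3 (fun x => ~~ adj o x)) (card_sum X3 (fun x => adj o x && (#|nb x| == 3))).
rewrite (card_sum X3 (fun x => adj o x && (#|nb x| != 3))) -[LHS]sum1_card -!big_split /=.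
by apply: eq_bigr => x _; case: (adj o x); case: (#|nb x| == 3).
Qed.

(** The planar bipartite bound between [X3] and [o |: NX3], which by [nb_X3] counts all edges at
    [X3]. *)
Lemma bipartite_count : 0 < #|X3| -> 6 * #|X3in| + 3 * #|Bd1| + 4 * #|Bd2| + 4 <= 2 * (#|X3| + #|NX3| + 1).
Proof.
move=> /card_gt0P[x0 x0X].
have oY : o \notin NX3 by apply/negP => /YP[]; rewrite !inE eqxx.
have cY : #|o |: NX3| = #|NX3| + 1 by rewrite cardsU1 oY addnC.
have dis : [disjoint X3 & o |: NX3].
  rewrite -setI_eq0; apply/eqP/setP => x; rewrite in_set0; apply/negP => /setIP[xX /setU1P[E|xY]].
    by have [] := X3P xX; rewrite E !inE eqxx.
  by have := X3_Y xX; rewrite xY.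
have big : 3 <= #|X3| + #|o |: NX3|.
  have [u [w [h uW wW]]] := inner_tri1 x0; have [xu uw xw] := tr_adj h.
  have : #|[set u; w]| <= #|NX3|.
    by apply: subset_leq_card; rewrite subset_pair !(Y_mem x0X).
  have : 0 < #|X3| by apply/card_gt0P; exists x0.
  by rewrite cards2 (adj_neq adjI uw) cY; clear; lia.
have := bip_bound adjI Ttri two span dis big.
rewrite cY addnA; apply: leq_trans; rewrite leq_add2r.
under [leqRHS]eq_bigr => x xX do rewrite nb_X3 //.
apply: leq_trans (_ : \sum_(x in X3) ((if ~~ adj o x then 6 else 0) +
  (if adj o x && (#|nb x| == 3) then 3 else 0) + (if adj o x && (#|nb x| != 3) then 4 else 0)) <= _).
  by rewrite !big_split /= -!big_mkcondr /= !sum_nat_cond_const ![_ * #|_|]mulnC.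
apply: leq_sum => x xX; have [ox|nox] /= := boolP (adj o x); last first.
  by rewrite !addn0; have [] // : [/\ nb x \subset W, 6 <= #|nb x| & _] := I_deg _; apply/setIdP.
have : 3 <= #|nb x| by apply: (deg_ge3 adjI Ttri two (u := o)); rewrite adjC.
by case: eqP => [->//|] /=; clear; move: #|nb x| => a; lia.
Qed.

(** A triangle at [o] contains at most one vertex of [X3], and then its third vertex is in [NX3b].
    Every neighbour of [o] lies on two of these triangles. *)
Lemma boundary_count : #|Bd1| + #|Bd2| <= #|NX3b|.
Proof.
pose Bd := [set x in X3 | adj o x].
have -> : #|Bd1| + #|Bd2| = #|Bd|.
  rewrite -!sum1dep_card !big_mkcondr /= -big_split /=.
  by apply: eq_bigr => x _; case: (adj o x); case: (#|nb x| == 3).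
have BdP x : x \in Bd -> x \in X3 /\ adj o x by move=> /setIdP.
have oB : o \notin Bd by apply/negP => /BdP[_]; rewrite adjI.
have oY : o \notin NX3b by apply/negP => /setIdP[_]; rewrite adjI.
have h1 := star_count Ttri two oB; have h2 := star_count Ttri two oY.
rewrite (setIidPl _) in h1; last by apply/subsetP => x /BdP[_]; rewrite in_nb.
rewrite (setIidPl _) in h2; last by apply/subsetP => x /setIdP[_]; rewrite in_nb.
suff : \sum_(t in T | o \in t) #|t :&: Bd| <= \sum_(t in T | o \in t) #|t :&: NX3b|.
  by rewrite h1 h2 leq_pmul2l.
apply: leq_sum => t /andP[tT ot].
have le1 : #|t :&: Bd| <= 1.
  apply/card_le1_eqP => a b /setIP[at_ /BdP[aX _]] /setIP[bt /BdP[bX _]].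
  apply/eqP; apply: contraT => ne; have := X3_indep bX aX.
  by rewrite (tri_adj Ttri tT).
have [->//|/card_gt0P[a /setIP[at_ /BdP[aX oa]]]] := posnP #|t :&: Bd|.
apply: leq_trans le1 _; apply/card_gt0P.
have [b [Et h]] := tri_tr Ttri tT ot at_ (adj_neq adjI oa); have [_ ab ob] := tr_adj h.
exists b; apply/setIP; split; first by rewrite Et !inE eqxx orbT.
apply/setIdP; split=> //; apply: (Y_mem aX) => //.
by rewrite !inE eq_sym (adj_neq adjI ob).
Qed.

(** Such a vertex sees the colour [c o], hence on half of its at least six neighbours. The bipartite
    bound becomes [3 * x + 4 <= 2 * (x + y)]. *)
Lemma interior_count : #|X3in0| <= 2 * #|NX3o|.
Proof.
have [->//|I0p] := posnP #|X3in0|; have /card_gt0P[x0 x0I] := I0p.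
have three x : x \in X3in0 -> 3 <= #|[set y in NX3o | adj x y]|.
  move=> /setIdP[xI oP]; have /setIdP[xX _] := xI.
  have [nW d6 ev] := I_deg xI; have [u uW [xu cu]] := sees_o xX oP.
  have := ev u xu; rewrite cu => E.
  have : 3 <= #|[set z | c z == c o] :&: nb x| by move: d6; rewrite E; clear; lia.
  move=> /leq_trans; apply; apply: subset_leq_card; apply/subsetP => y /setIP[].
  rewrite inE in_nb => cy xy; apply/setIdP; split=> //; apply/setIdP; split=> //.
  by apply: (Y_mem xX) => //; apply: (subsetP nW); rewrite in_nb.
have dis : [disjoint X3in0 & NX3o].
  rewrite -setI_eq0; apply/eqP/setP => x; rewrite in_set0; apply/negP.
  by move=> /setIP[/setIdP[/setIdP[xX _] _] /setIdP[xY _]]; have := X3_Y xX; rewrite xY.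
have big : 3 <= #|X3in0| + #|NX3o|.
  have : #|[set y in NX3o | adj x0 y]| <= #|NX3o| by apply: subset_leq_card; apply/subsetP => y /setIdP[].
  by have := three x0 x0I; clear; move: #|_| #|_| #|_| => a b d; lia.
have := bip_bound adjI Ttri two span dis big.
have : 3 * #|X3in0| <= \sum_(x in X3in0) #|[set y in NX3o | adj x y]|.
  by rewrite mulnC -sum_nat_const; exact: leq_sum.
by clear; move: (\sum_(x in X3in0) _) #|X3in0| #|NX3o| => a b d; lia.
Qed.

Lemma NX3b_NX3o : #|NX3b| + #|NX3o| <= #|NX3|.
Proof.
rewrite (card_sum NX3 (fun y => adj o y)) (card_sum NX3 (fun y => c y == c o)) -[leqRHS]sum1_card.
rewrite -big_split /=; apply: leq_sum => y _.
case oy: (adj o y); case: eqP => // E; by have := cP oy; rewrite E eqxx.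
Qed.

(** Three disjoint parts of [S (c o)] are counted. For [Bd1]: if [c o] did not own [x], then [x]
    would have a neighbour [u] of colour [c o]; as [u] is not adjacent to [o], the apexes of [x u]
    together with [u] and [o] would be four neighbours of a vertex of degree 3. *)
Lemma S5_card : #|X3in| + #|NX3o| + #|Bd1| <= #|S (c o)| + #|X3in0|.
Proof.
have -> : #|X3in| = #|X3in :\: X3in0| + #|X3in0|.
  have := cardsID X3in0 X3in; rewrite (setIidPr _); first by rewrite addnC.
  by apply/subsetP => x /setIdP[].
have dis1 : [disjoint X3in :\: X3in0 & NX3o :|: Bd1].
  rewrite -setI_eq0; apply/eqP/setP => x; rewrite in_set0; apply/negP.
  move=> /setIP[/setDP[/setIdP[xX nox] _] /setUP[/setIdP[xY _]|/setIdP[_ /andP[ox _]]]].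
    by have := X3_Y xX; rewrite xY.
  by rewrite ox in nox.
have dis2 : [disjoint NX3o & Bd1].
  rewrite -setI_eq0; apply/eqP/setP => x; rewrite in_set0; apply/negP.
  by move=> /setIP[/setIdP[xY _] /setIdP[xX _]]; have := X3_Y xX; rewrite xY.
suff : #|(X3in :\: X3in0) :|: (NX3o :|: Bd1)| <= #|S (c o)|.
  rewrite !cardsU !disjoint_setI0 // !cards0 !subn0; clear.
  by move: #|_| #|_| #|_| #|_| #|_| => a b d e f; lia.
apply: subset_leq_card; apply/subsetP => x /setUP[/setDP[xI nI0]|/setUP[/setIdP[/YP[xW _] /eqP]|]].
- by move: nI0; rewrite !inE in xI *; rewrite xI /= negbK.
- exact: Sc.
move=> /setIdP[xX /andP[ox /eqP d3]].
suff : c o \in owners x by rewrite inE.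
apply: contraT => oP; have [u uW [xu cu]] := sees_o xX oP.
have [p [q [hp hq pq]]] := apexes adjI Ttri two xu.
have [_ up xp] := tr_adj hp; have [_ uq xq] := tr_adj hq.
have nuo : ~~ adj u o by apply/negP => /cP; rewrite cu eqxx.
have : #|[set u; p; q; o]| <= #|nb x|.
  apply: subset_leq_card; apply/subsetP => z; rewrite !inE -!orbA.
  by move=> /or4P[]/eqP-> //; rewrite adjC.
have nuo' : u != o by move: uW; rewrite !inE.
have npo : p != o by apply: contraNneq nuo => <-.
have nqo : q != o by apply: contraNneq nuo => <-.
rewrite d3 setUC cardsU1 !inE !negb_or ![o == _]eq_sym nuo' npo nqo /=.
rewrite setUC cardsU1 !inE !negb_or ![q == _]eq_sym (adj_neq adjI uq) pq cards2.
by rewrite (adj_neq adjI up).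
Qed.

(** Take [bipartite_count] once, [boundary_count] with [NX3b_NX3o] three times, and [S5_card] with
    [interior_count] once: the coefficients of [X3in], [Bd1] and [Bd2] all become exactly 5. *)
Lemma excess_le : 5 * #|X3| <= #|S (c o)| + 5 * #|NX3|.
Proof.
have [->//|X3p] := posnP #|X3|.
have := bipartite_count X3p; have := boundary_count; have := interior_count; have := NX3b_NX3o; have := S5_card; rewrite card_X3; clear.
by move: #|X3in| #|Bd1| #|Bd2| #|NX3b| #|X3in0| #|NX3o| #|NX3| #|S (c o)| => a b d e f g h k; lia.
Qed.

(** Replacing every load by 2 is off by [#|X3| - #|X1|], which [excess_le] controls because [NX3]
    lies in [X1]. *)
Lemma weighted_sum : 5 * \sum_i #|S i| <= 10 * #|W| + #|S (c o)|.
Proof.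
have so : load o = 0.
  apply/eqP; rewrite cards_eq0; apply/eqP/setP => i; rewrite !inE; apply/negP => /(subsetP (SW i)).
  by rewrite !inE eqxx.
have : \sum_(v in W) (load v + (load v == 1)) = \sum_(v in W) (2 + (load v == 3)).
  by apply: eq_bigr => v /s13; case: (load v) => [|[|[|[|]]]].
rewrite !big_split /= sum_nat_const.
have toc (k : nat) : \sum_(v in W) (load v == k) = #|[set v in W | load v == k]|.
  by rewrite -sum1dep_card big_mkcondr /=; apply: eq_bigr => v _; case: (_ == _).
rewrite !toc -/X1 -/X3.
have -> : \sum_(v in W) load v = \sum_i #|S i|.
  rewrite -(sum_S S) [RHS](bigD1 o) //= so add0n; apply: eq_bigl => v; by rewrite !inE.
have := subset_leq_card Y_X1; have := excess_le; clear.
by move: (\sum_i #|S i|) #|W| #|X1| #|X3| #|NX3| #|S (c o)| => a b d e f g; lia.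
Qed.
End Weights.

Definition is_idsW (S : {set V}) := [/\ S \subset W, forall u v, u \in S -> v \in S -> ~~ adj u v &
  forall w, w \in W -> w \in S \/ exists2 u, u \in S & adj u w].

Hypothesis indec : forall X : {set {set V}}, X \subset T ->
  (forall e, e \in edges adj -> bd X e = false) -> X = set0 \/ X = T.

(** If all five sets had more than [m] elements, [weighted_sum] would give at least
    [(4 * 5 + 4) * m.+1] on the left of [10 * #|W|]. *)
Lemma ids_punctured m : 10 * #|W| < 24 * m.+1 -> exists S, is_idsW S /\ #|S| <= m.
Proof.
move=> lt; have [[c6 [t tt]]|isol] := octahedral_or_isolated adjI Ttri two indec cov.
  have m2 : 2 <= m.
    by move: lt; have := cardsC [set o]; rewrite cards1 c6; clear; move: #|_| => a; lia.
  have /setIdP[tT /subsetP tD] := tt.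
  have [v vt vo] : exists2 v, v \in t & v != o.
    have /is_triP[c3 _] := Ttri tT.
    have /card_gt0P[v] : 0 < #|t :\ o| by have := cardsD1 o t; rewrite c3; clear; case: (o \in t); lia.
    by rewrite !inE => /andP[vo vt]; exists v.
  have vW : v \in W by rewrite !inE.
  have [z [zv nvz H]] := small_indep_dom adjC adjI c6 (D4P (tD v vt)).
  (* [v] alone dominates everything but [z], so [z] may be dropped when it is [o]. *)
  exists ([set v; z] :\ o); split.
    split; first by apply/subsetP => u; rewrite !inE => /andP[].
      move=> a b; rewrite !inE => /andP[_ ha] /andP[_ hb].
      by case/orP: ha hb => /eqP-> /orP[]/eqP->; rewrite ?adjI // adjC.
    move=> w; rewrite !inE => wo; have [Ew|[Ew|vw]] := H w.
    - by left; rewrite wo Ew eqxx.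
    - by left; rewrite wo Ew eqxx orbT.
    - by right; exists v; rewrite // !inE vo eqxx.
  apply: leq_trans m2; apply: leq_trans (subset_leq_card (subsetDl _ _)) _.
  by rewrite cards2; case: (_ != _).
have [c [cP see3 poles]] := good_coloring adjC adjI Ttri two span isol.
have [S SP] := dominating_family adjC adjI cP W.
have SW i : S i \subset W by have [] := SP i.
have Sc i v : v \in W -> c v = i -> v \in S i by have [_ h _ _] := SP i; exact: h.
have SI i u v : u \in S i -> v \in S i -> ~~ adj u v by have [_ _ h _] := SP i; exact: h.
have ws := weighted_sum cP see3 SW Sc SI.
have [/existsP[i Si]|/existsPn no] := boolP [exists i, #|S i| <= m].
  by exists (S i); split=> //; have [h0 _ h1 h2] := SP i.
have big : forall i, m < #|S i| by move=> i; rewrite ltnNge; exact: no.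
move: ws; rewrite (bigD1 (c o)) //=.
have : 4 * m.+1 <= \sum_(i < 5 | i != c o) #|S i|.
  apply: leq_trans (_ : \sum_(i < 5 | i != c o) m.+1 <= _); last by apply: leq_sum.
  rewrite sum_nat_cond_const leq_mul2r; apply/orP; right.
  have := cardsC [set c o]; rewrite cards1 card_ord => h.
  have : #|~: [set c o]| = #|[set i | i != c o]| by apply: eq_card => i; rewrite !inE.
  by move: h; clear; move: #|_| #|_| => a b; lia.
have := big (c o); move: lt; clear.
by move: #|S (c o)| (\sum_(i < 5 | _) _) #|W| => a b d; lia.
Qed.
End Punctured.

(** * Closing near triangulations *)

Lemma bdP (V : finType) (X : {set {set V}}) e : bd X e -> exists2 t, t \in X & e \subset t.
Proof.
move=> h; have [/existsP[t /andP[tX et]]|/existsPn no] := boolP [exists t, (t \in X) && (e \subset t)].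
  by exists t.
by move: h; rewrite /bd big1 // => t tX; apply/negbTE; have := no t; rewrite tX.
Qed.

Lemma big_option (V : finType) (Q : pred (option V)) (F : option V -> bool) :
  \big[addb/false]_(z | Q z) F z =
  (Q None && F None) (+) \big[addb/false]_(x | Q (Some x)) F (Some x).
Proof.
rewrite (bigID (pred1 None)) /=; congr addb.
  rewrite (eq_bigr (fun i => (i == None) && F None)) ?xor_pred1 /=; last first.
    by move=> i /andP[_ /eqP->]; rewrite eqxx.
  by rewrite eqxx andbT.
rewrite (reindex_omap Some id) /=; last by case=> [x|] //; rewrite eqxx andbF.
by apply: eq_bigl => x; rewrite eqxx !andbT.
Qed.

Section Chains.
Variables (V : finType) (adj : rel V).
Hypotheses (adjC : symmetric adj) (adjI : irreflexive adj).
Implicit Types (u v w x y : V) (e t : {set V}) (Q X : {set {set V}}).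

Lemma dv_set Q x : Q \subset edges adj ->
  dv adj (fun e => e \in Q) x = \big[addb/false]_(e in Q) (x \in e).
Proof.
move=> /subsetP QE; rewrite /dv big_mkcond [RHS]big_mkcond; apply: eq_bigr => e _.
have [eQ|_] := boolP (e \in Q); first by rewrite QE // andbT.
by rewrite andbF; case: ifP.
Qed.

Lemma dv_nb (C : {set V} -> bool) x : dv adj C x = \big[addb/false]_(u in nb adj x) C [set x; u].
Proof.
have E : [set e in edges adj | x \in e] = [set [set x; u] | u in nb adj x].
  apply/setP => e; apply/idP/imsetP.
    move=> /setIdP[/edgesP[a [b [ab ->]]]].
    rewrite !inE => /orP[]/eqP->; first by exists b; rewrite ?in_nb.
    by exists a; rewrite ?in_nb ?[adj b a]adjC // setUC.
  move=> [u]; rewrite in_nb => xu ->; apply/setIdP; split; first exact: mem_edges.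
  by rewrite !inE eqxx.
rewrite -(big_imset (h := fun u => [set x; u]) (A := mem (nb adj x)) C); last first.
  move=> a b; rewrite !in_nb => xa xb /set2_eq[[_ //]|[Ev Ea]].
  by rewrite -Ev adjI in xb.
rewrite -E /dv big_mkcond [RHS]big_mkcond; apply: eq_bigr => e _.
by rewrite inE; case: (e \in edges adj); case: (x \in e).
Qed.

Lemma chain (r : rel V) u v : (forall x y, r x y -> adj x y) -> connect r u v ->
  exists Q : {set {set V}}, [/\ Q \subset edges adj,
    forall e, e \in Q -> exists x y, r x y /\ e = [set x; y] &
    forall x, \big[addb/false]_(e in Q) (x \in e) = (x == u) (+) (x == v)].
Proof.
move=> radj /connectP[p]; elim: p u => [|w p IH] u /=.
  move=> _ ->; exists set0; split; [exact: sub0set | by move=> e; rewrite inE |].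
  by move=> x; rewrite big_set0 addbb.
move=> /andP[uw wp] E; have [Q [QE Qr Qs]] := IH w wp E.
exists (sdiff [set [set u; w]] Q); split.
- by apply: sdiff_sub; rewrite // sub1set mem_edges // radj.
- move=> e; rewrite in_sdiff inE; case: eqP => [-> _|_ /= eQ]; last exact: Qr.
  by exists u, w.
- move=> x; rewrite xor_sdiff big_set1 Qs !inE.
  have := adj_neq adjI (radj _ _ uw).
  have [->|_] := eqVneq x u; last by case: (x == w); case: (x == v).
  by move=> /negbTE ->; case: (u == v).
Qed.
End Chains.

Lemma xor_tri (V : finType) (adj : rel V) (f : {set V} -> bool) u v w :
  irreflexive adj -> adj u v -> adj v w -> adj w u ->
  \big[addb/false]_(e in edges adj) ((e \subset [set u; v; w]) && f e) =
  f [set u; v] (+) f [set v; w] (+) f [set w; u].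
Proof.
move=> adjI uv vw wu; set t := [set u; v; w].
have nuv := adj_neq adjI uv; have nvw := adj_neq adjI vw; have nwu := adj_neq adjI wu.
have n1 : [set u; v] != [set v; w] :> {set V}.
  by apply/eqP => /set2_eq[[E _]|[E _]]; rewrite E eqxx in nuv nwu.
have n2 : [set v; w] != [set w; u] :> {set V}.
  by apply/eqP => /set2_eq[[E _]|[E _]]; rewrite E eqxx in nuv nvw.
have n3 : [set w; u] != [set u; v] :> {set V}.
  by apply/eqP => /set2_eq[[E _]|[E _]]; rewrite E eqxx in nwu nvw.
rewrite (eq_bigr (fun e => ((e == [set u; v]) && f e) (+) ((e == [set v; w]) && f e) (+) ((e == [set w; u]) && f e))).
  by rewrite !xorD !xor_pred1 !mem_edges.
move=> e /edgesP[a [b [ab Ee]]]; have nab := adj_neq adjI ab.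
have [h|h] := boolP (e \subset t); last first.
  have no p q : p \in t -> q \in t -> (e == [set p; q]) = false.
    by move=> pt qt; apply/negbTE; apply: contraNneq h => ->; rewrite subset_pair pt qt.
  by rewrite !no ?inE ?eqxx ?orbT.
have [->|[->|->]] : e = [set u; v] \/ e = [set v; w] \/ e = [set w; u].
- move: h; rewrite Ee subset_pair !inE -!orbA => /andP[/or3P[]/eqP Ea /or3P[]/eqP Eb]; subst a b;
  rewrite ?eqxx // in nab *; by [auto | rewrite setUC; auto].
- by rewrite eqxx (negbTE n1) eq_sym (negbTE n3) /= !addbF.
- by rewrite eqxx (negbTE n2) eq_sym (negbTE n1) /= addbF.
- by rewrite eqxx (negbTE n3) eq_sym (negbTE n2) /=.
Qed.

(** * The boundary cycle of a near triangulation *)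

Section NearTriangulation.
Variables (V : finType) (adj : rel V).
Hypotheses (adjC : symmetric adj) (adjI : irreflexive adj).
Variable B : {set {set V}}.
Hypothesis Btri : forall t, t \in B -> is_tri adj t.
Hypothesis le2 : forall u v, adj u v -> #|[set t in B | [set u; v] \subset t]| <= 2.
Hypothesis bspan : forall C, (forall v, dv adj C v = false) ->
  exists X : {set {set V}}, X \subset B /\ forall e, e \in edges adj -> C e = bd X e.
Hypothesis bindep : forall X : {set {set V}}, X \subset B ->
  (forall e, e \in edges adj -> bd X e = false) -> X = set0.
Hypothesis V3 : 2 < #|V|.
Hypothesis conn : forall X : {set V}, #|X| < 2 -> forall u v, u \notin X -> v \notin X ->
  connect [rel x y | [&& adj x y, x \notin X & y \notin X]] u v.
Implicit Types (u v w x y : V) (e t : {set V}) (X Q : {set {set V}}).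

Definition mult e := #|[set t in B | e \subset t]|.

Lemma chain_avoid z u v : u != z -> v != z -> exists Q : {set {set V}}, [/\ Q \subset edges adj,
    forall e, e \in Q -> z \notin e &
    forall x, \big[addb/false]_(e in Q) (x \in e) = (x == u) (+) (x == v)].
Proof.
move=> uz vz; have := @conn [set z]; rewrite cards1 => /(_ isT u v); rewrite !inE => /(_ uz vz) h.
have [|Q [QE Qr Qs]] := chain adjI _ h; first by move=> x y /and3P[].
exists Q; split=> // e /Qr[x [y [/and3P[_ xz yz] ->]]].
by move: xz yz; rewrite !inE !negb_or ![z == _]eq_sym => -> ->.
Qed.

Lemma even_span Q : Q \subset edges adj -> (forall x, \big[addb/false]_(e in Q) (x \in e) = false) ->
  exists X, X \subset B /\ forall e, e \in edges adj -> (e \in Q) = bd X e.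
Proof. by move=> QE Q0; apply: bspan => x; rewrite dv_set. Qed.

(** By 2-connectedness [a b] lies on a cycle: join [a] and [b] to a third vertex [z] by chains that
    avoid [b] and [a] respectively. This cycle bounds, so some triangle contains [a b]. *)
Lemma edge_tri a b : adj a b -> exists2 t, t \in B & [set a; b] \subset t.
Proof.
move=> ab; have nab := adj_neq adjI ab.
have /card_gt0P[z] : 0 < #|~: [set a; b]|.
  by have := cardsC [set a; b]; rewrite cards2 nab; move: V3; clear; move: #|V| #|_| => n k; lia.
rewrite !inE negb_or => /andP[za zb].
have [Q1 [Q1E Q1b Q1s]] := chain_avoid nab zb.
have [Q2 [Q2E Q2a Q2s]] := chain_avoid za (neq_sym nab).
have e1 : [set a; b] \notin Q1 by apply/negP => /Q1b; rewrite !inE eqxx orbT.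
have e2 : [set a; b] \notin Q2 by apply/negP => /Q2a; rewrite !inE eqxx.
have eE := mem_edges ab.
have [||X [XB XE]] := @even_span (sdiff (sdiff Q1 Q2) [set [set a; b]]).
- by rewrite !sdiff_sub // sub1set.
- move=> x; rewrite !xor_sdiff Q1s Q2s big_set1 !inE.
  have [->|_] := eqVneq x a; first by rewrite (negbTE nab); case: (a == z).
  by case: (x == z); case: (x == b).
have : bd X [set a; b] by rewrite -XE // !in_sdiff (negbTE e1) (negbTE e2) inE eqxx.
by move=> /bdP[t tX et]; exists t => //; exact: (subsetP XB).
Qed.

Lemma mult12 a b : adj a b -> mult [set a; b] = 1 \/ mult [set a; b] = 2.
Proof.
move=> ab; have := le2 ab; have [t tB et] := edge_tri ab.
have : 0 < mult [set a; b] by apply/card_gt0P; exists t; apply/setIdP.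
by rewrite /mult; case: #|_| => [|[|[|]]]; auto.
Qed.

Lemma bd_two X e t t' : X \subset B -> e \in edges adj -> t \in B -> t' \in B -> t != t' ->
  e \subset t -> e \subset t' -> bd X e = (t \in X) (+) (t' \in X).
Proof.
move=> XB /edgesP[a [b [ab Ee]]] tB t'B ne et et'.
have E : [set s in B | e \subset s] = [set t; t'].
  apply/esym/eqP; rewrite eqEcard cards2 ne /=; apply/andP; split; last by rewrite Ee le2.
  by apply/subsetP => s; rewrite !inE => /orP[]/eqP->; rewrite ?tB ?t'B ?et ?et'.
rewrite /bd (eq_bigr (fun s => ((s == t) && true) (+) ((s == t') && true))).
  by rewrite xorD !xor_pred1 !andbT.
move=> s sX; have : (s \in [set s in B | e \subset s]) = (s \in [set t; t']) by rewrite E.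
rewrite !inE (subsetP XB s sX) /= => ->; rewrite !andbT.
by have [->|_] := eqVneq s t; rewrite ?(negbTE ne).
Qed.

Lemma bd_one X e t : X \subset B -> mult e = 1 -> t \in B -> e \subset t -> bd X e = (t \in X).
Proof.
move=> XB m1 tB et.
have E : [set s in B | e \subset s] = [set t].
  apply/esym/eqP; rewrite eqEcard cards1 -/(mult e) m1 andbT sub1set; exact/setIdP.
rewrite /bd (eq_bigr (fun s => (s == t) && true)); first by rewrite xor_pred1 andbT.
move=> s sX; have : (s \in [set s in B | e \subset s]) = (s \in [set t]) by rewrite E.
by rewrite !inE (subsetP XB s sX) /= => ->; rewrite andbT.
Qed.

(* Otherwise the indicator of the edges from x to N would vanish on every
   triangle but not on a cycle through x. *)
Lemma link_connected x (N : {set V}) u1 u2 : N \subset nb adj x ->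
  (forall u u', u \in N -> tr B x u u' -> u' \in N) -> u1 \in N -> adj x u2 -> u2 \in N.
Proof.
move=> /subsetP NN cl u1N xu2; apply: contraT => u2N.
have xu1 : adj x u1 by have := NN _ u1N; rewrite in_nb.
have n1 : u1 != x by rewrite eq_sym (adj_neq adjI xu1).
have n2 : u2 != x by rewrite eq_sym (adj_neq adjI xu2).
have n12 : u1 != u2 by apply: contraNneq u2N => <-.
have [Q [QE Qx Qs]] := chain_avoid n1 n2.
have [||X [XB XE]] := @even_span (sdiff (sdiff Q [set [set x; u1]]) [set [set x; u2]]).
- by rewrite !sdiff_sub // sub1set mem_edges.
- move=> y; rewrite !xor_sdiff Qs !big_set1 !inE.
  have [->|_] := eqVneq y x; first by rewrite eq_sym (negbTE n1) eq_sym (negbTE n2).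
  by case: (y == u1); case: (y == u2).
have : \big[addb/false]_(u in N) bd X [set x; u] = true.
  rewrite (eq_bigr (fun u => (u == u1) && true)) ?xor_pred1 ?u1N // => u uN.
  have xu : adj x u by have := NN _ uN; rewrite in_nb.
  rewrite -XE ?mem_edges // !in_sdiff !in_set1 andbT.
  have -> : [set x; u] \in Q = false by apply/negbTE/negP => /Qx; rewrite !inE eqxx.
  have eqs a : ([set x; u] == [set x; a]) = (u == a).
    apply/eqP/eqP => [/set2_eq[[_ //]|[E1 E2]]|-> //]; by rewrite E2 adjI in xu.
  rewrite !eqs; have [E|] := eqVneq u u2; last by rewrite addbF.
  by rewrite E in uN; rewrite uN in u2N.
rewrite /bd exchange_big /= big1 // => t /(subsetP XB) tB.
have [xt|xt] := boolP (x \in t); last first.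
  by rewrite big1 // => u _; rewrite subset_pair (negbTE xt).
have [p [q [Et h]]] := tri_tr1 Btri tB xt; have [xp pq xq] := tr_adj Btri h.
have npq : (p \in N) = (q \in N).
  by apply/idP/idP => hN; [apply: (cl p) | apply: (cl q)] => //; trp.
rewrite (eq_bigr (fun u => ((u == p) && true) (+) ((u == q) && true))).
  by rewrite xorD !xor_pred1 !andbT npq addbb.
move=> u uN; have xu : adj x u by have := NN _ uN; rewrite in_nb.
rewrite subset_pair xt Et !inE !andbT [u == x]eq_sym (negbTE (adj_neq adjI xu)) /=.
by have [->|_] := eqVneq u p; rewrite ?(negbTE (adj_neq adjI pq)).
Qed.

Definition star x := [set t in B | x \in t].

(** A connected graph has at most one vertex more than edges, here for the link of [x]. Cuts are
    counted: two sets with the same cut are equal or differ by the whole link. *)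
Lemma link_edges x : #|nb adj x| <= #|star x|.+1.
Proof.
rewrite -(leq_exp2l (m := 2)) // expnS -!card_powerset.
pose f (A : {set V}) := [set t in star x | odd #|t :&: A|].
apply: (card_le_fibers (f := f)).
  by move=> A _; rewrite inE; apply/subsetP => t /setIdP[].
move=> Z _; have [->//|/card_gt0P[A0]] := posnP #|[set A in powerset (nb adj x) | f A == Z]|.
move=> /setIdP[]; rewrite powersetE => A0N /eqP fA0.
apply: leq_trans (_ : #|[set A0; sdiff A0 (nb adj x)]| <= _); last by rewrite cards2; case: (_ != _).
apply: subset_leq_card; apply/subsetP => A /setIdP[]; rewrite powersetE => AN /eqP fA.
pose D := sdiff A A0.
have DN : D \subset nb adj x by exact: sdiff_sub.
have cl u u' : u \in D -> tr B x u u' -> u' \in D.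
  move=> uD h; have [xu uu' xu'] := tr_adj Btri h.
  have parity (A1 : {set V}) : A1 \subset nb adj x ->
      odd #|[set x; u; u'] :&: A1| = (u \in A1) (+) (u' \in A1).
    move=> A1N; have xA : x \notin A1.
      by apply/negP => /(subsetP A1N); rewrite in_nb adjI.
    have -> : [set x; u; u'] :&: A1 = [set y | y \in A1 & y \in [set x; u; u']].
      by apply/setP => y; rewrite !inE andbC.
    rewrite -xor_card (eq_bigr (fun y => ((y == u) && true) (+) ((y == u') && true))).
      by rewrite xorD !xor_pred1 !andbT.
    move=> y yA; rewrite !inE !andbT; have -> : (y == x) = false.
      by apply/negbTE; apply: contraNneq xA => <-.
    by have [->|_] := eqVneq y u; rewrite ?(negbTE (adj_neq adjI uu')).
  have : ([set x; u; u'] \in f A) = ([set x; u; u'] \in f A0) by rewrite fA fA0.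
  have ts : [set x; u; u'] \in star x by apply/setIdP; split=> //; rewrite !inE eqxx.
  rewrite ![_ \in f _]inE ts /= !parity //; move: uD; rewrite !in_sdiff.
  by case: (u \in A); case: (u \in A0); case: (u' \in A); case: (u' \in A0).
rewrite !inE.
have [D0|/set0Pn[u uD]] := eqVneq D set0.
  apply/orP; left; apply/eqP/setP => y.
  by have : (y \in D) = false; [rewrite D0 inE | rewrite in_sdiff; case: (y \in A); case: (y \in A0)].
apply/orP; right; apply/eqP/setP => y.
have : (y \in D) = (y \in nb adj x).
  apply/idP/idP => [/(subsetP DN)//|]; rewrite in_nb => xy; exact: (link_connected DN cl uD xy).
by rewrite !in_sdiff => <-; case: (y \in A); case: (y \in A0).
Qed.

Lemma mult_sum x : \sum_(u in nb adj x) mult [set x; u] = 2 * #|star x|.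
Proof.
rewrite mulnC -sum_nat_const.
under eq_bigr => u _ do rewrite /mult -sum1dep_card big_mkcondr /=.
rewrite exchange_big /= [RHS]big_mkcond [LHS]big_mkcond; apply: eq_bigr => t _.
rewrite inE; case tB: (t \in B) => //=.
case xt: (x \in t); last by rewrite big1 // => u _; rewrite subset_pair xt.
have [p [q [Et h]]] := tri_tr1 Btri tB xt; have [xp pq xq] := tr_adj Btri h.
rewrite -big_mkcondr sum1dep_card /= (_ : [set _ | _] = [set p; q]).
  by rewrite cards2 (adj_neq adjI pq).
apply/setP => u; rewrite !inE subset_pair xt Et !inE /=.
have [->|_] := eqVneq u p; first by rewrite xp !orbT.
have [->|_] := eqVneq u q; first by rewrite xq !orbT.
by rewrite !orbF; case: eqP => [->|]; rewrite ?adjI ?andbF.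
Qed.

Definition BE := [set e in edges adj | mult e == 1].
Definition be : rel V := fun x u => adj x u && (mult [set x; u] == 1).
Definition bv x := [exists u, be x u].

Lemma BE_pair x u : adj x u -> ([set x; u] \in BE) = be x u.
Proof. by move=> xu; rewrite inE mem_edges // /be xu. Qed.

Lemma be_sym : symmetric be.
Proof. by move=> x u; rewrite /be adjC setUC. Qed.

Lemma BEP e : e \in BE -> exists a b, [/\ adj a b, be a b & e = [set a; b]].
Proof.
move=> eB; have /setIdP[/edgesP[a [b [ab Ee]]] m1] := eB.
by exists a, b; split=> //; rewrite /be ab -Ee.
Qed.

Lemma BE_bv e x : e \in BE -> x \in e -> bv x.
Proof.
move=> /BEP[a [b [ab h ->]]]; rewrite !inE => /orP[]/eqP->; apply/existsP; first by exists b.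
by exists a; rewrite be_sym.
Qed.

Lemma card_BE x : #|[set e in BE | x \in e]| = #|[set u | be x u]|.
Proof.
have -> : [set e in BE | x \in e] = [set [set x; u] | u in [set u | be x u]].
  apply/setP => e; apply/idP/imsetP.
    move=> /setIdP[/BEP[a [b [ab h ->]]]].
    rewrite !inE => /orP[]/eqP->; first by exists b; rewrite ?inE.
    by exists a; [rewrite inE be_sym | rewrite setUC].
  move=> [u]; rewrite inE => h ->; have /andP[xu _] := h.
  by apply/setIdP; rewrite BE_pair // !inE eqxx.
rewrite card_in_imset // => a b; rewrite !inE => /andP[xa _] /andP[xb _] /set2_eq[[_ //]|[Ev Ea]].
by rewrite -Ev adjI in xb.
Qed.

(** By [mult_sum] the number of boundary edges at [x] is [2 * (#|nb adj x| - #|star x|)], hence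
    even, and [link_edges] bounds it by 2. *)
Lemma boundary_degree x : #|[set e in BE | x \in e]| = if bv x then 2 else 0.
Proof.
rewrite card_BE; set k := #|_|.
have h : 2 * #|star x| + k = 2 * #|nb adj x|.
  rewrite -mult_sum; have -> : k = \sum_(u in nb adj x) (mult [set x; u] == 1).
    rewrite /k -sum1dep_card big_mkcond [RHS]big_mkcond; apply: eq_bigr => u _.
    by rewrite in_nb /be; case: (adj x u) => //=; case: (_ == 1).
  rewrite -big_split /= mulnC -sum_nat_const; apply: eq_bigr => u; rewrite in_nb => xu.
  by have [->|->] := mult12 xu.
have h2 := link_edges x.
have : k = 0 \/ k = 2 by move: h h2; clear; move: #|star x| #|nb adj x| => a b; lia.
rewrite /bv; case: existsP => [[u xu]|no] [k0|k2] //.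
  by have : u \in set0; [rewrite -(cards0_eq k0) inE | rewrite inE].
have /card_gt0P[u] : 0 < k by rewrite k2.
by rewrite inE => xu; case: no; exists u.
Qed.

(** Membership in [X] passes across inner edges, so it spreads around each vertex by
    [link_connected] and then along paths of the graph. *)
Lemma indecomposable X : X \subset B ->
  (forall e, e \in edges adj -> mult e = 2 -> bd X e = false) -> X = set0 \/ X = B.
Proof.
move=> XB X2; have [->|/set0Pn[t0 t0X]] := eqVneq X set0; [by left | right].
have same e t t' : e \in edges adj -> t \in X -> t' \in B -> e \subset t -> e \subset t' -> t' \in X.
  move=> eE tX t'B et et'; have tB := subsetP XB t tX.
  have [<-//|ne] := eqVneq t t'.
  have := bd_two XB eE tB t'B ne et et'; rewrite tX X2 //=; first by case: (t' \in X).
  have /edgesP[a [b [ab Ee]]] := eE; have [m1|m2] := mult12 ab; last by rewrite Ee.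
  have : #|[set t; t']| <= mult e.
    apply: subset_leq_card; apply/subsetP => s; rewrite !inE => /orP[]/eqP->; by rewrite ?tB ?t'B ?et ?et'.
  by rewrite cards2 ne Ee m1.
have stepA x u : (exists2 t, t \in X & x \in t) -> adj x u -> exists2 t, t \in X & (x \in t) && (u \in t).
  move=> [t tX xt] xu.
  pose N := [set w in nb adj x | [exists t in X, (x \in t) && (w \in t)]].
  have [p [q [Et h]]] := tri_tr1 Btri (subsetP XB t tX) xt; have [xp _ _] := tr_adj Btri h.
  suff : u \in N by move=> /setIdP[_ /existsP[t' /andP[]]]; exists t'.
  apply: (@link_connected x N p) => //.
  - by apply/subsetP => w /setIdP[].
  - move=> w w' /setIdP[]; rewrite in_nb => xw /existsP[t' /and3P[t'X xt' wt']] hw.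
    have [_ _ xw'] := tr_adj Btri hw.
    have t2 : [set x; w; w'] \in X.
      by apply: (same [set x; w] t') => //; rewrite ?mem_edges // subset_pair ?xt' ?wt' // !inE !eqxx orbT.
    apply/setIdP; split; first by rewrite in_nb.
    by apply/existsP; exists [set x; w; w']; rewrite t2 !inE !eqxx !orbT.
  - apply/setIdP; split; first by rewrite in_nb.
    by apply/existsP; exists t; rewrite tX Et !inE !eqxx !orbT.
have all x : exists2 t, t \in X & x \in t.
  have [x0 x0t] : exists x0, x0 \in t0.
    by apply/card_gt0P; have /is_triP[-> _] := Btri (subsetP XB _ t0X).
  have := @conn set0; rewrite cards0 => /(_ isT x0 x); rewrite !inE => /(_ isT isT)/connectP[p].
  have : exists2 t, t \in X & x0 \in t by exists t0.
  elim: p x0 {x0t} => [|w p IH] x0 hx0 /=; first by move=> _ ->.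
  move=> /andP[/andP[xw _] wp]; apply: IH => //.
  by have [t tX /andP[_ wt]] := stepA _ _ hx0 xw; exists t.
apply/eqP; rewrite eqEsubset XB; apply/subsetP => t tB.
have [x xt] : exists x, x \in t by apply/card_gt0P; have /is_triP[-> _] := Btri tB.
have [p [q [Et h]]] := tri_tr1 Btri tB xt; have [xp _ _] := tr_adj Btri h.
have [t' t'X /andP[xt' pt']] := stepA _ _ (all x) xp.
apply: (same [set x; p] t') => //; rewrite ?mem_edges // subset_pair ?xt' ?pt' // Et.
by rewrite !inE !eqxx orbT.
Qed.

Lemma BE_sub : BE \subset edges adj.
Proof. by apply/subsetP => e /setIdP[]. Qed.

Lemma bd_B e : e \in BE -> bd B e.
Proof.
move=> eB; have /setIdP[eE /eqP m1] := eB; have [a [b [ab _ Ee]]] := BEP eB.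
have [t tB et] := edge_tri ab; rewrite -Ee in et.
by rewrite (bd_one (subxx B) m1 tB et).
Qed.

(** The boundary edges in the component of [r] form a cycle [Z]. It bounds a set whose boundary
    contains no inner edge, thus the empty set or [B]; as [Z] is not empty it is the whole
    boundary. *)
Lemma boundary_connected r x : bv r -> bv x -> connect be r x.
Proof.
move=> /existsP[r' rr'] /existsP[x' xx'].
have csym : connect_sym be by apply: sym_connect_sym; exact: be_sym.
pose Z := [set e in BE | [exists y in e, connect be r y]].
have ZP a b : be a b -> ([set a; b] \in Z) = connect be r a.
  move=> ab; have /andP[aab _] := ab; rewrite inE BE_pair // ab /=; apply/existsP/idP => [[y]|h].
    rewrite !inE => /andP[/orP[]/eqP-> // h]; apply: connect_trans h _.
    by rewrite csym; exact: connect1.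
  by exists a; rewrite !inE eqxx.
have ZE : Z \subset edges adj by apply: subset_trans BE_sub; apply/subsetP => e /setIdP[].
have [|X [XB XE]] := even_span ZE.
  move=> y; rewrite xor_card; have [cy|cy] := boolP (connect be r y); last first.
    rewrite (_ : [set _ | _ & _] = set0) ?cards0 //; apply/setP => e; rewrite in_set0 inE.
    apply/negP => /andP[eZ ye]; have /setIdP[/BEP[a [b [ab h Ee]]] _] := eZ.
    move: eZ ye; rewrite Ee ZP // !inE => ca /orP[]/eqP Ey; rewrite Ey in cy; first by rewrite ca in cy.
    by rewrite (connect_trans ca (connect1 h)) in cy.
  rewrite (_ : [set _ | _ & _] = [set e in BE | y \in e]); first by rewrite boundary_degree; case: (bv y).
  apply/setP => e; rewrite !in_set; apply/andP/andP => [[/andP[eB _] ye]|[eB ye]]; split=> //.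
  by rewrite eB; apply/existsP; exists y; rewrite ye.
have [|X0|XB'] := indecomposable XB.
- move=> e eE m2; rewrite -XE //; apply/negbTE/negP => /setIdP[/setIdP[_ /eqP]].
  by rewrite m2.
- have := XE _ (subsetP BE_sub _ (_ : [set r; r'] \in BE)).
  have /andP[arr _] := rr'; rewrite BE_pair // => /(_ rr').
  by rewrite X0 ZP // connect0 /bd big_set0.
have /andP[axx _] := xx'.
have xB : [set x; x'] \in BE by rewrite BE_pair.
by rewrite -(ZP _ _ xx') XE ?XB' ?bd_B // (subsetP BE_sub).
Qed.

(** * The cone over the boundary, with apex [None] *)

Definition cadj : rel (option V) := fun a b => match a, b with
  | Some x, Some y => adj x y
  | None, Some x | Some x, None => bv x
  | None, None => false
  end.

Definition lift e : {set option V} := Some @: e.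
Definition cone e : {set option V} := None |: lift e.
Definition CT := (lift @: B) :|: (cone @: BE).

Lemma cadjC : symmetric cadj.
Proof. by case=> [x|] [y|] //=; rewrite adjC. Qed.

Lemma cadjI : irreflexive cadj.
Proof. by case=> [x|] //=; rewrite adjI. Qed.

Lemma lift_some e x : (Some x \in lift e) = (x \in e).
Proof. by apply: mem_imset => a b []. Qed.

Lemma lift_none e : (None \in lift e) = false.
Proof. by apply/negbTE/negP => /imsetP[]. Qed.

Lemma cone_some e x : (Some x \in cone e) = (x \in e).
Proof. by rewrite in_setU1 lift_some. Qed.

Lemma cone_none e : None \in cone e.
Proof. by rewrite in_setU1 eqxx. Qed.

Lemma lift_inj : injective lift.
Proof. by move=> e e' E; apply/setP => x; rewrite -!lift_some E. Qed.

Lemma cone_inj : injective cone.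
Proof. by move=> e e' E; apply/setP => x; rewrite -!cone_some E. Qed.

Lemma lift2 a b : lift [set a; b] = [set Some a; Some b].
Proof. by rewrite /lift imsetU !imset_set1. Qed.

Lemma lift_sub e t : (lift e \subset lift t) = (e \subset t).
Proof.
apply/subsetP/subsetP => [h x xe|h [x|]]; rewrite ?lift_none // ?lift_some //; last exact: h.
by rewrite -lift_some h // lift_some.
Qed.

Lemma lift_cone e t : (lift e \subset cone t) = (e \subset t).
Proof.
apply/subsetP/subsetP => [h x xe|h [x|]]; rewrite ?lift_none // ?lift_some ?cone_some //; last exact: h.
by rewrite -cone_some h // lift_some.
Qed.

Lemma none_lift x t : ([set None; Some x] \subset lift t) = false.
Proof. by rewrite subset_pair lift_none. Qed.

Lemma none_cone x e : ([set None; Some x] \subset cone e) = (x \in e).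
Proof. by rewrite subset_pair cone_none cone_some. Qed.

Lemma CTP (t : {set option V}) : t \in CT -> (exists2 t0, t0 \in B & t = lift t0) \/ (exists2 e, e \in BE & t = cone e).
Proof. by move=> /setUP[]/imsetP; auto. Qed.

Lemma CT_tri (t : {set option V}) : t \in CT -> is_tri cadj t.
Proof.
move=> /CTP[[t0 t0B ->]|[e eB ->]]; apply/is_triP.
  have /is_triP[c cl] := Btri t0B; split; first by rewrite card_imset // => x y [].
  by move=> [x|] [y|]; rewrite ?lift_none // !lift_some; exact: cl.
have [a [b [ab h Ee]]] := BEP eB; split.
  rewrite cardsU1 lift_none card_imset; last by move=> x y [].
  by rewrite Ee cards2 (adj_neq adjI ab).
move=> [x|] [y|]; rewrite ?cone_some // => hx hy.
- move: hx hy; rewrite Ee !inE => /orP[]/eqP-> /orP[]/eqP->; rewrite ?eqxx // => _;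
  by rewrite /= // adjC.
- by move=> _; exact: BE_bv eB hx.
- by move=> _; exact: BE_bv eB hy.
Qed.

Lemma CT_count (Q : pred {set option V}) :
  #|[set t in CT | Q t]| = #|[set t in B | Q (lift t)]| + #|[set e in BE | Q (cone e)]|.
Proof.
have -> : [set t in CT | Q t] = lift @: [set t in B | Q (lift t)] :|: cone @: [set e in BE | Q (cone e)].
  apply/setP => t; apply/setIdP/setUP.
    move=> [/CTP[[t0 h ->]|[e h ->]] q]; [left | right]; apply/imsetP.
      by exists t0 => //; exact/setIdP.
    by exists e => //; exact/setIdP.
  move=> [/imsetP[t0 /setIdP[h q] ->]|/imsetP[e /setIdP[h q] ->]]; split=> //; apply/setUP; [left | right]; exact: imset_f.
rewrite cardsU (_ : _ :&: _ = set0) ?cards0 ?subn0 ?(card_imset _ lift_inj) ?(card_imset _ cone_inj) //.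
apply/setP => t; rewrite in_set0; apply/negP => /setIP[/imsetP[t0 _ ->] /imsetP[e _ E]].
by have := lift_none t0; rewrite E cone_none.
Qed.

Lemma edge_sub e e2 : e \in edges adj -> e2 \in edges adj -> (e \subset e2) = (e == e2).
Proof.
move=> /edgesP[a [b [ab ->]]] /edgesP[a' [b' [ab' ->]]].
by rewrite eqEcard !cards2 (adj_neq adjI ab) (adj_neq adjI ab') andbT.
Qed.

(** Inner edges keep their two triangles, a boundary edge gains the cone over it, and an edge at the
    apex lies on the cones over the two boundary edges at its other end. *)
Lemma CT_two (u v : option V) : cadj u v -> #|[set t in CT | [set u; v] \subset t]| = 2.
Proof.
have side x : bv x -> #|[set t in CT | [set None; Some x] \subset t]| = 2.
  move=> bx; rewrite CT_count.
  rewrite (_ : [set t in B | _] = set0) ?cards0; last first.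
    by apply/setP => t; rewrite in_set0 inE none_lift andbF.
  rewrite -[RHS]/(if true then 2 else 0) -bx -boundary_degree add0n.
  by apply: eq_card => e; rewrite !in_set none_cone.
case: u v => [x|] [y|] //= h; last 2 first.
- by rewrite setUC; exact: side.
- exact: side.
rewrite CT_count -lift2.
have -> : #|[set t in B | lift [set x; y] \subset lift t]| = mult [set x; y].
  by apply: eq_card => t; rewrite !in_set lift_sub.
have -> : #|[set e in BE | lift [set x; y] \subset cone e]| = (mult [set x; y] == 1).
  rewrite -[RHS]/(nat_of_bool _) (_ : [set e in BE | _] = if mult [set x; y] == 1 then [set [set x; y]] else set0).
    by case: (_ == 1); rewrite ?cards1 ?cards0.
  apply/setP => e; rewrite in_set lift_cone; apply/andP/idP => [[eB]|].
    rewrite (edge_sub (mem_edges h) (subsetP BE_sub _ eB)) => /eqP E; have /setIdP[_] := eB.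
    by rewrite -E => ->; rewrite inE.
  by case: ifP => m1; rewrite inE // => /eqP->; split=> //; apply/setIdP; split=> //; exact: mem_edges.
by have [->|->] := mult12 h.
Qed.

Lemma CT_big (X : {set {set option V}}) (F : {set option V} -> bool) : X \subset CT ->
  \big[addb/false]_(t in X) F t = (\big[addb/false]_(t in [set t in B | lift t \in X]) F (lift t)) (+)
    (\big[addb/false]_(e in [set e in BE | cone e \in X]) F (cone e)).
Proof.
move=> /subsetP XC; rewrite (bigID (fun t : {set option V} => None \notin t)) /=; congr addb.
  rewrite -(big_imset F (h := lift) (A := mem [set t in B | lift t \in X])); last by move=> a b _ _ /lift_inj.
  apply: eq_bigl => t; apply/andP/imsetP.
    move=> [tX nt]; have [[t0 t0B E]|[e eB E]] := CTP (XC t tX); last by rewrite E cone_none in nt.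
    by exists t0 => //; apply/setIdP; rewrite -E.
  by move=> [t0 /setIdP[t0B h] ->]; rewrite lift_none.
rewrite -(big_imset F (h := cone) (A := mem [set e in BE | cone e \in X])); last by move=> a b _ _ /cone_inj.
apply: eq_bigl => t; rewrite negbK; apply/andP/imsetP.
  move=> [tX nt]; have [[t0 t0B E]|[e eB E]] := CTP (XC t tX); first by rewrite E lift_none in nt.
  by exists e => //; apply/setIdP; rewrite -E.
by move=> [e /setIdP[eB h] ->]; rewrite cone_none.
Qed.

Lemma cedgesP (e : {set option V}) : e \in edges cadj -> (exists2 e0, e0 \in edges adj & e = lift e0) \/
  (exists2 x, bv x & e = [set None; Some x]).
Proof.
move=> /edgesP[[x|] [[y|] [h ->]]] //.
- by left; exists [set x; y]; rewrite ?lift2 // mem_edges.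
- by right; exists x; rewrite // setUC.
- by right; exists y.
Qed.

Lemma bd_lift (X : {set {set option V}}) e : X \subset CT -> e \in edges adj ->
  bd X (lift e) = bd [set t in B | lift t \in X] e (+) (e \in [set e in BE | cone e \in X]).
Proof.
move=> XC eE; rewrite /bd CT_big //; congr addb; first by apply: eq_bigr => t _; rewrite lift_sub.
rewrite (eq_bigr (fun e2 => (e2 == e) && true)) ?xor_pred1 ?andbT // => e2 /setIdP[/(subsetP BE_sub) e2E _].
by rewrite lift_cone edge_sub // eq_sym andbT.
Qed.

Lemma bd_none (X : {set {set option V}}) x : X \subset CT ->
  bd X [set None; Some x] = \big[addb/false]_(e in [set e in BE | cone e \in X]) (x \in e).
Proof.
move=> XC; rewrite /bd CT_big // big1 => [|t _]; last exact: none_lift.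
by rewrite addFb; apply: eq_bigr => e _; rewrite none_cone.
Qed.

(** Every vertex of [N] is joined along the boundary to a fixed [r]; the ends at [r] cancel because
    [#|N|] is even. *)
Lemma boundary_chain (N : {set V}) : (forall x, x \in N -> bv x) -> ~~ odd #|N| ->
  exists Y : {set {set V}}, Y \subset BE /\ forall y, \big[addb/false]_(e in Y) (y \in e) = (y \in N).
Proof.
move=> Nb ev; have [->|/set0Pn[r rN]] := eqVneq N set0.
  by exists set0; split=> [|y]; rewrite ?sub0set // big_set0 inE.
have ex x : exists Q : {set {set V}}, x \in N -> Q \subset BE /\
    forall y, \big[addb/false]_(e in Q) (y \in e) = (y == x) (+) (y == r).
  have [xN|] := boolP (x \in N); last by exists set0.
  have cx : connect be x r by apply: boundary_connected; exact: Nb.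
  have [|Q [_ Qr Qs]] := chain adjI _ cx; first by move=> a b /andP[].
  exists Q => _; split=> //; apply/subsetP => e /Qr[a [b [ab ->]]].
  by have /andP[aab _] := ab; rewrite BE_pair.
have [Qf QP] := fin_all_exists ex.
exists [set e in BE | \big[addb/false]_(x in N) (e \in Qf x)].
split; first by apply/subsetP => e /setIdP[].
move=> y; rewrite big_mkcond (eq_bigr (fun e => \big[addb/false]_(x in N) ((e \in Qf x) && (y \in e)))).
  rewrite exchange_big /= (eq_bigr (fun x => ((x == y) && true) (+) (y == r))).
    rewrite xorD xor_pred1 andbT [X in _ (+) X](_ : _ = false) ?addbF //.
    rewrite xor_card; case: (y == r); last by rewrite (_ : [set _ | _ & _] = set0) ?cards0 //; apply/setP => x; rewrite !inE andbF.
    by rewrite (_ : [set _ | _ & _] = N) ?(negbTE ev) //; apply/setP => x; rewrite !inE andbT.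
  move=> x xN; have [_ Qs] := QP x xN; rewrite andbT [x == y]eq_sym -Qs [RHS]big_mkcond /=.
  by apply: eq_bigr => e _; case: (e \in Qf x).
move=> e _; rewrite inE -xor_andr; case eB: (e \in BE) => /=; first by case: (\big[_/_]_(_ in N) _).
rewrite big1 // => x xN; have [QB _] := QP x xN.
by apply/negbTE/negP => /(subsetP QB); rewrite eB.
Qed.

(** The edges of [C] at the apex end in an even set [N]. The cones over a boundary chain [Y] with
    ends [N] have the same edges at the apex, so subtracting them leaves a cycle of the near
    triangulation. *)
Lemma CT_span (C : {set option V} -> bool) : (forall v : option V, dv cadj C v = false) ->
  exists X : {set {set option V}}, X \subset CT /\ forall e : {set option V}, e \in edges cadj -> C e = bd X e.
Proof.
move=> evC; pose N := [set x | bv x && C [set None; Some x]].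
have Ne : ~~ odd #|N|.
  have := evC None; rewrite (dv_nb cadjC cadjI) big_option in_nb /= xor_card => h.
  rewrite (_ : #|N| = #|[set x | Some x \in nb cadj None & C [set None; Some x]]|).
    exact/negbT.
  by apply: eq_card => x; rewrite !inE.
have [|Y [YB YN]] := boundary_chain _ Ne; first by move=> x; rewrite inE => /andP[].
have YE := subset_trans YB BE_sub.
have [x|X [XB XE]] := @bspan (fun e => C (lift e) (+) (e \in Y)).
  rewrite /dv (eq_bigr (fun e => ((x \in e) && C (lift e)) (+) ((x \in e) && (e \in Y)))); last first.
    by move=> e _; case: (x \in e).
  rewrite xorD -/(dv adj (fun e => C (lift e)) x) -/(dv adj (fun e => e \in Y) x) dv_set // YN.
  rewrite dv_nb //; have := evC (Some x); rewrite (dv_nb cadjC cadjI) big_option in_nb /=.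
  rewrite [_ \in N]inE (setUC [set None]) => h; rewrite addbC -[RHS]h; congr addb.
  by apply: eq_big => u; rewrite ?in_nb // lift2.
have liftC t : t \in B -> lift t \in CT by move=> tB; apply/setUP; left; exact: imset_f.
have coneC e : e \in BE -> cone e \in CT by move=> eB; apply/setUP; right; exact: imset_f.
pose X' := (lift @: X) :|: (cone @: Y).
have X'C : X' \subset CT.
  apply/subsetP => t /setUP[]/imsetP[z zX ->]; [apply: liftC; exact: (subsetP XB) | apply: coneC; exact: (subsetP YB)].
have lX t : (lift t \in X') = (t \in X).
  rewrite in_setU mem_imset; last exact: lift_inj.
  rewrite [X in _ || X](_ : _ = false) ?orbF //; apply/negbTE/negP => /imsetP[e _ E].
  by have := lift_none t; rewrite E cone_none.
have cY e : (cone e \in X') = (e \in Y).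
  rewrite in_setU [X in _ || X]mem_imset; last exact: cone_inj.
  rewrite [X in X || _](_ : _ = false) //; apply/negbTE/negP => /imsetP[t _ E].
  by have := cone_none e; rewrite E lift_none.
have E1 : [set t in B | lift t \in X'] = X.
  by apply/setP => t; rewrite inE lX; have [/(subsetP XB)->|] := boolP (t \in X); rewrite ?andbF.
have E2 : [set e in BE | cone e \in X'] = Y.
  by apply/setP => e; rewrite inE cY; have [/(subsetP YB)->|] := boolP (e \in Y); rewrite ?andbF.
exists X'; split=> // e /cedgesP[[e0 e0E ->]|[x bx ->]].
  by rewrite bd_lift // E1 E2 -XE // -addbA addbb addbF.
by rewrite bd_none // E2 YN inE bx.
Qed.

(** The part of [X] in [B] has no inner edge in its boundary, so it is empty or [B]; the cones
    follow since boundary edges must cancel. *)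
Lemma CT_indec (X : {set {set option V}}) : X \subset CT ->
  (forall e : {set option V}, e \in edges cadj -> bd X e = false) -> X = set0 \/ X = CT.
Proof.
move=> XC X0.
have liftE e : e \in edges adj -> lift e \in edges cadj.
  by move=> /edgesP[a [b [ab ->]]]; rewrite lift2; apply/edgesP; exists (Some a), (Some b).
set X1 := [set t in B | lift t \in X]; set X2 := [set e in BE | cone e \in X].
have H e : e \in edges adj -> bd X1 e = (e \in X2).
  move=> eE; have := X0 _ (liftE e eE); rewrite bd_lift //.
  by rewrite -/X1 -/X2; case: (bd X1 e); case: (e \in X2).
have X1B : X1 \subset B by apply/subsetP => t /setIdP[].
have [|E|E] := indecomposable X1B.
- move=> e eE m2; rewrite H //; apply/negbTE/negP => /setIdP[/setIdP[_ /eqP]]; by rewrite m2.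
- left; apply/setP => t; rewrite in_set0; apply/negP => tX.
  have [[t0 t0B Et]|[e eB Ee]] := CTP (subsetP XC t tX).
    have : t0 \in X1 by apply/setIdP; rewrite -Et.
    by rewrite E inE.
  have : e \in X2 by apply/setIdP; rewrite -Ee.
  by rewrite -H ?(subsetP BE_sub) // E /bd big_set0.
- right; apply/eqP; rewrite eqEsubset XC; apply/subsetP => t /CTP[[t0 t0B ->]|[e eB ->]].
    by move: t0B; rewrite -E => /setIdP[].
  have : e \in X2 by rewrite -H ?(subsetP BE_sub) // E bd_B.
  by move=> /setIdP[].
Qed.

Lemma has_nb x : exists u, adj x u.
Proof.
have /card_gt0P[z] : 0 < #|~: [set x]|.
  by have := cardsC [set x]; rewrite cards1; move: V3; clear; move: #|V| #|_| => n k; lia.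
rewrite !inE => zx; have := @conn set0; rewrite cards0 => /(_ isT x z); rewrite !inE => /(_ isT isT)/connectP[[|w p]] /=.
  by move=> _ E; rewrite E eqxx in zx.
by move=> /andP[/andP[xw _] _] _; exists w.
Qed.

(** The apex is covered because there is a boundary edge: otherwise [B] would be a nonempty set with
    zero boundary, against [bindep]. *)
Lemma CT_cov (v : option V) : exists2 t : {set option V}, t \in CT & v \in t.
Proof.
case: v => [x|].
  have [u xu] := has_nb x; have [t tB] := edge_tri xu; rewrite subset_pair => /andP[xt _].
  by exists (lift t); [apply/setUP; left; exact: imset_f | rewrite lift_some].
have [/existsP[e eB]|/existsPn no] := boolP [exists e, e \in BE].
  by exists (cone e); [apply/setUP; right; exact: imset_f | exact: cone_none].
have /card_gt0P[x _] : 0 < #|V| by apply: leq_trans V3.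
have [u xu] := has_nb x; have [t tB _] := edge_tri xu.
suff E : B = set0 by rewrite E inE in tB.
apply: bindep => // e eE; have /edgesP[a [b [ab Ee]]] := eE.
rewrite /bd xor_card -/(mult e) Ee; have [m1|-> //] := mult12 ab.
by have := no e; rewrite inE eE Ee m1.
Qed.

Lemma near_ids m : 10 * #|V| < 24 * m.+1 -> exists S : {set V}, is_ids adj S /\ #|S| <= m.
Proof.
move=> lt; have cW : #|[set~ (None : option V)]| = #|V|.
  by have := cardsC [set (None : option V)]; rewrite cards1 card_option add1n => -[].
have [|S [[SW SI SD] Sm]] := ids_punctured cadjC cadjI CT_tri CT_two CT_span CT_cov (o := None) CT_indec (m := m).
  by rewrite cW.
pose S0 := [set x | Some x \in S]; exists S0; split; last first.
  apply: leq_trans Sm; rewrite -(card_imset (f := Some) (mem S0)); last by move=> x y [].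
  by apply: subset_leq_card; apply/subsetP => z /imsetP[x]; rewrite inE => h ->.
split=> [u v|w]; rewrite !inE; first by move=> uS vS; exact: (SI _ _ uS vS).
have [|wS|[[u|] uS uw]] := SD (Some w); rewrite ?inE //; first by left.
  by right; exists u; rewrite ?inE.
by have := subsetP SW _ uS; rewrite !inE eqxx.
Qed.
End NearTriangulation.

(** * Closing a triangulation by its outer triangle *)

Section ClosedTriangulation.
Variables (V : finType) (adj : rel V).
Hypotheses (adjC : symmetric adj) (adjI : irreflexive adj).
Variables (B : {set {set V}}) (t0 : {set V}).
Hypothesis Btri : forall t, t \in B -> is_tri adj t.
Hypothesis t0tri : is_tri adj t0.
Hypothesis le2 : forall u v, adj u v -> #|[set t in B | [set u; v] \subset t]| <= 2.
Hypothesis bspan : forall C, (forall v, dv adj C v = false) ->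
  exists X : {set {set V}}, X \subset B /\ forall e, e \in edges adj -> C e = bd X e.
Hypothesis bindep : forall X : {set {set V}}, X \subset B ->
  (forall e, e \in edges adj -> bd X e = false) -> X = set0.
Hypothesis bdB : forall e, e \in edges adj -> bd B e = (e \subset t0).
Hypothesis ein : forall a b, adj a b -> [set a; b] \subset t0 \/ exists2 t, t \in B & [set a; b] \subset t.
Hypothesis iso : forall v, exists u, adj v u.
Implicit Types (X : {set {set V}}).

(** Faces are recorded by vertex sets, so the outer face can coincide with a bounded one. Then [B]
    and [t0] have the same boundary, [B] consists of [t0] only, and the graph is a single
    triangle. *)
Lemma closed_degenerate : t0 \in B -> forall v, v \in t0.
Proof.
move=> t0B.
have E : sdiff B [set t0] = set0.
  apply: bindep; first by rewrite sdiff_sub // sub1set.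
  by move=> e eE; rewrite /bd xor_sdiff big_set1 -/(bd B e) bdB // addbb.
have BE t : t \in B -> t = t0.
  move=> tB; have : (t \in sdiff B [set t0]) = false by rewrite E inE.
  by rewrite in_sdiff tB inE; case: eqP.
move=> v; have [u vu] := iso v.
by have [|[t /BE->]] := ein vu; rewrite subset_pair => /andP[].
Qed.

Section Proper.
Hypothesis t0B : t0 \notin B.
Definition ClT := t0 |: B.

Lemma ClT_tri t : t \in ClT -> is_tri adj t.
Proof. by move=> /setU1P[->|/Btri]. Qed.

(** An edge of [t0] lies on an odd number of triangles of [B], hence on one. Any other edge lies on
    an even number, not 0 by [ein], hence on two. *)
Lemma ClT_two u v : adj u v -> #|[set t in ClT | [set u; v] \subset t]| = 2.
Proof.
move=> uv; have eE := mem_edges uv; set e := [set u; v] in eE *.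
have odE : odd #|[set t in B | e \subset t]| = (e \subset t0) by rewrite -bdB // /bd xor_card.
have l2 : #|[set t in B | e \subset t]| <= 2 by exact: le2.
have [et0|et0] := boolP (e \subset t0); rewrite ?et0 ?(negbTE et0) in odE.
  rewrite (_ : [set t in ClT | e \subset t] = t0 |: [set t in B | e \subset t]).
    rewrite cardsU1 inE (negbTE t0B) /=.
    by move: odE l2; case: #|_| => [|[|[|]]].
  apply/setP => t; rewrite !inE; have [->|_] := eqVneq t t0; by rewrite ?et0.
rewrite (_ : [set t in ClT | e \subset t] = [set t in B | e \subset t]).
  have [h|[t tB et]] := ein uv; first by rewrite h in et0.
  have : 0 < #|[set t in B | e \subset t]| by apply/card_gt0P; exists t; exact/setIdP.
  by move: odE l2; case: #|_| => [|[|[|]]].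
apply/setP => t; rewrite !inE; have [->|//] := eqVneq t t0; by rewrite (negbTE et0) !andbF.
Qed.

Lemma ClT_span C : (forall v, dv adj C v = false) ->
  exists X : {set {set V}}, X \subset ClT /\ forall e, e \in edges adj -> C e = bd X e.
Proof.
move=> /bspan[X [XB XE]]; exists X; split=> //; apply: subset_trans XB _; exact: subsetUr.
Qed.

Lemma ClT_cov v : exists2 t, t \in ClT & v \in t.
Proof.
have [u vu] := iso v; have [|[t tB]] := ein vu; rewrite subset_pair => /andP[vt _].
  by exists t0; rewrite // setU11.
by exists t; rewrite // setU1r.
Qed.

Lemma ClT_indec X : X \subset ClT -> (forall e, e \in edges adj -> bd X e = false) -> X = set0 \/ X = ClT.
Proof.
have half X' : X' \subset ClT -> t0 \notin X' -> (forall e, e \in edges adj -> bd X' e = false) -> X' = set0.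
  move=> /subsetP XC nt h; apply: bindep => //; apply/subsetP => t tX.
  by have /setU1P[E|//] := XC t tX; rewrite -E tX in nt.
move=> XC X0; have [tX|tX] := boolP (t0 \in X); [right | by left; exact: half].
have E : sdiff ClT X = set0.
  apply: half; first by rewrite sdiff_sub.
    by rewrite in_sdiff setU11 tX.
  move=> e eE; rewrite /bd xor_sdiff -/(bd X e) X0 // addbF -/(bd ClT e) /bd xor_card.
  by have /edgesP[a [b [ab ->]]] := eE; rewrite ClT_two.
apply/setP => t; have : (t \in sdiff ClT X) = false by rewrite E inE.
by rewrite in_sdiff; case: (t \in ClT); case: (t \in X).
Qed.
End Proper.

Lemma V_gt0 : 0 < #|V|.
Proof.
have /is_triP[c _] := t0tri; have /card_gt0P[v _] : 0 < #|t0| by rewrite c.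
by apply/card_gt0P; exists v.
Qed.

Lemma closed_ids m : 3 * #|V| <= 8 * m.+1 -> exists S : {set V}, is_ids adj S /\ #|S| <= m.
Proof.
move=> lt; have [t0B|t0B] := boolP (t0 \in B).
  have all := closed_degenerate t0B; have /is_triP[c cl] := t0tri.
  have cV : #|V| = 3 by rewrite -c -cardsT; apply: eq_card => v; rewrite inE all.
  have /card_gt0P[v vt] : 0 < #|t0| by rewrite c.
  exists [set v]; split; last by rewrite cards1; move: lt; rewrite cV; clear; lia.
  split=> [a b|w]; first by rewrite !inE => /eqP-> /eqP->; rewrite adjI.
  have [->|ne] := eqVneq w v; first by left; rewrite inE.
  by right; exists v; rewrite ?inE // cl // eq_sym.
exact: (ids_triangulation adjC adjI ClT_tri (ClT_two t0B) ClT_span ClT_cov V_gt0 (ClT_indec t0B)).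
Qed.

Lemma closed_ids5 m : (forall v, 5 <= #|nb adj v|) -> #|V| < 3 * m.+1 ->
  exists S : {set V}, is_ids adj S /\ #|S| <= m.
Proof.
move=> d5 lt; have [t0B|t0B] := boolP (t0 \in B).
  have all := closed_degenerate t0B; have /is_triP[c cl] := t0tri.
  have cV : #|V| = 3 by rewrite -c -cardsT; apply: eq_card => v; rewrite inE all.
  have /card_gt0P[v vt] : 0 < #|t0| by rewrite c.
  by have := leq_trans (d5 v) (max_card _); rewrite cV.
exact: (ids_deg5 adjC adjI ClT_tri (ClT_two t0B) ClT_span ClT_cov V_gt0 d5).
Qed.
End ClosedTriangulation.

Require Import Defs.
From mathcomp Require Import all_boot all_order all_algebra.
From mathcomp Require Import all_classical all_reals all_analysis.
From mathcomp Require Import ring lra.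
From Stdlib Require Import Btauto.

Import Order.TTheory GRing.Theory Num.Theory.
Import numFieldNormedType.Exports.
Local Open Scope classical_set_scope.
Local Open Scope ring_scope.

(** * Winding parities in the plane *)

Lemma addb_xorb : addb = xorb.
Proof. by apply/funext => -[]; apply/funext => -[]. Qed.

Ltac bxor := rewrite ?addb_xorb; btauto.

Section Parity.
Variable R : realType.
Local Notation P := (R * R)%type.
Implicit Types (a b p q x y z : P) (e : R) (A K : set P) (th : P -> P -> bool).

(** Open boxes keep all metric estimates linear in the coordinates. *)
Definition close e a b : bool :=
  [&& a.1 - e < b.1, b.1 < a.1 + e, a.2 - e < b.2 & b.2 < a.2 + e].

Lemma closeP e a b : reflect
  [/\ a.1 - e < b.1, b.1 < a.1 + e, a.2 - e < b.2 & b.2 < a.2 + e] (close e a b).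
Proof. exact: and4P. Qed.

Lemma close_refl e a : 0 < e -> close e a a.
Proof. by move=> e0; apply/closeP; split; lra. Qed.

Lemma close_sym e a b : close e a b -> close e b a.
Proof. by case/closeP=> *; apply/closeP; split; lra. Qed.

Lemma close_trans e e' a b c : close e a b -> close e' b c -> close (e + e') a c.
Proof. by case/closeP=> ? ? ? ? /closeP[] *; apply/closeP; split; lra. Qed.

Lemma close_le e e' a b : e <= e' -> close e a b -> close e' a b.
Proof. by move=> le /closeP[] *; apply/closeP; split; lra. Qed.

Lemma close_ball e a b : close e a b <-> ball a e b.
Proof.
rewrite /close; split.
  case/and4P=> ? ? ? ?; split; rewrite /ball /= ltr_norml; apply/andP; split; lra.
case; rewrite /ball /= !ltr_norml => /andP[? ?] /andP[? ?].
by apply/and4P; split; lra.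
Qed.

Lemma nbhs_close a (U : set P) :
  nbhs a U <-> exists2 e, 0 < e & forall b, close e a b -> U b.
Proof.
split.
  move=> /nbhs_ballP[e /= e0 aU]; exists e => // b /close_ball; exact: aU.
case=> e e0 H; apply/nbhs_ballP; exists e => //= b /close_ball; exact: H.
Qed.

(* The crossing parity of the rightward ray from p with the path that goes from
   a to b first horizontally, then vertically. *)
Definition theta p a b : bool := (p.1 < b.1) && ((a.2 <= p.2) (+) (b.2 <= p.2)).

Definition theta_pot p x a : bool := (p.1 < x.1) && (a.2 <= p.2).

(** If the box around [x] does not contain [p], either it lies on one side of [p] horizontally, so
    the centre decides, or it lies on one side vertically and both members vanish. *)
Lemma theta_local p x e a b : ~~ close e x p -> close e x a -> close e x b ->
  theta p a b = theta_pot p x a (+) theta_pot p x b.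
Proof.
move=> /closeP far /closeP[a1 a2 a3 a4] /closeP[b1 b2 b3 b4].
rewrite /theta /theta_pot.
have [h|h] := leP x.1 p.1; have [k|k] := leP b.1 p.1 => //=; last first.
- have [l|l] := leP a.2 p.2; have [l'|l'] := leP b.2 p.2 => //=.
  + by exfalso; apply: far; split; lra.
  + by exfalso; apply: far; split; lra.
- have [l|l] := leP a.2 p.2; have [l'|l'] := leP b.2 p.2 => //=.
  + by exfalso; apply: far; split; lra.
  + by exfalso; apply: far; split; lra.
Qed.

(** Cochains are functions of pairs of close points, as in Alexander-Spanier cohomology modulo 2:
    [triv] means coboundary at some scale, [loc_cob] coboundary on each small box. *)
Definition potential A e th (h : P -> bool) :=
  forall a b, A a -> A b -> close e a b -> th a b = h a (+) h b.

Definition triv A th := exists e, exists h, 0 < e /\ potential A e th h.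

Definition loc_cob A e th := forall x, A x -> exists rho : P -> bool,
  forall a b, A a -> A b -> close e x a -> close e x b ->
    th a b = rho a (+) rho b.

Lemma line_component x y (A : set P) :
  (forall t : R, 0 <= t -> t <= 1 ->
     A (x.1 + t * (y.1 - x.1), x.2 + t * (y.2 - x.2))) ->
  connected_component A x y.
Proof.
move=> H.
pose f := fun t : R => (x.1 + t * (y.1 - x.1), x.2 + t * (y.2 - x.2)).
have fc : continuous f.
  move=> t.
  apply: (@cvg_pair _ _ _ (nbhs t) (nbhs (f t).1) (nbhs (f t).2)) => /=.
    apply: cvgD; first exact: cvg_cst.
    by apply: cvgM; [exact: cvg_id | exact: cvg_cst].
  apply: cvgD; first exact: cvg_cst.
  by apply: cvgM; [exact: cvg_id | exact: cvg_cst].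
have f0 : f 0 = x by rewrite /f; case: (x) => u v /=; congr pair; ring.
have f1 : f 1 = y by rewrite /f; case: (y) (x) => u v [u' v'] /=; congr pair; ring.
exists (f @` `[0, 1]); last by exists 1 => //=; rewrite in_itv /= lexx ler01.
split.
- by exists 0 => //=; rewrite in_itv /= lexx ler01.
- by move=> _ [t /= tI <-]; move: tI; rewrite in_itv /= => /andP[? ?]; apply: H.
- apply: connected_continuous_connected; first exact: segment_connected.
  exact: continuous_subspaceT.
Qed.

Lemma component_open A x : open A -> open (connected_component A x).
Proof.
move=> oA; rewrite openE => y [C [Cx CA cC] Cy].
have /nbhs_close[e e0 eA] : nbhs y A by apply: open_nbhs_nbhs; split => //; exact: CA.
apply/nbhs_close; exists e => // z yz.
apply: (@connected_component_trans _ _ y); first by exists C.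
apply: line_component => t t0 t1; apply: eA; move/closeP: yz => [? ? ? ?].
apply/closeP; split => /=; nra.
Qed.

Lemma triv_xor A th th' :
  triv A th -> triv A th' -> triv A (fun a b => th a b (+) th' a b).
Proof.
move=> [e [h [e0 H]]] [e' [h' [e'0 H']]].
exists (Num.min e e'), (fun a => h a (+) h' a); split; first by rewrite lt_min e0.
move=> a b Aa Ab ab.
rewrite (H a b) ?(H' a b) //; first by move: (h a) (h b) (h' a) (h' b); do 4!case.
  by apply: close_le ab; rewrite ge_min lexx orbT.
by apply: close_le ab; rewrite ge_min lexx.
Qed.

Lemma triv_ext A th th' : (forall a b, A a -> A b -> th a b = th' a b) ->
  triv A th -> triv A th'.
Proof.
by move=> E [e [h [e0 H]]]; exists e, h; split=> // a b Aa Ab ab; rewrite -E // H.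
Qed.

Lemma closed_far A p : closed A -> ~ A p ->
  exists2 e, 0 < e & forall a, A a -> ~~ close e p a.
Proof.
move=> cA nAp; have /nbhs_close[e e0 H] : nbhs p (~` A).
  by apply: open_nbhs_nbhs; split => //; exact: closed_openC.
by exists e => // a Aa; apply/negP => /H.
Qed.

Lemma component_near A x y e : connected_component (~` A) x y ->
  (forall a, A a -> ~~ close e y a) ->
  forall z, close e y z -> connected_component (~` A) x z.
Proof.
move=> xy far z yz; apply: connected_component_trans xy _.
apply: line_component => t t0 t1 /far /negP; apply.
by move/closeP: yz => [? ? ? ?]; apply/closeP; split => /=; nra.
Qed.

Lemma component_near_eq A x y e z : close e y z ->
  (forall a, A a -> ~~ close e y a) ->
  `[< connected_component (~` A) x y >] = `[< connected_component (~` A) x z >].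
Proof.
move=> yz far; apply: asbool_equiv_eq; split=> H; first exact: component_near yz.
apply: connected_component_trans H _.
apply: line_component => t t0 t1 /far /negP; apply.
by move/closeP: yz => [? ? ? ?]; apply/closeP; split => /=; nra.
Qed.

Lemma xor_telescope (f : nat -> bool) N :
  \big[addb/false]_(i < N) (f i (+) f i.+1) = f 0%N (+) f N.
Proof.
elim: N => [|N IH]; first by rewrite big_ord0 addbb.
by rewrite big_ord_recr /= IH; case: (f 0%N); case: (f N); case: (f N.+1).
Qed.

(** Summation by parts; the hypothesis says that [c] changes only where [d] vanishes. *)
Lemma xor_telescope_cond (c d : nat -> bool) N :
  (forall i, c i && d i.+1 = c i.+1 && d i.+1) ->
  \big[addb/false]_(i < N) (c i && (d i (+) d i.+1)) =
    (c 0%N && d 0%N) (+) (c N && d N).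
Proof.
move=> H; rewrite -(xor_telescope (fun i => c i && d i)).
by apply: eq_bigr => i _; rewrite -H; case: (c i).
Qed.

Definition far_bound A M := forall a, A a ->
  [/\ - M < a.1, a.1 < M, - M < a.2 & a.2 < M].

Lemma small_mesh (e : R) : 0 < e -> exists k : nat, (0 < k)%N /\ k%:R^-1 < e.
Proof.
move=> e0; have [k hk] : exists k : nat, e^-1 < k%:R.
  by exists (Num.bound e^-1); apply: archi_boundP; rewrite invr_ge0 ltW.
exists k.+1; split=> //; rewrite invf_plt ?posrE ?ltr0n //.
by apply: lt_trans hk _; rewrite ltr_nat.
Qed.

Lemma lt_cross (r x m : R) : 0 < m -> (r < x) (+) (r < x + m) -> x <= r < x + m.
Proof. by move=> m0; have [|] := ltP r x; have [|] := ltP r (x + m) => //= *; lra. Qed.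

Lemma le_cross (r x m : R) : 0 < m -> (x <= r) (+) (x + m <= r) -> x <= r < x + m.
Proof. by move=> m0; have [|] := leP x r; have [|] := leP (x + m) r => //= *; lra. Qed.

Lemma close_center (r : P) (x y m e : R) : 0 < m -> 10 * m <= e ->
  x <= r.1 < x + m -> y <= r.2 < y + m -> close e r (x + m / 2, y + m / 2).
Proof. by move=> m0 me /andP[? ?] /andP[? ?]; apply/closeP; split=> /=; lra. Qed.

(** * From winding parities to components *)

Section SameComponent.
Variables (A : set P) (p q : P).
Hypotheses (cA : closed A) (nAp : ~ A p) (nAq : ~ A q).
Variable M : R.
Hypothesis bA : far_bound A M.
Hypotheses (bp : [/\ - M < p.1, p.1 < M, - M < p.2 & p.2 < M])
           (bq : [/\ - M < q.1, q.1 < M, - M < q.2 & q.2 < M]).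
Let th a b := theta p a b (+) theta q a b.

Let C := connected_component (~` A) p.

Let far : P := (- (M + 1), - (M + 1)).

(** The indicator of [C], normalised to vanish at infinity whether or not [C] is bounded, so that
    grid sums have no outer boundary terms. *)
Let chi x := `[< C x >] (+) `[< C far >].

Lemma chi_far x : [|| x.1 <= - M, M <= x.1, x.2 <= - M | M <= x.2] -> chi x = false.
Proof.
move=> hx; have M0 : 0 < M by case: bp; lra.
have step y z : connected_component (~` A) y z -> `[< C y >] = `[< C z >].
  move=> yz; apply: asbool_equiv_eq; split=> H.
    exact: connected_component_trans yz.
  by apply: connected_component_trans H _; exact: connected_component_sym.
suff E : `[< C x >] = `[< C far >] by rewrite /chi E addbb.
have h1 y z : y.1 <= - M -> z.1 <= - M -> connected_component (~` A) y z.
  by move=> *; apply: line_component => t t0 t1 /bA[] /=; nra.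
have h2 y z : M <= y.1 -> M <= z.1 -> connected_component (~` A) y z.
  by move=> *; apply: line_component => t t0 t1 /bA[] /=; nra.
have h3 y z : y.2 <= - M -> z.2 <= - M -> connected_component (~` A) y z.
  by move=> *; apply: line_component => t t0 t1 /bA[] /=; nra.
have h4 y z : M <= y.2 -> M <= z.2 -> connected_component (~` A) y z.
  by move=> *; apply: line_component => t t0 t1 /bA[] /=; nra.
case/or4P: hx => hx.
- by apply: step; apply: h1 => //=; lra.
- rewrite (step x (M, - M)); last by apply: h2.
  by apply: step; apply: h3 => //=; lra.
- by apply: step; apply: h3 => //=; lra.
- rewrite (step x (- M, M)); last by apply: h4.
  by apply: step; apply: h1 => //=; lra.
Qed.

(** A discrete Stokes argument. The cochain is corrected to a [D] that vanishes on the grid edges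
    near [A], and [chi] changes only across such edges; so [chi] times the circulation of [D],
    summed over all cells, is 0. This circulation is that of [th], concentrated in the cells of [p]
    and [q], whence [chi p = chi q]. *)
Lemma triv_same_component : triv A th -> C q.
Proof.
move=> [d [h [d0 hth]]]; apply: contrapT => nCq.
have [ep ep0 farp] := closed_far cA nAp.
have [eq eq0 farq] := closed_far cA nAq.
have M0 : 0 < M by case: bp; lra.
(* The chains of boxes below have total size at most [9 * m], which the factor 10 covers. *)
have [k [k0 km]] := @small_mesh (Num.min (d / 10) (Num.min (ep / 10) (Num.min (eq / 10) 1)))
   ltac:(by rewrite !lt_min; apply/and4P; split; lra).
set m := k%:R^-1 in km.
have m0 : 0 < m by rewrite invr_gt0 ltr0n.
move: km; rewrite !lt_min => /and4P[kd kp kq k1].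
pose L := (Num.bound M).+2.
have ML : M + 1 < L%:R.
  have : M < (Num.bound M)%:R by apply: archi_boundP; exact: ltW.
  by rewrite /L -[in X in _ -> X]addn2 natrD; lra.
pose N := (L.*2 * k)%N.
pose x (i : nat) : R := i%:R * m - L%:R.
have xS i : x i.+1 = x i + m by rewrite /x -natr1; ring.
have x0 : x 0%N = - L%:R by rewrite /x mul0r sub0r.
have xN : x N = L%:R.
  rewrite /x /N natrM -mulrA /m mulfV ?mulr1 ?pnatr_eq0 -?lt0n //.
  by rewrite -addnn natrD; ring.
pose ctr i j : P := (x i + m / 2, x j + m / 2).
pose cor i j : P := (x i, x j).
pose nr v := exists a, A a /\ close (3 * m) v a.
pose pr v := if pselect (nr v) is left H then projT1 (cid H) else v.
have prP v : nr v -> A (pr v) /\ close (3 * m) v (pr v).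
  by rewrite /pr; case: pselect => // H _; case: cid.
(* The potential [h] is carried from [A] to nearby points through the chosen point [pr v]. *)
pose kk v := th v (pr v) (+) h (pr v).
pose D v w := th v w (+) kk v (+) kk w.
have D0 v w : nr v -> nr w -> close (2 * m) v w -> D v w = false.
  move=> /prP[Av cv] /prP[Aw cw] vw; rewrite /D /kk /th.
  have E : th (pr v) (pr w) = h (pr v) (+) h (pr w).
    apply: hth => //; apply: (@close_le (3 * m + 2 * m + 3 * m)); first lra.
    by apply: close_trans (close_trans (close_sym cv) vw) cw.
  have fp : ~~ close (6 * m) v p.
    apply: contra (farp _ Av) => vp; apply: close_sym.
    apply: (@close_le (3 * m + 6 * m)); first lra.
    by apply: close_trans vp; apply: close_sym.
  have fq : ~~ close (6 * m) v q.
    apply: contra (farq _ Av) => vp; apply: close_sym.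
    apply: (@close_le (3 * m + 6 * m)); first lra.
    by apply: close_trans vp; apply: close_sym.
  have cvv : close (6 * m) v v by apply: close_refl; lra.
  have cvw : close (6 * m) v w by apply: close_le vw; lra.
  have cvpv : close (6 * m) v (pr v) by apply: close_le cv; lra.
  have cvpw : close (6 * m) v (pr w).
    by apply: (@close_le (2 * m + 3 * m)); [lra | exact: close_trans cw].
  have {E} -> : h (pr w) = h (pr v) (+) th (pr v) (pr w) by rewrite E; bxor.
  rewrite /th !(theta_local fp) // !(theta_local fq) //.
  by rewrite ?addb_xorb; btauto.
have front y z : chi y != chi z -> close (3 / 2 * m) y z ->
    exists2 a, A a & close (3 / 2 * m) y a.
  move=> ne yz; apply: contrapT => no; move/eqP: ne; apply.
  rewrite /chi (@component_near_eq A p y (3 / 2 * m) z) //.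
  by move=> a Aa; apply/negP => ya; apply: no; exists a.
have near_cor i j v : close (3 / 5 * m) (ctr i j) v -> forall z,
    chi (ctr i j) != chi z -> close (3 / 2 * m) (ctr i j) z -> nr v.
  move=> cv z ne /(front _ _ ne)[a Aa ca]; exists a; split=> //.
  move: cv ca; rewrite /ctr => /closeP/=[? ? ? ?] /closeP/=[? ? ? ?].
  by apply/closeP; split; lra.
have keyv i j : chi (ctr i j) && D (cor i.+1 j) (cor i.+1 j.+1) =
               chi (ctr i.+1 j) && D (cor i.+1 j) (cor i.+1 j.+1).
  have [-> //|ne] := eqVneq (chi (ctr i j)) (chi (ctr i.+1 j)).
  have cl : close (3 / 2 * m) (ctr i j) (ctr i.+1 j).
    by apply/closeP; rewrite /ctr /= xS; split; lra.
  rewrite D0 ?andbF //.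
  - by apply: near_cor ne cl; apply/closeP; rewrite /ctr /cor /= ?xS; split; lra.
  - by apply: near_cor ne cl; apply/closeP; rewrite /ctr /cor /= !xS; split; lra.
  - by apply/closeP; rewrite /cor /= !xS; split; lra.
have keyh i j : chi (ctr i j) && D (cor i j.+1) (cor i.+1 j.+1) =
               chi (ctr i j.+1) && D (cor i j.+1) (cor i.+1 j.+1).
  have [-> //|ne] := eqVneq (chi (ctr i j)) (chi (ctr i j.+1)).
  have cl : close (3 / 2 * m) (ctr i j) (ctr i j.+1).
    by apply/closeP; rewrite /ctr /= xS; split; lra.
  rewrite D0 ?andbF //.
  - by apply: near_cor ne cl; apply/closeP; rewrite /ctr /cor /= ?xS; split; lra.
  - by apply: near_cor ne cl; apply/closeP; rewrite /ctr /cor /= !xS; split; lra.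
  - by apply/closeP; rewrite /cor /= !xS; split; lra.
pose cell i j := [&& chi (ctr i j) &
   (D (cor i j) (cor i j.+1) (+) D (cor i.+1 j) (cor i.+1 j.+1)) (+)
   (D (cor i j) (cor i.+1 j) (+) D (cor i j.+1) (cor i.+1 j.+1))].
have S0 : \big[addb/false]_(i < N) \big[addb/false]_(j < N) cell i j = false.
  transitivity (\big[addb/false]_(j < N) \big[addb/false]_(i < N)
      (chi (ctr i j) && (D (cor i j) (cor i j.+1) (+) D (cor i.+1 j) (cor i.+1 j.+1)))
    (+) \big[addb/false]_(i < N) \big[addb/false]_(j < N)
      (chi (ctr i j) && (D (cor i j) (cor i.+1 j) (+) D (cor i j.+1) (cor i.+1 j.+1)))).
    rewrite [X in X (+) _]exchange_big -big_split; apply: eq_bigr => i _.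
    by rewrite -big_split; apply: eq_bigr => j _; rewrite /cell andb_addr.
  rewrite !big1 // => [i|j] _.
    rewrite (@xor_telescope_cond (fun j => chi (ctr i j))
      (fun j => D (cor i j) (cor i.+1 j)) N (keyh i)).
    by rewrite !chi_far // /ctr /= ?x0 ?xN; apply/or4P; [constructor 4|constructor 3]; lra.
  rewrite (@xor_telescope_cond (fun i => chi (ctr i j))
      (fun i => D (cor i j) (cor i j.+1)) N (keyv^~ j)).
  by rewrite !chi_far // /ctr /= ?x0 ?xN; apply/or4P; [constructor 2|constructor 1]; lra.
have cellE i j : cell i j = chi (ctr i j) && (th (cor i j) (cor i j.+1) (+) th (cor i.+1 j) (cor i.+1 j.+1)).
  rewrite /cell; congr andb.
  have hz a b : a.2 = b.2 -> th a b = false by rewrite /th /theta => ->; rewrite !addbb !andbF.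
  rewrite /D (hz (cor i j) (cor i.+1 j)) // (hz (cor i j.+1) (cor i.+1 j.+1)) //.
  by bxor.
(* Only the cell containing [r] has odd circulation, and [chi] agrees at its centre and at [r]. *)
have one r e : 0 < e -> 10 * m <= e -> (forall a, A a -> ~~ close e r a) ->
    [/\ - M < r.1, r.1 < M, - M < r.2 & r.2 < M] ->
  \big[addb/false]_(i < N) \big[addb/false]_(j < N)
    (chi (ctr i j) && (theta r (cor i j) (cor i j.+1) (+) theta r (cor i.+1 j) (cor i.+1 j.+1)))
  = chi r.
  move=> e0 me fr [r1 r2 r3 r4].
  transitivity (chi r && \big[addb/false]_(i < N) \big[addb/false]_(j < N)
     (((r.1 < x i) (+) (r.1 < x i.+1)) && ((x j <= r.2) (+) (x j.+1 <= r.2)))).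
    rewrite big_distrr; apply: eq_bigr => i _; rewrite big_distrr; apply: eq_bigr => j _.
    rewrite /theta /= -andb_addl.
    have [|] := boolP ((r.1 < x i) (+) (r.1 < x i.+1)); last by rewrite !andbF.
    have [|] := boolP ((x j <= r.2) (+) (x j.+1 <= r.2)); last by rewrite !andbF.
    rewrite !andbT => hj hi; rewrite /chi; congr addb; apply: esym.
    apply: (@component_near_eq A p r e) => //.
    move: hi hj; rewrite !xS => /(lt_cross m0) hi /(le_cross m0) hj.
    exact: (close_center m0 me hi hj).
  under eq_bigr => i _ do rewrite -big_distrr /=.
  rewrite -big_distrl /= (xor_telescope (fun i => r.1 < x i)) (xor_telescope (fun j => x j <= r.2)).
  rewrite x0 xN; have -> : (r.1 < - L%:R) = false by apply/negbTE; rewrite -leNgt; lra.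
  have -> : r.1 < L%:R by lra.
  have -> : - L%:R <= r.2 by lra.
  have -> : (L%:R <= r.2) = false by apply/negbTE; rewrite -ltNge; lra.
  by rewrite andbT.
have S1 : \big[addb/false]_(i < N) \big[addb/false]_(j < N) cell i j = chi p (+) chi q.
  rewrite -(@one p ep) //; last lra.
  rewrite -(@one q eq) //; last lra.
  rewrite -big_split; apply: eq_bigr => i _; rewrite -big_split; apply: eq_bigr => j _.
  by rewrite cellE /th /=; bxor.
move: S1; rewrite S0 /chi.
have -> : `[< C p >] by apply/asboolP; exact: connected_component_refl.
have -> : `[< C q >] = false by apply/asboolPn.
by case: `[< C far >].
Qed.
End SameComponent.
End Parity.

(** * Local cocycles as sums of winding parities *)

Section Parity2.
Variable R : realType.
Local Notation P := (R * R)%type.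
Implicit Types (a b p q x y z : P) (e : R) (A K : set P) (th : P -> P -> bool).

(** The discrete Poincare lemma: integrate along the bottom row, then up a column. *)
Lemma grid_exact (N : nat) (wh wv : nat -> nat -> bool) :
  (forall i j, (i < N)%N -> (j < N)%N ->
     wv i j (+) wv i.+1 j (+) (wh i j (+) wh i j.+1) = false) ->
  exists g : nat -> nat -> bool,
    (forall i j, wv i j = g i j (+) g i j.+1) /\
    (forall i j, (i < N)%N -> (j <= N)%N -> wh i j = g i j (+) g i.+1 j).
Proof.
move=> cl; exists (fun i j => \big[addb/false]_(k < i) wh k 0%N (+)
                             \big[addb/false]_(l < j) wv i l); split.
  by move=> i j; rewrite [X in _ = _ (+) (_ (+) X)]big_ord_recr /=; bxor.
move=> i + iN; elim=> [|j IH] jN.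
  by rewrite !big_ord0 big_ord_recr /=; bxor.
have -> : wh i j.+1 = wh i j (+) (wv i j (+) wv i.+1 j).
  by have := cl i j iN jN; case: (wv i j); case: (wv i.+1 j); case: (wh i j); case: (wh i j.+1).
by rewrite (IH (ltnW jN)) !big_ord_recr /=; bxor.
Qed.

Lemma xor_single N i (f : nat -> bool) : (i < N)%N ->
  (forall k, k != i -> f k = false) -> \big[addb/false]_(k < N) f k = f i.
Proof.
move=> iN H; rewrite (bigD1 (Ordinal iN)) //= big1 ?addbF // => k ne.
by apply: H; apply: contra ne => /eqP E; apply/eqP/val_inj.
Qed.

Lemma floor_cell (m L t : R) : 0 < m -> - L < t ->
  exists i : nat, 0 <= t - (i%:R * m - L) < m.
Proof.
move=> m0 Lt; exists (Num.truncn ((t + L) / m)).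
have h : 0 <= (t + L) / m by apply: divr_ge0; lra.
have /andP[h1 h2] := truncn_itv h.
move: h1 h2; rewrite ler_pdivlMr // ltr_pdivrMr // -natr1 => h1 h2.
by apply/andP; split; lra.
Qed.

Lemma nat_step (m L t t' : R) (i i' : nat) : 0 < m ->
  0 <= t - (i%:R * m - L) < m -> 0 <= t' - (i'%:R * m - L) < m ->
  t - m < t' -> t' < t + m -> [\/ i' = i, i' = i.+1 | i = i'.+1].
Proof.
move=> m0 /andP[h1 h2] /andP[h3 h4] h5 h6.
have lt1 : (i' < i.+2)%N.
  by rewrite -(ltr_nat R) -(ltr_pM2r m0) -!natr1; lra.
have lt2 : (i < i'.+2)%N.
  by rewrite -(ltr_nat R) -(ltr_pM2r m0) -!natr1; lra.
move: lt1 lt2; rewrite !ltnS leq_eqVlt => /orP[/eqP->|]; first by constructor 2.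
rewrite ltnS => h; rewrite leq_eqVlt => /orP[/eqP->|]; first by constructor 3.
by rewrite ltnS => h'; constructor 1; apply/eqP; rewrite eqn_leq h h'.
Qed.

Lemma theta_same_height p a b : a.2 = b.2 -> theta p a b = false.
Proof. by rewrite /theta => ->; rewrite addbb andbF. Qed.

Lemma thetaE (r s t u v w : R) :
  theta (r, s) (t, u) (v, w) = (r < v) && ((u <= s) (+) (w <= s)).
Proof. by []. Qed.

(** The cocycle is copied to a grid through close points of [K]. A cell with odd circulation cannot
    be near [K], where a local primitive exists. One point at the centre of each such cell makes the
    corrected grid cochain closed, hence exact, and its primitive is carried back to [K]. *)
Lemma cocycle_span K e (eta : P -> P -> bool) M :
  far_bound K M -> 0 < M -> 0 < e -> loc_cob K e eta ->
  exists ps : seq P, (forall p, p \in ps -> ~ K p) /\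
    triv K (fun a b => eta a b (+) \big[addb/false]_(p <- ps) theta p a b).
Proof.
move=> bK M0 e0 lc.
have [k [k0 km]] : exists k : nat, (0 < k)%N /\ k%:R^-1 < Num.min (e / 20) 1.
  by apply: small_mesh; rewrite lt_min; apply/andP; split; lra.
set m := k%:R^-1 in km.
have m0 : 0 < m by rewrite invr_gt0 ltr0n.
move: km; rewrite lt_min => /andP[ke k1].
pose L := (Num.bound M).+2.
have ML : M + 1 < L%:R.
  have : M < (Num.bound M)%:R by apply: archi_boundP; exact: ltW.
  by rewrite /L -[in X in _ -> X]addn2 natrD; lra.
pose N := (L.*2 * k)%N.
pose x (i : nat) : R := i%:R * m - L%:R.
have xS i : x i.+1 = x i + m by rewrite /x -natr1; ring.
have xle i j : (i <= j)%N -> x i <= x j.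
  by move=> ij; rewrite /x lerB // ler_pM2r // ler_nat.
have xN : x N = L%:R.
  rewrite /x /N natrM -mulrA /m mulfV ?mulr1 ?pnatr_eq0 -?lt0n //.
  by rewrite -addnn natrD; ring.
pose ctr i j : P := (x i + m / 2, x j + m / 2).
pose cor i j : P := (x i, x j).
pose nr v := exists a, K a /\ close (4 * m) v a.
pose pr v := if pselect (nr v) is left H then projT1 (cid H) else v.
have prP v : nr v -> K (pr v) /\ close (4 * m) v (pr v).
  by rewrite /pr; case: pselect => // H _; case: cid.
pose et v w := [&& `[< nr v >], `[< nr w >] & eta (pr v) (pr w)].
pose bad i j := et (cor i j) (cor i j.+1) (+) et (cor i.+1 j) (cor i.+1 j.+1) (+)
   (et (cor i j) (cor i.+1 j) (+) et (cor i j.+1) (cor i.+1 j.+1)).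
have bad_far i j a : bad i j -> K a -> ~~ close (3 * m) (ctr i j) a.
  move=> bd Ka; apply/negP => ca.
  have nrc i' j' : close m (ctr i j) (cor i' j') -> nr (cor i' j').
    move=> cc; exists a; split=> //; apply: (@close_le _ (m + 3 * m)); first by clear - m0; lra.
    exact: close_trans (close_sym cc) ca.
  have c1 : close m (ctr i j) (cor i j) by apply/closeP; rewrite /ctr /cor /=; clear - m0; split; lra.
  have c2 : close m (ctr i j) (cor i j.+1) by apply/closeP; rewrite /ctr /cor /= xS; clear - m0; split; lra.
  have c3 : close m (ctr i j) (cor i.+1 j) by apply/closeP; rewrite /ctr /cor /= xS; clear - m0; split; lra.
  have c4 : close m (ctr i j) (cor i.+1 j.+1) by apply/closeP; rewrite /ctr /cor /= !xS; clear - m0; split; lra.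
  have [rho hr] := lc a Ka.
  have hp i' j' (cc : close m (ctr i j) (cor i' j')) :
      K (pr (cor i' j')) /\ close e a (pr (cor i' j')).
    have [Kp cp] := prP _ (nrc _ _ cc); split=> //.
    apply: (@close_le _ (3 * m + m + 4 * m)); first by clear - ke m0; lra.
    exact: close_trans (close_trans (close_sym ca) cc) cp.
  have [K1 d1] := hp _ _ c1; have [K2 d2] := hp _ _ c2.
  have [K3 d3] := hp _ _ c3; have [K4 d4] := hp _ _ c4.
  move: bd; rewrite /bad /et.
  rewrite (asboolT (nrc _ _ c1)) (asboolT (nrc _ _ c2)) (asboolT (nrc _ _ c3)) (asboolT (nrc _ _ c4)) /=.
  rewrite !hr //.
  by case: (rho _); case: (rho _); case: (rho _); case: (rho _).
pose Th a b := \big[addb/false]_(i < N) \big[addb/false]_(j < N)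
   (bad i j && theta (ctr i j) a b).
pose wh i j := et (cor i j) (cor i.+1 j) (+) Th (cor i j) (cor i.+1 j).
pose wv i j := et (cor i j) (cor i j.+1) (+) Th (cor i j) (cor i j.+1).
have cross (i i' : nat) : ((x i' + m / 2 < x i) (+) (x i' + m / 2 < x i.+1)) = (i == i').
  rewrite xS; case: (ltngtP i i') => [ii|ii|->].
  - have := xle _ _ ii; rewrite xS => h.
    by have [|] := ltP (x i' + m / 2) (x i); have [|] := ltP (x i' + m / 2) (x i + m) => //=; clear - h m0; lra.
  - have := xle _ _ ii; rewrite xS => h.
    by have [|] := ltP (x i' + m / 2) (x i); have [|] := ltP (x i' + m / 2) (x i + m) => //=; clear - h m0; lra.
  - by have [|] := ltP (x i' + m / 2) (x i'); have [|] := ltP (x i' + m / 2) (x i' + m) => //=; clear - m0; lra.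
have crossle (i i' : nat) : ((x i <= x i' + m / 2) (+) (x i.+1 <= x i' + m / 2)) = (i == i').
  by rewrite -cross !leNgt; case: (_ < _); case: (_ < _).
have Thcell i j : (i < N)%N -> (j < N)%N ->
    Th (cor i j) (cor i j.+1) (+) Th (cor i.+1 j) (cor i.+1 j.+1) = bad i j.
  move=> iN jN; rewrite /Th -big_split /=.
  transitivity (\big[addb/false]_(i' < N) \big[addb/false]_(j' < N)
     (bad i' j' && ((i == i' :> nat) && (j == j' :> nat)))).
    apply: eq_bigr => i' _; rewrite -big_split /=; apply: eq_bigr => j' _.
    by rewrite /ctr /cor !thetaE -andb_addr -andb_addl cross crossle.
  rewrite (@xor_single N i (fun i' => \big[addb/false]_(j' < N)
     (bad i' j' && ((i == i') && (j == j'))))) //; last first.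
    by move=> i' /negbTE ne; rewrite big1 // => j' _; rewrite eq_sym ne andbF.
  rewrite (@xor_single N j (fun j' => bad i j' && ((i == i) && (j == j')))) ?eqxx ?andbT //.
  by move=> j' /negbTE ne; rewrite [j == j']eq_sym ne !andbF.
have Thh i j j' : Th (cor i j) (cor j' j) = false.
  by rewrite /Th big1 // => i' _; rewrite big1 // => j'' _; rewrite theta_same_height ?andbF.
have [g [gv gh]] : exists g : nat -> nat -> bool,
    (forall i j, wv i j = g i j (+) g i j.+1) /\
    (forall i j, (i < N)%N -> (j <= N)%N -> wh i j = g i j (+) g i.+1 j).
  apply: grid_exact => i j iN jN; rewrite /wv /wh !Thh.
  have E := Thcell _ _ iN jN.
  transitivity (bad i j (+) (Th (cor i j) (cor i j.+1) (+) Th (cor i.+1 j) (cor i.+1 j.+1))).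
    by rewrite /bad; bxor.
  by rewrite E addbb.
pose ps := [seq ctr ij.1 ij.2 | ij <- [seq (i, j) | i <- iota 0 N, j <- iota 0 N] & bad ij.1 ij.2].
have ThE a b : \big[addb/false]_(p <- ps) theta p a b = Th a b.
  rewrite /ps big_map big_filter big_mkcond /= big_allpairs /Th.
  rewrite -(big_mkord xpredT (fun i => \big[addb/false]_(j < N) (bad i j && theta (ctr i j) a b))).
  rewrite /index_iota subn0; apply: eq_bigr => i _.
  rewrite -(big_mkord xpredT (fun j => bad i j && theta (ctr i j) a b)) /index_iota subn0.
  by apply: eq_bigr => j _ /=; case: (bad i j).
exists ps; split.
  move=> p /mapP[[i j]]; rewrite mem_filter /= => /andP[bd _] -> Kc.
  have := bad_far i j _ bd Kc; rewrite close_refl //; clear - m0; lra.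
have cellx (t : R) : - M < t -> t < M -> exists i, [/\ 0 <= t - x i < m & (i < N)%N].
  move=> h1 h2; have [i hi] := @floor_cell m L%:R t m0 ltac:(clear - h1 ML; lra).
  exists i; split=> //; rewrite ltnNge; apply/negP => /xle; rewrite xN.
  by move/andP: hi => [h3 h4]; rewrite /x in h3 h4 *; clear - h3 h4 h2 ML; lra.
have cellxP a : exists ij : nat * nat, K a ->
    [/\ 0 <= a.1 - x ij.1 < m, 0 <= a.2 - x ij.2 < m, (ij.1 < N)%N & (ij.2 < N)%N].
  have [Ka|nK] := pselect (K a); last by exists (0%N, 0%N).
  have [h1 h2 h3 h4] := bK _ Ka.
  have [i [? ?]] := cellx _ h1 h2; have [j [? ?]] := cellx _ h3 h4.
  by exists (i, j).
pose ix a := projT1 (cid (cellxP a)).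
have ixP a : K a -> [/\ 0 <= a.1 - x (ix a).1 < m, 0 <= a.2 - x (ix a).2 < m,
   ((ix a).1 < N)%N & ((ix a).2 < N)%N] by rewrite /ix; case: cid.
pose va a := cor (ix a).1 (ix a).2.
(* The grid primitive at a corner of the cell of [a], corrected by the step from [a] to that
   corner. *)
pose kk a := g (ix a).1 (ix a).2 (+) eta a (pr (va a)) (+) Th a (va a).
exists m, kk; split=> // a b Ka Kb ab; rewrite ThE.
have [rho hr] := lc a Ka.
pose S y := \big[addb/false]_(i < N) \big[addb/false]_(j < N) (bad i j && theta_pot (ctr i j) a y).
have ThS u v : close (3 * m) a u -> close (3 * m) a v -> Th u v = S u (+) S v.
  move=> cu cv; rewrite /Th /S -big_split; apply: eq_bigr => i _.
  rewrite -big_split; apply: eq_bigr => j _ /=.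
  have [bd|//] := boolP (bad i j).
  rewrite (@theta_local _ _ a (3 * m)) //.
  by apply: contra (bad_far _ _ _ bd Ka) => ?; apply: close_sym.
have nrA v : close (3 * m) a v -> nr v.
  by move=> c; exists a; split=> //; apply: close_sym; apply: close_le c; clear - m0; lra.
have pre v : close (3 * m) a v -> K (pr v) /\ close e a (pr v).
  move=> c; have [Kp cp] := prP _ (nrA _ c); split=> //.
  by apply: (@close_le _ (3 * m + 4 * m)); [clear - ke m0; lra | exact: close_trans cp].
pose Om v := rho (pr v) (+) S v.
have omE u v : close (3 * m) a u -> close (3 * m) a v ->
    et u v (+) Th u v = Om u (+) Om v.
  move=> cu cv; rewrite /et (asboolT (nrA _ cu)) (asboolT (nrA _ cv)) /= ThS //.
  have [? ?] := pre _ cu; have [? ?] := pre _ cv.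
  by rewrite hr // /Om; bxor.
have [a1 a2 a3 a4] := ixP _ Ka; have [b1 b2 b3 b4] := ixP _ Kb.
have [ab1 ab2 ab3 ab4] := closeP _ _ _ ab.
have cloc i j : x i - 2 * m < a.1 -> a.1 < x i + 2 * m -> x j - 2 * m < a.2 -> a.2 < x j + 2 * m ->
    close (3 * m) a (cor i j).
  by clear - m0 => *; apply/closeP; rewrite /cor /=; split; lra.
have c1 : close (3 * m) a (va a).
  by clear - m0 cloc a1 a2; move/andP: a1 => []; move/andP: a2 => [] *; apply: cloc; lra.
have c2 : close (3 * m) a (cor (ix b).1 (ix a).2).
  by clear - m0 cloc b1 a2 ab1 ab2; move/andP: b1 => []; move/andP: a2 => [] *; apply: cloc; lra.
have c3 : close (3 * m) a (va b).
  by clear - m0 cloc b1 b2 ab1 ab2 ab3 ab4; move/andP: b1 => []; move/andP: b2 => [] *; apply: cloc; lra.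
(* The corners of two close points are joined by at most one horizontal and one vertical grid
   edge. *)
have gE : g (ix a).1 (ix a).2 (+) g (ix b).1 (ix b).2 = Om (va a) (+) Om (va b).
  have g1 : g (ix a).1 (ix a).2 (+) g (ix b).1 (ix a).2 =
            Om (va a) (+) Om (cor (ix b).1 (ix a).2).
    case: (nat_step m0 a1 b1 ab1 ab2) => [E|E|E].
    - by rewrite /va E !addbb.
    - by rewrite -omE // /va E -gh // ltnW.
    - by rewrite addbC [RHS]addbC -omE // /va E -gh // ltnW.
  have g2 : g (ix b).1 (ix a).2 (+) g (ix b).1 (ix b).2 =
            Om (cor (ix b).1 (ix a).2) (+) Om (va b).
    case: (nat_step m0 a2 b2 ab3 ab4) => [E|E|E].
    - by rewrite /va E !addbb.
    - by rewrite -omE // /va E -gv.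
    - by rewrite addbC [RHS]addbC -omE // /va E -gv.
  transitivity ((g (ix a).1 (ix a).2 (+) g (ix b).1 (ix a).2) (+)
     (g (ix b).1 (ix a).2 (+) g (ix b).1 (ix b).2)); first by bxor.
  by rewrite g1 g2; bxor.
have caa : close (3 * m) a a by apply: close_refl; clear - m0; lra.
have cab : close (3 * m) a b by apply: close_le ab; clear - m0; lra.
have ea : close e a a by apply: close_refl.
have eb : close e a b by apply: close_le ab; clear - ke m0; lra.
have [Kpa epa] := pre _ c1; have [Kpb epb] := pre _ c3.
transitivity ((g (ix a).1 (ix a).2 (+) g (ix b).1 (ix b).2) (+)
  ((eta a (pr (va a)) (+) eta b (pr (va b))) (+) (Th a (va a) (+) Th b (va b)))); last first.
  by rewrite /kk; bxor.
rewrite gE !ThS // !hr // /Om; bxor.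
Qed.
End Parity2.

(** * Moving points, gluing potentials, arcs *)

Section Parity3.
Variable R : realType.
Local Notation P := (R * R)%type.
Implicit Types (a b p q x y z : P) (e : R) (A B C K : set P) (th : P -> P -> bool).

Lemma close_open e w z : close e w z ->
  exists2 e', 0 < e' & forall b, close e' z b -> close e w b.
Proof.
move=> /closeP[h1 h2 h3 h4].
pose t := Num.min (Num.min (z.1 - (w.1 - e)) (w.1 + e - z.1))
                  (Num.min (z.2 - (w.2 - e)) (w.2 + e - z.2)).
have t1 : t <= z.1 - (w.1 - e) by rewrite /t !ge_min lexx.
have t2 : t <= w.1 + e - z.1 by rewrite /t !ge_min lexx ?orbT.
have t3 : t <= z.2 - (w.2 - e) by rewrite /t !ge_min lexx ?orbT.
have t4 : t <= w.2 + e - z.2 by rewrite /t !ge_min lexx ?orbT.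
exists t; first by rewrite /t !lt_min; apply/andP; split; apply/andP; split; lra.
by clearbody t; move=> b /closeP[? ? ? ?]; apply/closeP; split; lra.
Qed.

Lemma locally_constant C (g : P -> bool) : connected C ->
  (forall x, C x -> exists2 e, 0 < e & forall y, C y -> close e x y -> g x = g y) ->
  forall x y, C x -> C y -> g x = g y.
Proof.
move=> cC lg x y Cx Cy.
pose U (v : bool) := [set z | exists w e, [/\ C w, g w = v, 0 < e, close e w z &
   forall y, C y -> close e w y -> g w = g y]].
have oU v : open (U v).
  rewrite openE => z /= -[w [e [Cw gw e0 wz H]]]; apply/nbhs_close.
  have [e' e'0 he] := close_open wz.
  by exists e' => // b /he wb; exists w, e; split.
have CU v z : C z -> (U v z <-> g z = v).
  move=> Cz; split; first by case=> w [e [Cw gw e0 wz H]]; rewrite -(H z).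
  by move=> gz; have [e e0 H] := lg z Cz; exists z, e; split=> //; exact: close_refl.
have E : C `&` U (g x) = C; first apply: cC.
- by exists x; split=> //; apply/CU.
- by exists (U (g x)).
- exists (~` U (~~ g x)); first exact: open_closedC.
  apply/seteqP; split=> z [Cz Uz]; split => //.
    move=> /CU; move: Uz => /CU -> // /(_ Cz); by case: (g x).
  by apply/CU => //; case: (boolP (g z == g x)) => [/eqP //|ne]; exfalso; apply: Uz;
    apply/CU => //; move: ne; case: (g z); case: (g x).
by have : C y by []; rewrite -{1}E => -[_ /CU h]; rewrite h.
Qed.

(** The primitive marks points to the right of [p] at heights between [p] and [q]. It could fail
    only inside the box around [q], which [A] avoids. *)
Lemma theta_move A p q e : 0 < e -> close e q p ->
  (forall a, A a -> ~~ close (2 * e) q a) ->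
  triv A (fun a b => theta p a b (+) theta q a b).
Proof.
move=> e0 /closeP[q1 q2 q3 q4] far.
exists e, (fun a => (p.1 < a.1) && ((a.2 <= p.2) (+) (a.2 <= q.2))); split=> //.
move=> a b Aa Ab /closeP[a1 a2 a3 a4]; rewrite /theta.
have [h|h] := leP b.1 (q.1 - 2 * e).
  have -> : (p.1 < b.1) = false by apply/negbTE; rewrite -leNgt; lra.
  have -> : (q.1 < b.1) = false by apply/negbTE; rewrite -leNgt; lra.
  by have -> : (p.1 < a.1) = false by apply/negbTE; rewrite -leNgt; lra.
have [h'|h'] := leP (q.1 + 2 * e) b.1.
  have -> : (p.1 < b.1) by lra.
  have -> : (q.1 < b.1) by lra.
  by have -> : (p.1 < a.1); [lra | rewrite /=; bxor].
have [k|k] := leP b.2 (q.2 - 2 * e).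
  have -> : (a.2 <= p.2) by lra.
  have -> : (b.2 <= p.2) by lra.
  have -> : (a.2 <= q.2) by lra.
  by have -> : (b.2 <= q.2); [lra | rewrite /= !andbF].
have [k'|k'] := leP (q.2 + 2 * e) b.2.
  have -> : (a.2 <= p.2) = false by apply/negbTE; rewrite -ltNge; lra.
  have -> : (b.2 <= p.2) = false by apply/negbTE; rewrite -ltNge; lra.
  have -> : (a.2 <= q.2) = false by apply/negbTE; rewrite -ltNge; lra.
  by have -> : (b.2 <= q.2) = false; [apply/negbTE; rewrite -ltNge; lra | rewrite /= !andbF].
by have /negP[] := far b Ab; apply/closeP; split.
Qed.

(** By [theta_move] the class of [theta q] on [A] is locally constant in [q], and components are
    connected. *)
Lemma same_component_triv A p q : closed A -> ~ A p ->
  connected_component (~` A) p q -> triv A (fun a b => theta p a b (+) theta q a b).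
Proof.
move=> cA nAp pq.
pose C := connected_component (~` A) p.
pose g q := `[< triv A (fun a b => theta p a b (+) theta q a b) >].
have Cp : C p by exact: connected_component_refl.
suff E : g p = g q.
  apply/asboolP; rewrite -/(g q) -E; apply/asboolP.
  by exists 1, (fun=> false); split=> // a b _ _ _; rewrite addbb.
apply: (@locally_constant C) => //; first exact: component_connected.
move=> x Cx; have nAx : ~ A x by have := connected_component_sub Cx.
have [e e0 far] := closed_far cA nAx.
exists (e / 2) => [|y Cy xy]; first lra.
have T : triv A (fun a b => theta y a b (+) theta x a b).
  apply: (@theta_move A y x (e / 2)) => //; first lra.
  by move=> a Aa; apply: contra (far a Aa); apply: close_le; lra.
apply: asbool_equiv_eq; split=> H; have := triv_xor H T; apply: triv_ext => a b _ _; bxor.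
Qed.

(** The Lebesgue number argument. *)
Lemma compact_uniform (T : topologicalType) (A : set T) (Q : R -> T -> Prop) :
  compact A ->
  (forall x : T, A x -> exists2 d : R, 0 < d &
     \forall x' \near x, forall s : R, 0 < s -> s <= d -> A x' -> Q s x') ->
  exists2 d : R, 0 < d & forall x : T, A x -> Q d x.
Proof.
move=> /compact_near_coveringP cA H.
have HH : forall x : T, A x -> \forall x' \near x & s \near 0^'+, A x' -> Q s x'.
  move=> x /H[d d0 Hd].
  exists ([set x' : T | forall s : R, 0 < s -> s <= d -> A x' -> Q s x'], [set s : R | 0 < s <= d]).
    split => //=; near=> s; apply/andP; split; near: s; first exact: nbhs_right_gt.
    exact: nbhs_right_le.
  by move=> [x' s] /= [h /andP[s0 sd]]; apply: h.
have h : \forall s \near (0 : R)^'+, A `<=` (fun x' : T => A x' -> Q s x').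
  by apply: cA => // x /HH.
near (0 : R)^'+ => s; exists s; first by near: s; exact: nbhs_right_gt.
move=> x Ax; suff : A `<=` (fun x' : T => A x' -> Q s x') by apply.
by near: s; exact: h.
Unshelve. all: by end_near. Qed.

Lemma compact_meet A B d : compact A -> closed B -> 0 < d ->
  exists2 e, 0 < e & forall a b, A a -> B b -> close e a b ->
    exists x, [/\ A x, B x & close d x a].
Proof.
move=> cA cB d0.
have [] := @compact_uniform _ A (fun e a => forall b, B b -> close e a b ->
   exists x, [/\ A x, B x & close d x a]) cA.
  move=> x Ax; have [Bx|nBx] := pselect (B x).
    exists 1 => //; apply/nbhs_close; exists d => // a xa s _ _ Aa b _ _; by exists x.
  have [e e0 far] := closed_far cB nBx.
  exists (e / 2); first lra.
  apply/nbhs_close; exists (e / 2); first lra.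
  move=> a xa s s0 se Aa b Bb ab; have /negP[] := far b Bb.
  by apply: (@close_le _ (e / 2 + s)); [lra | exact: close_trans ab].
by move=> e e0 H; exists e => // a b Aa; exact: H.
Qed.

Lemma pos_min (r s : R) : 0 < r -> 0 < s -> exists t, [/\ 0 < t, t <= r & t <= s].
Proof.
move=> r0 s0; have [rs|sr] := leP r s; first by exists r.
by exists s; split=> //; exact: ltW.
Qed.

(** A Mayer-Vietoris step. Close points on different sides are near a common point [z] of [A] and
    [B], where the potentials agree; comparing both with the local primitive at [z] settles the
    mixed case. *)
Lemma glue A B e th (eA eB : R) (hA hB : P -> bool) :
  compact A -> compact B -> 0 < e -> 0 < eA -> 0 < eB -> loc_cob (A `|` B) e th ->
  potential A eA th hA -> potential B eB th hB ->
  (forall x, A x -> B x -> hA x = hB x) ->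
  exists e' h, [/\ 0 < e', potential (A `|` B) e' th h,
    forall x, A x -> h x = hA x & forall x, B x -> h x = hB x].
Proof.
move=> cA cB e0 eA0 eB0 lc pA pB E.
have clB : closed B by apply: compact_closed => //; exact: norm_hausdorff.
have [d' [d'0 dA dB]] := pos_min eA0 eB0.
have [d3 [d30 d3e d3d]] := pos_min e0 d'0.
pose d := d3 / 3.
have d0 : 0 < d by rewrite /d; lra.
have dP : [/\ d <= e / 3, d <= eA / 3 & d <= eB / 3] by rewrite /d; split; lra.
clearbody d; case: dP => dP1 dP2 dP3.
have [e1 e10 H] := compact_meet cA clB d0.
pose h x := if `[< A x >] then hA x else hB x.
have hAE x : A x -> h x = hA x by move=> Ax; rewrite /h asboolT.
have hBE x : B x -> h x = hB x.
  by move=> Bx; rewrite /h; case: asboolP => // Ax; exact: E.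
have [e' [e'0 e'1 e'd]] := pos_min e10 d0.
exists e', h; split=> // a b Aa Ab ab.
have mixed x y : A x -> B y -> close e' x y ->
  exists rho : P -> bool, [/\ th x y = rho x (+) rho y, th y x = rho y (+) rho x &
     h x (+) h y = rho x (+) rho y].
  move=> Ax By xy; have [z [Az Bz zx]] := H x y Ax By ltac:(apply: close_le xy; lra).
  have [rho hr] := lc z (or_introl Az).
  have zy : close (d + e') z y by exact: close_trans xy.
  have zz : close e z z by exact: close_refl.
  have zx' : close e z x by apply: close_le zx; lra.
  have zy' : close e z y by apply: close_le zy; lra.
  exists rho; rewrite !hr //; try (by [left | right]); split=> //.
  have e1' : rho z (+) rho x = hA z (+) hA x.
    by rewrite -hr //; [apply: pA => //; apply: close_le zx; lra | left | left].
  have e2' : rho z (+) rho y = hB z (+) hB y.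
    by rewrite -hr //; [apply: pB => //; apply: close_le zy; lra | right | right].
  rewrite hAE // hBE //; move: e1' e2'; rewrite (E z) //.
  by move: (rho x) (rho y) (rho z) (hB z) (hA x) (hB y); do 6!case.
case: Aa Ab => [Aa|Ba] [Ab|Bb].
- by rewrite !hAE //; apply: pA => //; apply: close_le ab; lra.
- by have [rho [-> _ ->]] := mixed a b Aa Bb ab.
- have [rho [_ -> hh]] := mixed b a Ab Ba (close_sym ab).
  by rewrite addbC [RHS]addbC hh.
- by rewrite !hBE //; apply: pB => //; apply: close_le ab; lra.
Qed.

Lemma loc_cob_sub A B e th : A `<=` B -> loc_cob B e th -> loc_cob A e th.
Proof.
move=> AB lc x /AB/lc[rho H]; exists rho => a b /AB ? /AB; exact: H.
Qed.

Lemma arc_compact A p q : is_arc A p q -> compact A.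
Proof.
move=> [f [fc _ _ _ <-]]; apply: continuous_compact => //; exact: segment_compact.
Qed.

Lemma arc_connected A p q : is_arc A p q -> connected A.
Proof.
move=> [f [fc _ _ _ <-]]; apply: connected_continuous_connected => //.
exact: segment_connected.
Qed.

(** The parameter interval is cut so finely that each piece has a local primitive. Pieces are glued
    one after another: by injectivity a new piece meets the old ones in a single point, where its
    additive constant is adjusted. *)
Lemma arc_triv A p q e th : is_arc A p q -> 0 < e -> loc_cob A e th -> triv A th.
Proof.
move=> arcA e0 lc; have [f [fc finj f0 f1 fA]] := arcA.
have [d d0 dP] : exists2 d : R, 0 < d & forall t : R, `[0, 1]%classic t ->
    forall s : R, `[0, 1]%classic s -> `|s - t| < d -> close e (f t) (f s).
  apply: (@compact_uniform R `[0, 1]%classic (fun d (t : R) => forall s : R, `[0, 1]%classic s ->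
    `|s - t| < d -> close e (f t) (f s))); first exact: segment_compact.
  move=> t tI.
  have /subspace_continuousP/(_ t tI) ft := fc.
  have /ft : nbhs (f t) [set x | close (e / 2) (f t) x].
    by apply/nbhs_close; exists (e / 2) => //; lra.
  move=> /nbhs_ballP[d /= d0 dP]; exists (d / 2); first lra.
  apply/nbhs_ballP; exists (d / 2) => /=; first lra.
  move=> u; rewrite /ball /= => tu s s0 sd uI v vI vu.
  have cu : close (e / 2) (f t) (f u).
    by apply: dP => //; rewrite /ball /=; move: tu; rewrite !ltr_norml => /andP[? ?]; apply/andP; split; lra.
  have cv : close (e / 2) (f t) (f v).
    apply: dP => //; rewrite /ball /=; move: tu vu; rewrite !ltr_norml => /andP[? ?] /andP[? ?].
    by apply/andP; split; lra.
  by apply: (@close_le _ (e / 2 + e / 2)); [lra | exact: close_trans (close_sym cu) cv].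
have [N [N0 Nd]] := small_mesh d0.
set m : R := N%:R^-1 in Nd.
have m0 : 0 < m by rewrite invr_gt0 ltr0n.
have Nm : N%:R * m = 1 by rewrite mulfV // pnatr_eq0 -lt0n.
pose I (s t : R) := f @` `[s, t]%classic.
have sub01 (s t : R) : 0 <= s -> t <= 1 -> `[s, t]%classic `<=` `[0, 1]%classic.
  by move=> s0 t1 u /=; rewrite !in_itv /= => /andP[? ?]; apply/andP; split; lra.
have subA (s t : R) : 0 <= s -> t <= 1 -> I s t `<=` A.
  by move=> s0 t1 _ [u uI <-]; rewrite -fA; exists u => //; exact: sub01 uI.
have cI (s t : R) : 0 <= s -> t <= 1 -> compact (I s t).
  move=> s0 t1; apply: continuous_compact; last exact: segment_compact.
  exact: continuous_subspaceW (sub01 _ _ s0 t1) fc.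
have step (k : nat) : (k <= N)%N -> exists e' h, 0 < e' /\ potential (I 0 (k%:R * m)) e' th h.
  elim: k => [|k IH] kN.
    exists 1, (fun=> false); split=> // a b [u uI <-] [v vI <-] _.
    move: uI vI; rewrite /= !in_itv /= mul0r => uI vI.
    have -> : u = 0 by lra.
    have -> : v = 0 by lra.
    have Af : A (f 0) by rewrite -fA; exists 0 => //=; rewrite in_itv /= lexx ler01.
    have [rho hr] := lc _ Af; rewrite hr ?addbb //; exact: close_refl.
  have [e1 [h1 [e10 p1]]] := IH (ltnW kN).
  have k0 : 0 <= k%:R * m by rewrite mulr_ge0 ?ler0n // ltW.
  have kS : k.+1%:R * m = k%:R * m + m by rewrite -natr1; ring.
  have k1 : k.+1%:R * m <= 1 by rewrite -[X in _ <= X]Nm ler_pM2r // ler_nat.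
  have kI : `[0, 1]%classic (k%:R * m) by rewrite /= in_itv /=; lra.
  pose x := f (k%:R * m).
  have Ax : A x by rewrite -fA; exists (k%:R * m).
  have [rho hr] := lc x Ax.
  pose h2 y := rho y (+) (rho x (+) h1 x).
  have p2 : potential (I (k%:R * m) (k.+1%:R * m)) 1 th h2.
    have near y : I (k%:R * m) (k.+1%:R * m) y -> A y /\ close e x y.
      move=> Iy; split; first exact: subA Iy.
      case: Iy => u uI <-; apply: dP => //.
        by apply: sub01 uI; lra.
      move: uI; rewrite /= in_itv /= => /andP[? ?].
      by rewrite ltr_norml; apply/andP; split; lra.
    move=> a b /near[Aa xa] /near[Ab xb] _; rewrite hr // /h2; bxor.
  have c1 : compact (I 0 (k%:R * m)) by apply: cI; lra.
  have c2 : compact (I (k%:R * m) (k.+1%:R * m)) by apply: cI; lra.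
  have lcI : loc_cob (I 0 (k%:R * m) `|` I (k%:R * m) (k.+1%:R * m)) e th.
    by apply: loc_cob_sub lc => y [] h; apply: subA h; lra.
  have agr y : I 0 (k%:R * m) y -> I (k%:R * m) (k.+1%:R * m) y -> h1 y = h2 y.
    move=> [u uI <-] [v vI vu].
    have E : v = u by apply: finj => //; [apply: sub01 vI | apply: sub01 uI]; lra.
    move: uI vI; rewrite E /= !in_itv /= => /andP[? ?] /andP[? ?].
    have -> : u = k%:R * m by lra.
    by rewrite /h2 -/x; bxor.
  have := glue c1 c2 e0 e10 ltr01 lcI p1 p2 agr.
  move=> [e' [h [e'0 ph _ _]]]; exists e', h; split=> // a b Aa Ab; apply: ph.
    case: Aa => u; rewrite /= in_itv /= => /andP[u0 u1] <-.
    have [le|lt] := leP u (k%:R * m); [left | right]; exists u => //=; rewrite in_itv /=; lra.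
  case: Ab => u; rewrite /= in_itv /= => /andP[u0 u1] <-.
  have [le|lt] := leP u (k%:R * m); [left | right]; exists u => //=; rewrite in_itv /=; lra.
have [e' [h []]] := step N (leqnn N); rewrite Nm => e'0 ph.
by exists e', h; split=> // a b; rewrite -fA; exact: ph.
Qed.
End Parity3.

(** * Drawings of graphs *)

Section Drawing.
Variables (R : realType) (G : plane_graph R).
Local Notation P := (R * R)%type.
Implicit Types (p q x y z : P) (e : R) (A B C K : set P) (th : P -> P -> bool) (u v w : G).

Lemma pair_hausdorff : hausdorff_space P.
Proof. exact: norm_hausdorff. Qed.

Lemma compact_far A : compact A -> exists2 M, 0 < M & far_bound A M.
Proof.
move=> /compact_bounded[M [_ HM]].
pose M1 := Num.max M 0 + 1.
have h1 : M < M1 by rewrite /M1 (@le_lt_trans _ _ (Num.max M 0)) ?ltrDl // le_max lexx.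
have h0 : 0 < M1 by rewrite /M1 ltr_pwDr // le_max lexx orbT.
exists (M1 + 1) => [|a Aa]; first by rewrite ltr_wpDr.
have /= := HM _ h1 a Aa; rewrite prod_normE ge_max => /andP[].
by rewrite !ler_norml => /andP[? ?] /andP[? ?]; split; lra.
Qed.

Lemma edge_compact u v : adj u v -> compact (edge_set u v).
Proof. by move=> uv; exact: arc_compact (edge_arc uv). Qed.

Lemma edge_ends u v : adj u v -> edge_set u v (pos u) /\ edge_set u v (pos v).
Proof.
move=> uv; have [f [_ _ f0 f1 <-]] := edge_arc uv; split.
  by exists 0 => //=; rewrite in_itv /= lexx ler01.
by exists 1 => //=; rewrite in_itv /= lexx ler01.
Qed.

(** The integral of [th] along the edge; by [incE] it does not depend on the potential, since the
    edge is connected. *)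
Definition inc th u v : bool := `[< exists e h,
  [/\ 0 < e, potential (edge_set u v) e th h & h (pos u) (+) h (pos v)] >].

Lemma incE th u v e h : adj u v -> 0 < e -> potential (edge_set u v) e th h ->
  inc th u v = h (pos u) (+) h (pos v).
Proof.
move=> uv e0 ph; apply/idP/idP; last by move=> hh; apply/asboolP; exists e, h.
move=> /asboolP[e' [h' [e'0 ph' hh']]].
have [t [t0 te te']] := pos_min e0 e'0.
have [eu ev] := edge_ends uv.
suff : h (pos u) (+) h' (pos u) = h (pos v) (+) h' (pos v).
  by move: hh'; case: (h' _); case: (h' _); case: (h _); case: (h _).
apply: (@locally_constant _ (edge_set u v) (fun x => h x (+) h' x)) => //.
  exact: arc_connected (edge_arc uv).
move=> x Ax; exists t => // y Ay xy.
have := ph x y Ax Ay (close_le te xy); rewrite (ph' x y Ax Ay (close_le te' xy)).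
by case: (h x); case: (h y); case: (h' x); case: (h' y).
Qed.

Lemma theta_loc_cob A p : closed A -> ~ A p ->
  exists2 e, 0 < e & loc_cob A e (theta p).
Proof.
move=> cA nAp; have [e e0 far] := closed_far cA nAp.
exists e => // x Ax; exists (theta_pot p x) => a b _ _ xa xb.
by apply: (theta_local _ xa xb); apply: contra (far x Ax); exact: close_sym.
Qed.

Lemma loc_cob_xor A e e' th th' : loc_cob A e th -> loc_cob A e' th' ->
  0 < e -> 0 < e' ->
  exists2 e2, 0 < e2 & loc_cob A e2 (fun a b => th a b (+) th' a b).
Proof.
move=> l l' e0 e'0; have [t [t0 te te']] := pos_min e0 e'0.
exists t => // x Ax; have [r hr] := l x Ax; have [r' hr'] := l' x Ax.
exists (fun a => r a (+) r' a) => a b Aa Ab xa xb.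
by rewrite hr ?hr' //; [bxor|apply: close_le xa|apply: close_le xb|
  apply: close_le xa|apply: close_le xb].
Qed.

Lemma inc_xor th th' u v : adj u v -> triv (edge_set u v) th -> triv (edge_set u v) th' ->
  inc (fun a b => th a b (+) th' a b) u v = inc th u v (+) inc th' u v.
Proof.
move=> uv [e [h [e0 H]]] [e' [h' [e'0 H']]].
rewrite (incE uv e0 H) (incE uv e'0 H').
have [t [t0 te te']] := pos_min e0 e'0.
rewrite (@incE _ u v t (fun x => h x (+) h' x)) //; first by bxor.
move=> a b Aa Ab ab; rewrite (H a b) ?(H' a b) //; first by bxor.
  exact: close_le te' ab.
exact: close_le te ab.
Qed.

Lemma edge_triv th u v e : adj u v -> 0 < e -> loc_cob (edge_set u v) e th ->
  triv (edge_set u v) th.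
Proof. by move=> uv; exact: arc_triv (edge_arc uv). Qed.

Lemma edge_closed u v : adj u v -> closed (edge_set u v).
Proof. by move=> uv; apply: compact_closed; [exact: pair_hausdorff | exact: edge_compact]. Qed.

Lemma theta_edge_triv p u v : adj u v -> ~ edge_set u v p -> triv (edge_set u v) (theta p).
Proof.
move=> uv np; have [e e0 lc] := theta_loc_cob (edge_closed uv) np.
exact: edge_triv lc.
Qed.

Lemma inc_sym th u v : adj u v -> inc th u v = inc th v u.
Proof.
move=> uv; rewrite /inc (edge_sym uv).
by apply/asboolP/asboolP => -[e [h [e0 H hh]]]; exists e, h; split=> //; rewrite addbC.
Qed.

Definition vset (s : seq G) : set P := [set x | exists2 v, v \in s & x = pos v].

Definition eset (L : seq (G * G)) : set P :=
  [set x | exists2 uv, uv \in L & edge_set uv.1 uv.2 x].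

(** Each edge is listed once, oriented by the enumeration of the vertices, so that different entries
    meet only in ends. *)
Definition olist (L : seq (G * G)) := uniq L /\
  {in L, forall uv, adj uv.1 uv.2 /\ (enum_rank uv.1 < enum_rank uv.2)%N}.

Lemma vset_compact s : compact (vset s).
Proof.
elim: s => [|v s IH].
  have -> : vset [::] = set0 by apply/seteqP; split=> // x [].
  exact: compact0.
have -> : vset (v :: s) = [set pos v] `|` vset s.
  apply/seteqP; split=> x.
    by move=> [w]; rewrite inE => /orP[/eqP->|ws] ->; [left | right; exists w].
  by move=> [->|[w ws ->]]; [exists v; rewrite ?mem_head | exists w; rewrite ?inE ?ws ?orbT].
by apply: compactU => //; exact: compact_set1.
Qed.

Lemma eset_compact s L : olist L -> compact (vset s `|` eset L).
Proof.
move=> [_]; elim: L => [|[u v] L IH] H.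
  have -> : eset [::] = set0 by apply/seteqP; split=> // x [].
  by rewrite setU0; exact: vset_compact.
have -> : eset ((u, v) :: L) = edge_set u v `|` eset L.
  apply/seteqP; split=> x.
    by move=> [w]; rewrite inE => /orP[/eqP->|ws] /= h; [left | right; exists w].
  by move=> [h|[w ws h]]; [exists (u, v); rewrite ?mem_head | exists w; rewrite ?inE ?ws ?orbT].
rewrite setUCA; apply: compactU.
  by apply: edge_compact; have [] := H (u, v) (mem_head _ _).
by apply: IH => uv uvL; apply: H; rewrite inE uvL orbT.
Qed.

Lemma vset_glue s th e (hv : G -> bool) : uniq s -> 0 < e -> loc_cob (vset s) e th ->
  exists e' h, [/\ 0 < e', potential (vset s) e' th h & forall v, v \in s -> h (pos v) = hv v].
Proof.
elim: s => [|v s IH] /=; first by exists 1, (fun=> false); split=> // a b [].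
move=> /andP[vs us] e0 lc.
have E : vset (v :: s) = [set pos v] `|` vset s.
  apply/seteqP; split=> x.
    by move=> [w]; rewrite inE => /orP[/eqP->|ws] ->; [left | right; exists w].
  by move=> [->|[w ws ->]]; [exists v; rewrite ?mem_head | exists w; rewrite ?inE ?ws ?orbT].
rewrite E in lc *.
have [|e' [h [e'0 ph hE]]] := IH us e0 _.
  by apply: loc_cob_sub lc => x; right.
have pv : potential [set pos v] 1 th (fun=> hv v).
  move=> a b -> -> _; have [r hr] := lc (pos v) (or_introl erefl).
  by rewrite hr ?addbb //; [left | left | exact: close_refl | exact: close_refl].
have [x -> [w ws /pos_inj Ew]|e2 [h2 [e20 p2 h2v h2s]]] :=
   glue (@compact_set1 _ (pos v)) (vset_compact (s := s)) e0 ltr01 e'0 lc pv ph.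
  by rewrite Ew ws in vs.
exists e2, h2; split=> // w; rewrite inE => /orP[/eqP->|ws]; first by rewrite h2v.
by rewrite h2s ?hE //; exists w.
Qed.

Lemma edges_meet u v u' v' x : adj u v -> adj u' v' ->
  (enum_rank u < enum_rank v)%N -> (enum_rank u' < enum_rank v')%N -> (u, v) != (u', v') ->
  edge_set u v x -> edge_set u' v' x -> x = pos u \/ x = pos v.
Proof.
move=> uv uv' r r' ne h h'; apply: contrapT => /not_orP[nu nv].
have : ((edge_set u v `\` [set pos u; pos v]) `&` edge_set u' v') x.
  by split=> //; split=> // -[].
rewrite edge_edge // => E.
have : u \in [set u'; v']%SET by rewrite -E !inE eqxx.
have : v \in [set u'; v']%SET by rewrite -E !inE eqxx orbT.
rewrite !inE => /orP[]/eqP Ev /orP[]/eqP Eu; subst u v.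
- by rewrite ltnn in r.
- by move: r; rewrite ltnNge ltnW.
- by rewrite eqxx in ne.
- by rewrite ltnn in r.
Qed.

(** Edges are added one at a time. The potential of the new edge is shifted to be right at one end,
    and the assumption on [inc] makes it right at the other. *)
Lemma edges_glue L th e (hv : G -> bool) : olist L -> 0 < e ->
  loc_cob (vset (enum G) `|` eset L) e th ->
  {in L, forall uv, inc th uv.1 uv.2 = hv uv.1 (+) hv uv.2} ->
  exists e' h, [/\ 0 < e', potential (vset (enum G) `|` eset L) e' th h
                & forall v, h (pos v) = hv v].
Proof.
elim: L => [|[u v] L IH] oL e0.
  have -> : eset [::] = set0 by apply/seteqP; split=> // x [].
  rewrite setU0 => lc _; have [e' [h [e'0 p hE]]] := vset_glue hv (enum_uniq G) e0 lc.
  by exists e', h; split=> // v; rewrite hE // mem_enum.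
have oL' : olist L.
  by case: oL => /= /andP[_ uL] H; split=> // x xL; apply: H; rewrite inE xL orbT.
have E : vset (enum G) `|` eset ((u, v) :: L) = edge_set u v `|` (vset (enum G) `|` eset L).
  rewrite setUCA; congr setU; apply/seteqP; split=> x.
    by move=> [w]; rewrite inE => /orP[/eqP->|ws] /= h; [left | right; exists w].
  by move=> [h|[w ws h]]; [exists (u, v); rewrite ?mem_head | exists w; rewrite ?inE ?ws ?orbT].
rewrite {}E => lc hL.
have [uv rk] : adj u v /\ (enum_rank u < enum_rank v)%N by case: oL => _ /(_ (u, v) (mem_head _ _)).
have [||e' [h [e'0 ph hE]]] := IH oL' e0 _ _.
- by apply: loc_cob_sub lc => x; right.
- by move=> x xL; apply: hL; rewrite inE xL orbT.
have [e1 [h1 [e10 p1]]] : triv (edge_set u v) th.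
  by apply: (edge_triv uv e0); apply: loc_cob_sub lc => x; left.
pose h2 x := h1 x (+) (h1 (pos u) (+) hv u).
have h2u : h2 (pos u) = hv u by rewrite /h2; bxor.
have h2v : h2 (pos v) = hv v.
  have := hL (u, v) (mem_head _ _); rewrite (incE uv e10 p1) /= /h2.
  by case: (h1 _); case: (h1 _); case: (hv _); case: (hv _).
have p2 : potential (edge_set u v) e1 th h2.
  by move=> a b Aa Ab ab; rewrite p1 // /h2; bxor.
have agr x : edge_set u v x -> (vset (enum G) `|` eset L) x -> h2 x = h x.
  move=> xe xB; suff [->|->] : x = pos u \/ x = pos v by rewrite ?h2u ?h2v hE.
  move: xB => [[w _ xw]|[[u' v'] uvL /= xe']].
    by move: xe; rewrite xw => /(edge_vertex uv)[->|->]; [left | right].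
  have [uv' rk'] : adj u' v' /\ (enum_rank u' < enum_rank v')%N by case: oL' => _ /(_ _ uvL).
  apply: (edges_meet uv uv' rk rk' _ xe xe').
  by case: oL => /= /andP[nL _] _; apply: contra nL => /eqP ->.
have [e2 [h3 [e30 p3 h3A h3B]]] :=
   glue (edge_compact uv) (eset_compact (s := enum G) oL') e0 e10 e'0 lc p2 ph agr.
exists e2, h3; split=> // w; rewrite h3B ?hE //; left; exists w => //; exact: mem_enum.
Qed.

End Drawing.

(** * Winding parities of edges *)

Section Drawing2.
Variables (R : realType) (G : plane_graph R).
Local Notation P := (R * R)%type.
Implicit Types (p q x y z : P) (e : R) (A B C K : set P) (th : P -> P -> bool) (u v w : G)
  (D : rel G).

Definition elist D : seq (G * G) := [seq uv <- enum {: G * G} |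
  [&& adj uv.1 uv.2, D uv.1 uv.2 & (enum_rank uv.1 < enum_rank uv.2)%N]].

Definition AD D : set P := vset (enum G) `|` eset (elist D).

Lemma elistP D u v : ((u, v) \in elist D) =
  [&& adj u v, D u v & (enum_rank u < enum_rank v)%N].
Proof. by rewrite mem_filter mem_enum andbT. Qed.

Lemma elist_olist D : olist (elist D).
Proof.
split; first by rewrite filter_uniq // enum_uniq.
by move=> [u v]; rewrite elistP => /and3P[].
Qed.

Lemma AD_compact D : compact (AD D).
Proof. exact: eset_compact (elist_olist D). Qed.

Lemma AD_closed D : closed (AD D).
Proof. by apply: compact_closed; [exact: pair_hausdorff | exact: AD_compact]. Qed.

Lemma AD_vertex D v : AD D (pos v).
Proof. by left; exists v => //; exact: mem_enum. Qed.

Lemma AD_edge D u v : symmetric D -> adj u v -> D u v -> edge_set u v `<=` AD D.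
Proof.
move=> sD uv Duv x xe; right.
case: (ltngtP (enum_rank u) (enum_rank v)) => r.
- by exists (u, v); rewrite ?elistP ?uv ?Duv ?r.
- exists (v, u); rewrite ?elistP; first by rewrite adj_sym uv sD Duv r.
  by rewrite /= -edge_sym.
- by move/val_inj/enum_rank_inj: r => E; rewrite E adj_irr in uv.
Qed.

Lemma AD_sub D D' : (forall u v, adj u v -> D u v -> D' u v) -> AD D `<=` AD D'.
Proof.
move=> H x [xv|[[u v]]]; first by left.
rewrite elistP => /and3P[uv Duv r] xe; right; exists (u, v) => //.
by rewrite elistP uv r H.
Qed.

Lemma drawingE : drawing G = AD (fun _ _ => true).
Proof.
apply/seteqP; split=> x.
  move=> [[v ->]|[u [v [uv xe]]]]; first exact: AD_vertex.
  by apply: AD_edge xe.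
move=> [[v _ ->]|[[u v]]]; first by left; exists v.
by rewrite elistP => /and3P[uv _ _] xe; right; exists u, v.
Qed.

Definition cw p u v := inc (theta p) u v.

Lemma cw_sym p u v : adj u v -> cw p u v = cw p v u.
Proof. exact: inc_sym. Qed.

Lemma cw_xor p q u v : adj u v -> ~ edge_set u v p -> ~ edge_set u v q ->
  inc (fun a b => theta p a b (+) theta q a b) u v = cw p u v (+) cw q u v.
Proof. by move=> uv np nq; apply: inc_xor => //; exact: theta_edge_triv. Qed.

Lemma component_coboundary D p q : symmetric D -> ~ AD D p ->
  connected_component (~` AD D) p q ->
  exists hv : G -> bool, forall u v, adj u v -> D u v ->
    cw p u v (+) cw q u v = hv u (+) hv v.
Proof.
move=> sD np pq.
have nq : ~ AD D q by have := connected_component_sub pq.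
have [e [h [e0 H]]] := same_component_triv (AD_closed (D := D)) np pq.
exists (fun v => h (pos v)) => u v uv Duv.
have sub := AD_edge sD uv Duv.
rewrite -cw_xor //; [|by move=> /sub|by move=> /sub].
by apply: (incE uv e0) => a b Aa Ab; apply: H; exact: sub.
Qed.

(** [edges_glue] extends the coboundary from the vertices to a potential on the drawing of [D], and
    [triv_same_component] applies. *)
Lemma coboundary_component D p q (hv : G -> bool) : symmetric D -> ~ AD D p -> ~ AD D q ->
  (forall u v, adj u v -> D u v -> cw p u v (+) cw q u v = hv u (+) hv v) ->
  connected_component (~` AD D) p q.
Proof.
move=> sD np nq H.
have cA := AD_closed (D := D).
have [e1 e10 l1] := theta_loc_cob cA np.
have [e2 e20 l2] := theta_loc_cob cA nq.
have [e e0 l] := loc_cob_xor l1 l2 e10 e20.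
have [|e' [h [e'0 ph _]]] := @edges_glue _ _ (elist D) _ _ hv (elist_olist D) e0 l.
  move=> [u v]; rewrite elistP => /and3P[uv Duv _] /=.
  have sub := AD_edge sD uv Duv.
  by rewrite cw_xor ?H //; [move=> /sub | move=> /sub].
have [M M0 bM] := compact_far (compactU (AD_compact (D := D))
   (compactU (@compact_set1 _ p) (@compact_set1 _ q))).
apply: (@triv_same_component _ _ p q cA np nq M) => //.
- by move=> a Aa; apply: bM; left.
- by apply: bM; right; left.
- by apply: bM; right; right.
- by exists e', h.
Qed.

Lemma theta_sum_triv (ps : seq P) u v : adj u v ->
  (forall p, p \in ps -> ~ edge_set u v p) ->
  triv (edge_set u v) (fun a b => \big[addb/false]_(p <- ps) theta p a b) /\
  inc (fun a b => \big[addb/false]_(p <- ps) theta p a b) u v =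
    \big[addb/false]_(p <- ps) cw p u v.
Proof.
move=> uv; elim: ps => [|p ps IH] H.
  have T : potential (edge_set u v) 1 (fun a b => \big[addb/false]_(p <- [::]) theta p a b)
       (fun=> false) by move=> a b _ _ _; rewrite big_nil.
  by split; [exists 1, (fun=> false) | rewrite (incE uv ltr01 T) big_nil].
have [|T1 T2] := IH; first by move=> q qps; apply: H; rewrite inE qps orbT.
have T0 : triv (edge_set u v) (theta p) by apply: theta_edge_triv => //; apply: H; exact: mem_head.
have E : (fun a b => \big[addb/false]_(q <- p :: ps) theta q a b) =
   (fun a b => theta p a b (+) \big[addb/false]_(q <- ps) theta q a b).
  by apply/funext => a; apply/funext => b; rewrite big_cons.
rewrite E; split; first exact: triv_xor.
by rewrite inc_xor // T2 big_cons.
Qed.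

(** The indicator of one edge is the integral of a local cocycle [eta] that detects leaving the end
    [x0] along this edge; [cocycle_span] writes [eta] through winding parities. *)
Lemma cochain_span u0 v0 : adj u0 v0 -> exists (ps : seq P) (hv : G -> bool),
  (forall p, p \in ps -> ~ drawing G p) /\
  (forall u v, adj u v -> (((u, v) == (u0, v0)) || ((u, v) == (v0, u0))) =
     \big[addb/false]_(p <- ps) cw p u v (+) (hv u (+) hv v)).
Proof.
move=> uv0.
pose A := edge_set u0 v0.
pose D u v := ~~ (((u, v) == (u0, v0)) || ((u, v) == (v0, u0))).
have sD : symmetric D by move=> u v; rewrite /D !xpair_eqE [(v == _) && _]andbC [(v == v0) && _]andbC orbC.
pose B := AD D.
have KE : drawing G = A `|` B.
  rewrite drawingE; apply/seteqP; split=> x.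
    move=> [xv|[[u v]]]; first by right; left.
    rewrite elistP => /and3P[uv _ r] /= xe.
    have [Duv|] := boolP (D u v); first by right; exact: AD_edge xe.
    by rewrite negbK => /orP[]/eqP[Eu Ev]; subst u v; left => //; rewrite /A edge_sym.
  by move=> [/AD_edge|]; [apply | apply: AD_sub].
have AB x : A x -> B x -> x = pos u0 \/ x = pos v0.
  move=> Ax [[w _ xw]|[[u v]]].
    by move: Ax; rewrite xw => /(edge_vertex uv0)[->|->]; [left | right].
  rewrite elistP => /and3P[uv Duv r] /= xe; apply: contrapT => /not_orP[n1 n2].
  have : ((edge_set u0 v0 `\` [set pos u0; pos v0]) `&` edge_set u v) x.
    by split=> //; split=> // -[].
  rewrite edge_edge // => E.
  have : u \in [set u0; v0]%SET by rewrite E !inE eqxx.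
  have : v \in [set u0; v0]%SET by rewrite E !inE eqxx orbT.
  rewrite !inE => /orP[]/eqP Ev /orP[]/eqP Eu; subst u v; move: Duv; rewrite /D ?eqxx ?orbT //.
    by rewrite ltnn in r.
  by rewrite ltnn in r.
pose x0 := pos v0; pose y0 := pos u0.
have cA : compact A by exact: edge_compact.
have clB : closed B by exact: AD_closed.
have [r r0 fr] : exists2 r, 0 < r & ~~ close (4 * r) x0 y0.
  have [||t t0 ft] := @closed_far R [set y0] x0 _ _.
  - by apply: compact_closed; [exact: pair_hausdorff | exact: compact_set1].
  - by move=> /pos_inj E; rewrite E adj_irr in uv0.
  exists (t / 4); first lra.
  by apply: contra (ft y0 erefl); apply: close_le; lra.
pose ch x := `[< A x >] && (x != x0).
pose eta a b := [&& close r x0 a, close r x0 b & ch a (+) ch b].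
have [d1 d10 meet] : exists2 e, 0 < e & forall a b, A a -> B b -> close e a b ->
    exists x, [/\ A x, B x & close (r / 4) x a].
  by apply: compact_meet => //; lra.
have [d2 [d20 d2d d2r]] := pos_min d10 r0.
pose d := d2 / 4.
have [dd0 dd1 dd2] : [/\ 0 < d, 2 * d <= d1 & d <= r / 4] by rewrite /d; split; lra.
clearbody d; clear d2 d20 d2d d2r.
(* Away from [x0] the edge comes close to the rest of the drawing only near its other end [y0],
   which [fr] keeps at a distance from [x0]. *)
have aux z a b : A a -> (A `|` B) b -> close d z a -> close d z b -> ~~ close (r / 2) x0 z ->
    ~ A b -> ~~ close r x0 a.
  move=> Aa Kb za zb nz nAb; case: Kb => // Bb.
  have ab : close d1 a b.
    by apply: (@close_le _ (d + d)); [lra | exact: close_trans (close_sym za) zb].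
  have [x [Ax Bx xa]] := meet a b Aa Bb ab.
  case: (AB x Ax Bx) => Ex; subst x.
    apply: contra fr => x0a; apply: (@close_le _ (r + r / 4)); first lra.
    by apply: close_trans x0a (close_sym xa).
  exfalso; move/negP: nz; apply.
  apply: (@close_le _ (r / 4 + d)); first lra.
  exact: close_trans xa (close_sym za).
have lc : loc_cob (A `|` B) d eta.
  move=> z Kz; have [cz|ncz] := boolP (close (r / 2) x0 z).
    exists ch => a b Ka Kb za zb; rewrite /eta.
    have -> : close r x0 a by apply: (@close_le _ (r / 2 + d)); [lra | exact: close_trans za].
    by have -> : close r x0 b by apply: (@close_le _ (r / 2 + d)); [lra | exact: close_trans zb].
  exists (fun=> false) => a b Ka Kb za zb; rewrite /eta /=.
  apply/negbTE/negP => /and3P[ca cb].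
  have ne y : close d z y -> y != x0.
    move=> zy; apply: contra ncz => /eqP <-; apply: close_sym.
    by apply: close_le zy; lra.
  rewrite /ch !ne // !andbT.
  have [Aa|nAa] := asboolP (A a); have [Ab|nAb] := asboolP (A b) => // _.
    by move: ca; apply/negP; exact: (aux z a b).
  by move: cb; apply/negP; exact: (aux z b a).
have [M M0 bM] := compact_far (compactU cA (AD_compact (D := D))).
have [ps [nps [e [k [e0 pk]]]]] := cocycle_span bM M0 dd0 lc.
have npe p u v : p \in ps -> adj u v -> ~ edge_set u v p.
  move=> /nps; rewrite -/B -KE drawingE => np uv xe; apply: np.
  exact: (AD_edge _ uv _ xe).
exists ps, (fun v => k (pos v)); split=> [p /nps|u v uv]; first by rewrite KE.
have sub : edge_set u v `<=` A `|` B.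
  by rewrite -/B -KE drawingE; exact: (AD_edge _ uv).
have pk' : potential (edge_set u v) e
   (fun a b => eta a b (+) \big[addb/false]_(p <- ps) theta p a b) k.
  by move=> a b /sub Aa /sub Ab; exact: pk.
have [T1 T2] := theta_sum_triv uv (fun p pps => npe p u v pps uv).
suff [T3 T4] : triv (edge_set u v) eta /\ inc eta u v = ((u, v) == (u0, v0)) || ((u, v) == (v0, u0)).
  have := incE uv e0 pk'; rewrite inc_xor // T4 T2.
  by case: (_ || _); case: (\big[_/_]_(_ <- _) _); case: (k _); case: (k _).
have [|Duv] := boolP (((u, v) == (u0, v0)) || ((u, v) == (v0, u0))).
  move=> Duv; have Euv : edge_set u v = A.
    by case/orP: Duv => /eqP[-> ->] //; rewrite edge_sym // adj_sym.
  (* Along the edge itself [eta] is the coboundary of the indicator of [x0], which differs at the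
     two ends. *)
  have pA : potential (edge_set u v) (r / 2) eta (fun x => x == x0).
    rewrite Euv => a b Aa Ab ab; rewrite /eta /ch !asboolT //=.
    have [Ea|na] := eqVneq a x0; have [Eb|nb] := eqVneq b x0 => //=.
    - by rewrite !andbF.
    - rewrite Ea close_refl // andbT -Ea; apply: close_le ab; lra.
    - by rewrite Eb close_refl //= andbT -Eb; apply: close_le (close_sym ab); lra.
    - by rewrite !andbF.
  have r20 : 0 < r / 2 by lra.
  split; first by exists (r / 2), (fun x => x == x0).
  rewrite (incE uv r20 pA).
  have ne : (pos u0 == x0) = false.
    by apply/negbTE/negP => /eqP/pos_inj E; rewrite E adj_irr in uv0.
  by case/orP: Duv => /eqP[-> ->]; rewrite ne eqxx.
have pA : potential (edge_set u v) 1 eta (fun=> false).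
  move=> a b Aa Ab _ /=; apply/negbTE/negP => /and3P[ca cb].
  have ch0 x : edge_set u v x -> close r x0 x -> ch x = false.
    move=> xe cx; apply/negbTE/negP => /andP[/asboolP Ax ne].
    have : B x by apply: (AD_edge sD uv Duv).
    move=> /(AB x Ax)[] E; last by rewrite E eqxx in ne.
    by move/negP: fr; apply; rewrite -[y0]E; apply: close_le cx; lra.
  by rewrite !ch0.
split; first by exists 1, (fun=> false).
by rewrite (incE uv ltr01 pA).
Qed.

End Drawing2.

(** * Facial triangles *)

Section Faces.
Variables (R : realType) (G : plane_graph R).
Local Notation P := (R * R)%type.
Implicit Types (p q x y z : P) (e M : R) (A B C K F : set P) (a b u v w : G)
  (D : rel G) (t : {set G}).

Let K := drawing G.
Let allD : rel G := fun _ _ => true.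

Lemma drawing_closed : closed K.
Proof. by rewrite /K drawingE; exact: AD_closed. Qed.

Lemma drawing_far : exists2 M, 0 < M & far_bound K M.
Proof. by apply: compact_far; rewrite /K drawingE; exact: AD_compact. Qed.

Lemma AD_drawing D : AD D `<=` K.
Proof. by rewrite /K drawingE; apply: AD_sub. Qed.

Lemma face_point F p : face G F -> F p -> ~ K p /\ F = connected_component (~` K) p.
Proof.
move=> [q nq ->] qp; split; first by have := connected_component_sub qp.
exact: same_connected_component.
Qed.

Lemma face_eq F F' p : face G F -> face G F' -> F p -> F' p -> F = F'.
Proof. by move=> /face_point fF /face_point fF' /fF[_ ->] /fF'[_ ->]. Qed.

Lemma face_open F : face G F -> open F.
Proof.
by move=> [p np ->]; apply: component_open; apply: closed_openC; exact: drawing_closed.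
Qed.

(** Off its frontier the open set [F] is also closed. *)
Lemma face_absorbs F A p q : face G F -> frontier F `<=` A -> F p ->
  connected_component (~` A) p q -> F q.
Proof.
move=> fF FA Fp [C [Cp CA cC] Cq].
suff E : C `&` F = C by move: Cq; rewrite -E => -[].
apply: cC; first by exists p.
  by exists F => //; exact: face_open.
exists (closure F); first exact: closed_closure.
apply/seteqP; split=> x [Cx Fx]; split=> //; first exact: subset_closure.
apply: contrapT => nFx; apply: (CA x Cx); apply: FA; split=> //.
by move=> /interior_subset.
Qed.

Definition tri_face F t := exists u v w, [/\ adj u v, adj v w, adj w u,
  t = [set u; v; w]%SET & frontier F = edge_set u v `|` edge_set v w `|` edge_set w u].

Definition inside t : rel G := fun a b => (a \in t) && (b \in t).

Lemma inside_sym t : symmetric (inside t).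
Proof. by move=> a b; rewrite /inside andbC. Qed.

(** For [f := cw p], the parity with which the closed curve through [u], [v], [w] winds around
    [p]. *)
Definition tsum (f : rel G) u v w := f u v (+) f v w (+) f w u.

Lemma tsum_perm (f : rel G) u v w u' v' w' :
  (forall a b, adj a b -> f a b = f b a) ->
  adj u v -> adj v w -> adj w u -> [set u; v; w]%SET = [set u'; v'; w']%SET ->
  adj u' v' -> adj v' w' -> adj w' u' -> tsum f u v w = tsum f u' v' w'.
Proof.
move=> sf uv vw wu E uv' vw' wu'.
have hu : u' \in [set u; v; w]%SET by rewrite E !inE eqxx.
have hv : v' \in [set u; v; w]%SET by rewrite E !inE eqxx ?orbT.
have hw : w' \in [set u; v; w]%SET by rewrite E !inE eqxx ?orbT.
have s1 := sf _ _ uv; have s2 := sf _ _ vw; have s3 := sf _ _ wu.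
move: hu hv hw uv' vw' wu'; rewrite !inE -!orbA /tsum.
move=> /or3P[]/eqP-> /or3P[]/eqP-> /or3P[]/eqP->; rewrite ?adj_irr // => _ _ _;
  rewrite -?s1 -?s2 -?s3; bxor.
Qed.

Lemma tri_frontier F t : tri_face F t -> frontier F `<=` AD (inside t).
Proof.
move=> [u [v [w [uv vw wu -> ->]]]] x.
by move=> [[xe|xe]|xe]; apply: (AD_edge (inside_sym _) _ _ xe) => //; rewrite /inside !inE !eqxx ?orbT.
Qed.

(** If the triangle winds equally around [p] and [q], the difference of their parities sums to zero
    on it and is the coboundary of [hv]. So the triangle, which contains the frontier of [F], does
    not separate them. *)
Lemma tri_same_side F u v w p q : face G F ->
  adj u v -> adj v w -> adj w u -> frontier F = edge_set u v `|` edge_set v w `|` edge_set w u ->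
  F p -> ~ AD (inside [set u; v; w]%SET) q ->
  tsum (cw (G := G) p) u v w = tsum (cw (G := G) q) u v w -> F q.
Proof.
move=> fF uv vw wu frF Fp nq E.
have [np _] := face_point fF Fp.
apply: (face_absorbs (A := AD (inside [set u; v; w]%SET)) fF _ Fp).
  by apply: (@tri_frontier F [set u; v; w]%SET); exists u, v, w; split.
have ne1 : u == v = false by apply/negP => /eqP h; rewrite h adj_irr in uv.
have ne2 : v == w = false by apply/negP => /eqP h; rewrite h adj_irr in vw.
have ne3 : w == u = false by apply/negP => /eqP h; rewrite h adj_irr in wu.
pose d a b := cw (G := G) p a b (+) cw q a b.
have dS a b : adj a b -> d a b = d b a by move=> ab; rewrite /d (cw_sym p ab) (cw_sym q ab).
have dT : d w u = d u v (+) d v w.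
  by move: E; rewrite /tsum /d; move: (cw p u v) (cw p v w) (cw p w u) (cw q u v) (cw q v w) (cw q w u); do 6!case.
pose hv a := if a == u then false else if a == v then d u v else d w u.
have hvE : (hv u = false) * (hv v = d u v) * (hv w = d w u).
  by rewrite /hv !eqxx [v == u]eq_sym ne1 ne3 [w == v]eq_sym ne2.
apply: (@coboundary_component _ _ _ _ _ hv (inside_sym _)) => //.
  by move=> /AD_drawing.
move=> a b ab; rewrite -/(d a b) /inside !inE -!orbA.
move=> /andP[/or3P[]/eqP Ea /or3P[]/eqP Eb]; subst a b; rewrite ?adj_irr // in ab *.
- by rewrite !hvE.
- by rewrite !hvE (dS u w).
- by rewrite !hvE (dS v u) // addbF.
- by rewrite !hvE dT; bxor.
- by rewrite !hvE addbF.
- by rewrite !hvE (dS w v) // dT; bxor.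
Qed.

(** Either the ray of [q] misses the drawing, or the whole drawing is to the right of [q] and the
    height alone is a potential. *)
Lemma far_coboundary M q : far_bound K M ->
  [|| M <= q.1, q.1 <= - M, M <= q.2 | q.2 <= - M] ->
  exists hv : G -> bool, forall a b, adj a b -> cw q a b = hv a (+) hv b.
Proof.
move=> bK hq.
suff [h H] : exists h, potential K 1 (theta q) h.
  exists (fun a => h (pos a)) => a b ab; apply: (incE ab ltr01) => x y Ax Ay.
  by apply: H; right; exists a, b.
case/or4P: hq => hq.
- exists (fun=> false) => x y /bK[? ? ? ?] /bK[? ? ? ?] _; rewrite /theta.
  by have -> : (q.1 < y.1) = false by apply/negbTE; rewrite -leNgt; lra.
- exists (fun x => x.2 <= q.2) => x y /bK[? ? ? ?] /bK[? ? ? ?] _; rewrite /theta.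
  by have -> : (q.1 < y.1) by lra.
- exists (fun=> false) => x y /bK[? ? ? ?] /bK[? ? ? ?] _; rewrite /theta.
  have -> : x.2 <= q.2 by lra.
  by have -> : y.2 <= q.2; [lra | rewrite andbF].
- exists (fun=> false) => x y /bK[? ? ? ?] /bK[? ? ? ?] _; rewrite /theta.
  have -> : (x.2 <= q.2) = false by apply/negbTE; rewrite -ltNge; lra.
  by have -> : (y.2 <= q.2) = false; [apply/negbTE; rewrite -ltNge; lra | rewrite andbF].
Qed.

Lemma far_not_drawing M q : far_bound K M ->
  [|| M <= q.1, q.1 <= - M, M <= q.2 | q.2 <= - M] -> ~ K q.
Proof. by move=> bK hq /bK[? ? ? ?]; case/or4P: hq; lra. Qed.

Lemma tsum_cob (f : rel G) (hv : G -> bool) u v w :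
  (forall a b, adj a b -> f a b = hv a (+) hv b) ->
  adj u v -> adj v w -> adj w u -> tsum f u v w = false.
Proof. by move=> H uv vw wu; rewrite /tsum !H //; bxor. Qed.

(** Otherwise a far point, whose parity is 0, would be on the same side as [p] and so in the bounded
    set [F]. *)
Lemma tri_inside F u v w p : face G F -> bounded_set F ->
  adj u v -> adj v w -> adj w u -> frontier F = edge_set u v `|` edge_set v w `|` edge_set w u ->
  F p -> tsum (cw (G := G) p) u v w.
Proof.
move=> fF [N [_ bF]] uv vw wu frF Fp; apply: contrapT => /negP/negbTE s0.
have [M M0 bM] := drawing_far.
pose L := Num.max N 0 + Num.max M 0 + 1.
have [h1 h2] : N < L /\ M <= L.
  have := le_max N N 0; have := le_max 0 N 0; have := le_max M M 0; have := le_max 0 M 0.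
  by rewrite !lexx !orbT /= /L; split; lra.
pose q : P := (L + 1, 0).
have hq : [|| M <= q.1, q.1 <= - M, M <= q.2 | q.2 <= - M] by apply/orP; left => /=; lra.
have [hv cq] := far_coboundary bM hq.
have Fq : F q.
  apply: (tri_same_side fF uv vw wu frF Fp).
    by move=> /AD_drawing; exact: far_not_drawing hq.
  by rewrite s0 (tsum_cob cq).
have /= := bF L h1 q Fq; rewrite prod_normE ge_max /= => /andP[+ _].
by rewrite ler_norml => /andP[_]; lra.
Qed.

Lemma tri_outside F u v w p : face G F -> bounded_set F ->
  adj u v -> adj v w -> adj w u -> frontier F = edge_set u v `|` edge_set v w `|` edge_set w u ->
  ~ K p -> ~ F p -> tsum (cw (G := G) p) u v w = false.
Proof.
move=> fF bF uv vw wu frF np nF; apply/negbTE/negP => s1; apply: nF.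
have [p0 np0 E] := fF.
have Fp0 : F p0 by rewrite E; exact: connected_component_refl.
apply: (tri_same_side fF uv vw wu frF Fp0); first by move=> /AD_drawing.
by rewrite s1 (tri_inside fF bF).
Qed.

Lemma unbounded_coboundary F p : face G F -> ~ bounded_set F -> F p ->
  exists hv : G -> bool, forall a b, adj a b -> cw p a b = hv a (+) hv b.
Proof.
move=> fF ub Fp; have [M M0 bM] := drawing_far.
have [q Fq hq] : exists2 q, F q & [|| M <= q.1, q.1 <= - M, M <= q.2 | q.2 <= - M].
  apply: contrapT => no; apply: ub; exists M; split; first exact: num_real.
  move=> N MN x Fx /=; rewrite prod_normE ge_max !ler_norml.
  have : ~~ [|| M <= x.1, x.1 <= - M, M <= x.2 | x.2 <= - M].
    by apply/negP => hx; apply: no; exists x.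
  by rewrite !negb_or -!ltNge => /and4P[? ? ? ?]; apply/andP; split; apply/andP; split; lra.
have [hv cq] := far_coboundary bM hq.
have [np EF] := face_point fF Fp.
have [|||hv' H] := @component_coboundary _ G allD p q.
- by [].
- by rewrite -drawingE.
- by rewrite -drawingE -/K -EF.
exists (fun a => hv a (+) hv' a) => a b ab.
have := H a b ab isT; rewrite cq //.
by case: (cw _ _ _); case: (hv _); case: (hv _); case: (hv' _); case: (hv' _).
Qed.

Lemma same_face_coboundary F p q : face G F -> F p -> F q ->
  exists hv : G -> bool, forall a b, adj a b -> cw p a b = cw q a b (+) (hv a (+) hv b).
Proof.
move=> fF Fp Fq; have [np EF] := face_point fF Fp.
have [|||hv H] := @component_coboundary _ G allD p q.
- by [].
- by rewrite -drawingE.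
- by rewrite -drawingE -/K -EF.
exists hv => a b ab; have := H a b ab isT.
by case: (cw p _ _); case: (cw q _ _); case: (hv _); case: (hv _).
Qed.

End Faces.

(** * Bounded faces as triangles *)

Section Triangles.
Variables (R : realType) (G : plane_graph R).
Local Notation P := (R * R)%type.
Implicit Types (p q x y z : P) (e M : R) (A B C F : set P) (a b u v w : G)
  (D : rel G) (t : {set G}).
Hypothesis Htri : forall F, face G F -> bounded_set F -> bounded_by_triangle G F.
Let K := drawing G.

(** A bounded face is recorded by the vertices of its triangle; by [same_triangle] these determine
    the face. *)
Definition bfaces : {set {set G}} :=
  [set t : {set G} | `[< exists F, [/\ face G F, bounded_set F & tri_face F t] >]]%SET.

Definition bpoint t : P :=
  xget (0, 0) [set p | exists F, [/\ face G F, bounded_set F, tri_face F t & F p]].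

Lemma bpointP t : t \in bfaces ->
  exists F, [/\ face G F, bounded_set F, tri_face F t & F (bpoint t)].
Proof.
rewrite inE => /asboolP[F [fF bF tF]].
have h : exists p, [set p | exists F, [/\ face G F, bounded_set F, tri_face F t & F p]] p.
  have [p np E] := fF; exists p, F; split=> //.
  by rewrite E; exact: connected_component_refl.
exact: (xgetPex (0, 0) h).
Qed.

Lemma tri_face_mem F t a : tri_face F t -> (a \in t) <-> frontier F (pos a).
Proof.
move=> [u [v [w [uv vw wu -> ->]]]].
have [? ?] := edge_ends uv; have [? ?] := edge_ends vw; have [? ?] := edge_ends wu.
rewrite !inE -!orbA; split.
  by move=> /or3P[]/eqP->; [left; left | left; left | left; right].
move=> [[/(edge_vertex uv)|/(edge_vertex vw)]|/(edge_vertex wu)] [] ->;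
  by rewrite eqxx ?orbT.
Qed.

Lemma tri_face_inj F t t' : tri_face F t -> tri_face F t' -> t = t'.
Proof.
move=> tF tF'; apply/setP => a; apply/idP/idP.
  by move=> /(tri_face_mem _ tF)/(tri_face_mem _ tF').
by move=> /(tri_face_mem _ tF')/(tri_face_mem _ tF).
Qed.

Lemma tri_face_clique F t : tri_face F t ->
  #|t| = 3%N /\ forall a b, a \in t -> b \in t -> a != b -> adj a b.
Proof.
move=> [u [v [w [uv vw wu -> _]]]]; split.
  have ne1 : u != v by apply/negP => /eqP h; rewrite h adj_irr in uv.
  have ne2 : v != w by apply/negP => /eqP h; rewrite h adj_irr in vw.
  have ne3 : w != u by apply/negP => /eqP h; rewrite h adj_irr in wu.
  rewrite finset.setUC cardsU1 cards2 !inE ne1 negb_or ne3.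
  by rewrite eq_sym ne2.
move=> a b; rewrite !inE -!orbA => /or3P[]/eqP-> /or3P[]/eqP->; rewrite ?eqxx // => _ //;
  by rewrite adj_sym.
Qed.

Lemma kronecker t t' u v w : t \in bfaces -> t' \in bfaces ->
  t' = [set u; v; w]%SET -> adj u v -> adj v w -> adj w u ->
  tsum (cw (G := G) (bpoint t)) u v w = (t == t').
Proof.
move=> tB t'B Et' uv vw wu.
have [F [fF bF tF Fp]] := bpointP tB.
have [F' [fF' bF' tF' _]] := bpointP t'B.
have [np _] := face_point fF Fp.
have [u' [v' [w' [uv' vw' wu' E' fr']]]] := tF'.
rewrite (@tsum_perm _ _ _ u v w u' v' w') //; [|exact: cw_sym|by rewrite -Et'].
have [Ett|ne] := eqVneq t t'.
  move: tF'; rewrite -Ett => tF'2.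
  have [|nFp] := pselect (F' (bpoint t)); first exact: tri_inside.
  have [u2 [v2 [w2 [uv2 vw2 wu2 E2 fr2]]]] := tF.
  rewrite (@tsum_perm _ _ _ u' v' w' u2 v2 w2) //; [|exact: cw_sym|by rewrite -E' -Ett].
  exact: (tri_inside fF bF).
apply: (tri_outside fF' bF') => // Fp'.
have EF := face_eq fF fF' Fp Fp'; subst F'.
by move/eqP: ne; apply; exact: tri_face_inj tF tF'.
Qed.

Lemma same_triangle F F' t : face G F -> bounded_set F -> face G F' -> bounded_set F' ->
  tri_face F t -> tri_face F' t -> F = F'.
Proof.
move=> fF bF fF' bF' [u [v [w [uv vw wu E fr]]]] [u' [v' [w' [uv' vw' wu' E' fr']]]].
have [p np Ep] := fF'.
have Fp : F' p by rewrite Ep; exact: connected_component_refl.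
have [Fp'|nFp] := pselect (F p); first exact: (face_eq fF fF' Fp' Fp).
have := tri_outside fF bF uv vw wu fr np nFp.
rewrite (@tsum_perm _ _ _ u v w u' v' w') //; [|exact: cw_sym|by rewrite -E].
by rewrite (tri_inside fF' bF').
Qed.

(** Up to a coboundary, a point of a bounded face moves to the chosen [bpoint], and a point of an
    unbounded face contributes nothing; a face met twice cancels. *)
Lemma bfaces_span_seq (ps : seq P) : (forall p, p \in ps -> ~ K p) ->
  exists (X : {set {set G}}) (hv : G -> bool), X \subset bfaces /\
    forall a b, adj a b -> \big[addb/false]_(p <- ps) cw p a b =
      \big[addb/false]_(t in X) cw (bpoint t) a b (+) (hv a (+) hv b).
Proof.
elim: ps => [|p ps IH] H.
  exists finset.set0, (fun=> false); split; first exact: finset.sub0set.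
  by move=> a b _; rewrite big_nil big_set0.
have [|X [hv [XB E]]] := IH; first by move=> q qs; apply: H; rewrite inE qs orbT.
have np : ~ K p by apply: H; exact: mem_head.
pose F := connected_component (~` K) p.
have fF : face G F by exists p.
have Fp : F p by exact: connected_component_refl.
have [bF|ub] := pselect (bounded_set F); last first.
  have [hv' H'] := unbounded_coboundary fF ub Fp.
  exists X, (fun a => hv a (+) hv' a); split=> // a b ab.
  by rewrite big_cons H' // E //; bxor.
have [u [v [w [uv vw wu fr]]]] := Htri fF bF.
pose t := [set u; v; w]%SET.
have tF : tri_face F t by exists u, v, w.
have tB : t \in bfaces by rewrite inE; apply/asboolP; exists F.
have [F' [fF' bF' tF' Fp']] := bpointP tB.
have EF := same_triangle fF bF fF' bF' tF tF'; subst F'.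
have [hv' H'] := same_face_coboundary fF Fp Fp'.
have [tX|tX] := boolP (t \in X).
  exists (X :\ t)%SET, (fun a => hv a (+) hv' a); split.
    by apply: fintype.subset_trans XB; exact: subD1set.
  move=> a b ab; rewrite big_cons H' // E //.
  have -> : \big[addb/false]_(i in X) cw (bpoint i) a b = cw (bpoint t) a b (+)
      \big[addb/false]_(i in (X :\ t)%SET) cw (bpoint i) a b by exact: big_setD1.
  by bxor.
exists (t |: X)%SET, (fun a => hv a (+) hv' a); split.
  by rewrite finset.subUset finset.sub1set tB.
move=> a b ab; rewrite big_cons H' // E //.
have -> : \big[addb/false]_(i in (t |: X)%SET) cw (bpoint i) a b = cw (bpoint t) a b (+)
    \big[addb/false]_(i in X) cw (bpoint i) a b by exact: big_setU1.
by bxor.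
Qed.

Lemma bfaces_span u0 v0 : adj u0 v0 ->
  exists (X : {set {set G}}) (hv : G -> bool), X \subset bfaces /\
    forall a b, adj a b -> (((a, b) == (u0, v0)) || ((a, b) == (v0, u0))) =
      \big[addb/false]_(t in X) cw (bpoint t) a b (+) (hv a (+) hv b).
Proof.
move=> uv; have [ps [hv [nps E]]] := cochain_span uv.
have [X [hv' [XB E']]] := bfaces_span_seq nps.
exists X, (fun a => hv a (+) hv' a); split=> // a b ab.
by rewrite E // E' //; bxor.
Qed.

Lemma edge_middle a b : adj a b -> exists x, [/\ edge_set a b x, x <> pos a & x <> pos b].
Proof.
move=> ab; have [f [_ fi f0 f1 <-]] := edge_arc ab.
have h (t : R) : 0 <= t <= 1 -> t \in `[0, 1]%R by rewrite in_itv.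
exists (f (1 / 2)); split.
- by exists (1 / 2) => //=; rewrite in_itv /=; lra.
- rewrite -f0 => /fi E; have : 1 / 2 = 0 :> R by apply: E; apply: h; lra.
  lra.
- rewrite -f1 => /fi E; have : 1 / 2 = 1 :> R by apply: E; apply: h; lra.
  lra.
Qed.

Lemma middle_notin D a b x : adj a b -> edge_set a b x -> x <> pos a -> x <> pos b ->
  (forall u v, D u v -> [set u; v]%SET <> [set a; b]%SET) -> ~ AD D x.
Proof.
move=> ab xe na nb H [[w _ xw]|[[u v]]].
  by move: xe; rewrite xw => /(edge_vertex ab)[E|E]; rewrite xw E in na nb.
rewrite elistP => /and3P[uv Duv _] /= xe'.
have : ((edge_set a b `\` [set pos a; pos b]) `&` edge_set u v) x.
  by split=> //; split=> // -[].
rewrite edge_edge // => E; exact: (H u v Duv).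
Qed.

(** Consider the 4-cycle left of [t1] and [t2] without [a b]. The faces of [t1] and [t3] both reach
    the middle [x] of [a b], so it winds equally around their points; but it winds around the point
    of [t1] and not around that of [t3]. *)
Lemma edge_le2_aux a b (y1 y2 : G) t1 t2 t3 : adj a b ->
  t1 \in bfaces -> t2 \in bfaces -> t3 \in bfaces ->
  t1 = [set a; b; y1]%SET -> t2 = [set a; b; y2]%SET ->
  adj b y1 -> adj y1 a -> adj b y2 -> adj y2 a ->
  a \in t3 -> b \in t3 -> t1 != t2 -> t1 != t3 -> t2 != t3 -> False.
Proof.
move=> ab B1 B2 B3 E1 E2 by1 ya1 by2 ya2 a3 b3 n12 n13 n23.
have [x [xe xa xb]] := edge_middle ab.
pose D u v := (inside t1 u v || inside t2 u v) && ([set u; v]%SET != [set a; b]%SET).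
have sD : symmetric D.
  by move=> u v; rewrite /D (inside_sym t1) (inside_sym t2) (finset.setUC [set u]%SET).
have nx : ~ AD D x.
  by apply: (middle_notin ab xe xa xb) => u v /andP[_ /eqP].
have [F1 [f1 b1 T1 P1]] := bpointP B1.
have [F3 [f3 b3' T3 P3]] := bpointP B3.
have ne_ab : a != b by apply/negP => /eqP h; rewrite h adj_irr in ab.
have onfr F t : tri_face F t -> a \in t -> b \in t -> frontier F x.
  move=> [u [v [w [uv vw wu -> ->]]]]; rewrite !inE -!orbA.
  move=> /or3P[]/eqP Ea /or3P[]/eqP Eb; subst a b; rewrite ?eqxx // in ne_ab *.
  - by left; left.
  - by right; rewrite (edge_sym wu).
  - by left; left; rewrite (edge_sym uv).
  - by left; right.
  - by right.
  - by left; right; rewrite (edge_sym vw).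
have [e e0 far] := closed_far (AD_closed (D := D)) nx.
have reach F p t : face G F -> F p -> tri_face F t -> a \in t -> b \in t ->
    connected_component (~` AD D) p x.
  move=> fF Fp tF at_ bt; have [cl _] := onfr F t tF at_ bt.
  have [z [Fz xz]] : exists z, F z /\ close e x z.
    have /cl[z [Fz xz]] : nbhs x [set z | close e x z] by apply/nbhs_close; exists e.
    by exists z.
  have [np EF] := face_point fF Fp.
  apply: (@connected_component_trans _ _ z).
    move: Fz; rewrite EF => -[C [Cp CK cC] Cz]; exists C => //; split=> //.
    by move=> y /CK nK /AD_drawing.
  apply: connected_component_sym; apply: (@component_near _ (AD D) x x e) => //.
  exact: connected_component_refl.
have c13 : connected_component (~` AD D) (bpoint t1) (bpoint t3).
  apply: (@connected_component_trans _ _ x).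
    by apply: (reach F1 _ t1) => //; rewrite E1 !inE eqxx ?orbT.
  by apply: connected_component_sym; apply: (reach F3 _ t3).
have [np1 _] := face_point f1 P1.
have [|hv H] := component_coboundary sD _ c13; first by move=> /AD_drawing.
have [ne1 ne2] : y1 != y2 /\ true.
  by split=> //; apply/negP => /eqP h; rewrite E1 E2 h eqxx in n12.
have Dp u v : adj u v -> (inside t1 u v || inside t2 u v) ->
   ((u == y1) || (v == y1)) || ((u == y2) || (v == y2)) ->
   cw (bpoint t1) u v (+) cw (bpoint t3) u v = hv u (+) hv v.
  move=> uv Iuv yy; apply: H => //; rewrite /D Iuv /=; apply/eqP => E.
  have na1 : y1 != a by apply/negP => /eqP h; rewrite h adj_irr in ya1.
  have na2 : y2 != a by apply/negP => /eqP h; rewrite h adj_irr in ya2.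
  have nb1 : y1 != b by apply/negP => /eqP h; rewrite h adj_irr in by1.
  have nb2 : y2 != b by apply/negP => /eqP h; rewrite h adj_irr in by2.
  have : u \in [set a; b]%SET by rewrite -E !inE eqxx.
  have : v \in [set a; b]%SET by rewrite -E !inE eqxx orbT.
  rewrite !inE; case/orP: yy => /orP[]/eqP Ey; subst; rewrite ?(negbTE na1) ?(negbTE na2) ?(negbTE nb1) ?(negbTE nb2) //.
have I1 : inside t1 b y1 /\ inside t1 y1 a by rewrite /inside E1 !inE !eqxx ?orbT.
have I2 : inside t2 b y2 /\ inside t2 y2 a by rewrite /inside E2 !inE !eqxx ?orbT.
have k11 := kronecker B1 B1 E1 ab by1 ya1.
have k12 := kronecker B1 B2 E2 ab by2 ya2.
have k31 := kronecker B3 B1 E1 ab by1 ya1.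
have k32 := kronecker B3 B2 E2 ab by2 ya2.
have h1 := Dp b y1 by1; have h2 := Dp y1 a ya1; have h3 := Dp b y2 by2; have h4 := Dp y2 a ya2.
case: I1 => I1 I1'; case: I2 => I2 I2'.
rewrite I1 I1' I2 I2' !eqxx ?orbT in h1 h2 h3 h4.
move: (h1 isT isT) (h2 isT isT) (h3 isT isT) (h4 isT isT) k11 k12 k31 k32.
rewrite eqxx (negbTE n12) (eq_sym t3 t1) (negbTE n13) (eq_sym t3 t2) (negbTE n23) /tsum.
move: (cw (bpoint t1) b y1) (cw (bpoint t1) y1 a) (cw (bpoint t1) b y2) (cw (bpoint t1) y2 a).
move: (cw (bpoint t3) b y1) (cw (bpoint t3) y1 a) (cw (bpoint t3) b y2) (cw (bpoint t3) y2 a).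
move=> c1 c2 c3 c4 d1 d2 d3 d4 e1 e2 e3 e4 e5 e6 e7 e8.
have {e1 e2 e3 e4} : (d1 (+) c1) (+) (d2 (+) c2) (+) (d3 (+) c3) (+) (d4 (+) c4) = false.
  by rewrite e1 e2 e3 e4; bxor.
move: e5 e6 e7 e8; move: (cw (bpoint t1) a b) (cw (bpoint t3) a b) => g1 g2 e5 e6 e7 e8.
have : (g1 (+) d1 (+) d2) (+) (g1 (+) d3 (+) d4) (+) ((g2 (+) c1 (+) c2) (+) (g2 (+) c3 (+) c4)) = true.
  by rewrite e5 e6 e7 e8.
move=> E4 E3; suff : true = false by [].
by rewrite -E4 -E3; bxor.
Qed.

End Triangles.

(** * Faces of planar triangulations *)

Section Planar.
Variables (R : realType) (G : plane_graph R).
Local Notation P := (R * R)%type.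
Implicit Types (p q x y z : P) (e M : R) (A B C S F : set P) (a b u v w : G)
  (D : rel G) (t : {set G}).
Let K := drawing G.

Lemma edge_le2 a b : adj a b ->
  (#|[set t : {set G} in bfaces G | (a \in t) && (b \in t)]%SET| <= 2)%N.
Proof.
move=> ab; rewrite leqNgt; apply/negP => /card_gt2P[t1 [t2 [t3 [[]]]]].
move=> /setIdP[B1 /andP[a1 b1]] /setIdP[B2 /andP[a2 b2]] /setIdP[B3 /andP[a3 b3]] [n12 n23 n31].
have ne : a != b by apply/negP => /eqP h; rewrite h adj_irr in ab.
have third t : t \in bfaces G -> a \in t -> b \in t ->
    exists y : G, [/\ t = [set a; b; y]%SET, adj b y & adj y a].
  move=> tB at_ bt; have [F [_ _ tF _]] := bpointP tB.
  have [c3 cl] := tri_face_clique tF.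
  have /card_gt0P[y] : (0 < #|t :\ a :\ b|%SET)%N.
    have := cardsD1 a t; rewrite c3 at_ add1n => -[c2].
    have := cardsD1 b (t :\ a)%SET; rewrite -c2 !inE eq_sym ne bt add1n => -[<-] //.
  rewrite !inE => /and3P[yb ya yt]; exists y; split.
  - apply/esym/eqP; rewrite eqEcard; apply/andP; split.
      by apply/fintype.subsetP => z; rewrite !inE -orbA => /or3P[]/eqP->.
    by rewrite c3 finset.setUC cardsU1 cards2 !inE negb_or ya yb ne.
  - by apply: cl => //; rewrite eq_sym.
  - exact: cl.
have [y1 [E1 by1 ya1]] := third t1 B1 a1 b1.
have [y2 [E2 by2 ya2]] := third t2 B2 a2 b2.
apply: (edge_le2_aux ab B1 B2 B3 E1 E2 by1 ya1 by2 ya2 a3 b3 n12 _ n23).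
by rewrite eq_sym.
Qed.

(** With [f t2] missing, the part of [S] up to parameter [t2] is open and closed in [S]. *)
Lemma arc_middle (f : R -> P) S (t1 t2 t3 : R) :
  {within `[0, 1], continuous f} -> {in `[0, 1] &, injective f} ->
  connected S -> S `<=` f @` `[0, 1] -> S (f t1) -> S (f t3) -> ~ S (f t2) ->
  0 <= t1 -> t1 < t2 -> t2 < t3 -> t3 <= 1 -> False.
Proof.
move=> fc fi cS SA S1 S3 nS2 t10 t12 t23 t31.
have cI (s t : R) : 0 <= s -> t <= 1 -> closed (f @` `[s, t]).
  move=> s0 tt; apply: compact_closed; first exact: pair_hausdorff.
  apply: continuous_compact; last exact: segment_compact.
  apply: continuous_subspaceW fc => u /=; rewrite !in_itv /= => /andP[? ?]; apply/andP; split; lra.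
have E : S `&` f @` `[0, t2] = S.
  apply: cS.
  - by exists (f t1); split=> //; exists t1 => //=; rewrite in_itv /=; lra.
  - exists (~` (f @` `[t2, 1])); first by apply: closed_openC; apply: cI; lra.
    apply/seteqP; split=> x [Sx h]; split=> //.
      case: h => u /=; rewrite in_itv /= => /andP[u0 u2] fu [v /=]; rewrite in_itv /= => /andP[v2 v1] fv.
      have E : u = v by apply: fi; rewrite ?in_itv /= ?fu ?fv //; apply/andP; split; lra.
      by apply: nS2; have <- : u = t2; [lra | rewrite fu].
    have [u /=] := SA x Sx; rewrite in_itv /= => /andP[u0 u1] fu.
    exists u => //=; rewrite in_itv /= u0 /= leNgt; apply/negP => u2; apply: h.
    by exists u => //=; rewrite in_itv /=; lra.
  - by exists (f @` `[0, t2]) => //; apply: cI; lra.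
have : S (f t3) by [].
rewrite -E => -[_ [u /=]]; rewrite in_itv /= => /andP[u0 u2] fu.
have : u = t3 by apply: fi => //; rewrite in_itv /=; apply/andP; split; lra.
lra.
Qed.

Lemma conv_gt (l r s t : R) : l < r -> l < s -> 0 <= t -> t <= 1 -> l < r + t * (s - r).
Proof. by move=> ? ? ? ?; have [?|?] := leP r s; nra. Qed.

Lemma conv_lt (l r s t : R) : r < l -> s < l -> 0 <= t -> t <= 1 -> r + t * (s - r) < l.
Proof. by move=> ? ? ? ?; have [?|?] := leP r s; nra. Qed.

(** A box contains three points such that any two are joined by a segment avoiding the third; on an
    arc one of the three lies between the other two. *)
Lemma arc_no_interior A p q x e : is_arc A p q -> 0 < e ->
  (forall y, close e x y -> A y) -> False.
Proof.
move=> [f [fc fi _ _ fA]] e0 H.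
pose y : P := (x.1 + e / 2, x.2); pose z : P := (x.1, x.2 + e / 2).
have cx : close e x x by exact: close_refl.
have cy : close e x y by apply/closeP; split=> /=; lra.
have cz : close e x z by apply/closeP; split=> /=; lra.
have seg y1 y2 y3 : close e x y1 -> close e x y2 ->
   (forall t : R, 0 <= t -> t <= 1 -> (y1.1 + t * (y2.1 - y1.1), y1.2 + t * (y2.2 - y1.2)) <> y3) ->
   exists S, [/\ connected S, S `<=` A, S y1, S y2 & ~ S y3].
  move=> c1 c2 n3.
  have [S [S1 SA cS] S2] : connected_component (A `\` [set y3]) y1 y2.
    apply: line_component => t t0 t1; split; last by move=> /= E; apply: (n3 t t0 t1).
    apply: H; move/closeP: c1 => [? ? ? ?]; move/closeP: c2 => [? ? ? ?].
    by apply/closeP; split=> /=; first [exact: conv_gt | exact: conv_lt].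
  by exists S; split=> // [w /SA[]|/SA[_]] //; apply.
have [S1 [c1 s1 p1 q1 n1]] : exists S, [/\ connected S, S `<=` A, S x, S y & ~ S z].
  by apply: seg => // t t0 t1; move=> h; have /= h1 := congr1 fst h; have /= h2 := congr1 snd h; clear - h1 h2 e0; lra.
have [S2 [c2 s2 p2 q2 n2]] : exists S, [/\ connected S, S `<=` A, S x, S z & ~ S y].
  by apply: seg => // t t0 t1; move=> h; have /= h1 := congr1 fst h; have /= h2 := congr1 snd h; clear - h1 h2 e0; lra.
have [S3 [c3 s3 p3 q3 n3]] : exists S, [/\ connected S, S `<=` A, S y, S z & ~ S x].
  by apply: seg => // t t0 t1; move=> h; have /= h1 := congr1 fst h; have /= h2 := congr1 snd h; clear - h1 h2 e0; lra.
have := H x cx; have := H y cy; have := H z cz; rewrite -fA.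
move=> [tz /= hz fz] [ty /= hy fy] [tx /= hx fx].
rewrite -fA in s1 s2 s3; rewrite -fz -fy -fx in p1 q1 n1 p2 q2 n2 p3 q3 n3.
move: hx hy hz; rewrite !in_itv /= => /andP[x0 x1] /andP[y0 y1] /andP[z0 z1].
have xy : x <> y by move=> /(congr1 fst) /=; lra.
have xz : x <> z by move=> /(congr1 snd) /=; lra.
have yz : y <> z by move=> /(congr1 fst) /=; lra.
have [lxy|lxy|E] := ltgtP tx ty; last by apply: xy; rewrite -fx -fy E.
- have [lxz|lxz|E] := ltgtP tx tz; last by apply: xz; rewrite -fx -fz E.
  + have [lyz|lyz|E] := ltgtP ty tz; last by apply: yz; rewrite -fy -fz E.
    * exact: (@arc_middle f S2 tx ty tz).
    * exact: (@arc_middle f S1 tx tz ty).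
  + exact: (@arc_middle f S3 tz tx ty).
- have [lxz|lxz|E] := ltgtP tx tz; last by apply: xz; rewrite -fx -fz E.
  + exact: (@arc_middle f S3 ty tx tz).
  + have [lyz|lyz|E] := ltgtP ty tz; last by apply: yz; rewrite -fy -fz E.
    * exact: (@arc_middle f S1 ty tz tx).
    * exact: (@arc_middle f S2 tz ty tx).
Qed.

Hypothesis HP : planar_triangulation G.

(** A face next to an isolated vertex has it on its frontier, which consists of three edges that
    avoid it. *)
Lemma isolated_free v : exists u, adj v u.
Proof.
apply: contrapT => no.
have niso u w : adj u w -> ~ edge_set u w (pos v).
  by move=> uw /(edge_vertex uw)[E|E]; apply: no; subst v; [exists w | exists u; rewrite adj_sym].
pose A := vset (rem v (enum G)) `|` eset (elist (fun _ _ : G => true)).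
have cA : closed A.
  apply: compact_closed; first exact: pair_hausdorff.
  by apply: eset_compact; exact: elist_olist.
have nA : ~ A (pos v).
  move=> [[u ur /pos_inj E]|[[u w]]].
    by move: ur; rewrite -E mem_rem_uniq ?enum_uniq // inE eqxx.
  by rewrite elistP => /and3P[uw _ _]; exact: niso.
have KA x : K x -> x = pos v \/ A x.
  rewrite /K drawingE => -[[u _ ->]|xe]; last by right; right.
  have [->|ne] := eqVneq u v; [by left | right; left; exists u => //].
  by rewrite mem_rem_uniq ?enum_uniq // !inE ne mem_enum.
have [e e0 far] := closed_far cA nA.
pose y (s : R) : P := ((pos v).1 + s, (pos v).2).
have ny (s : R) : 0 < s -> s < e -> ~ K (y s).
  move=> s0 se /KA[/(congr1 fst) /=|Ay]; first by lra.
  by have /negP := far _ Ay; apply; apply/closeP; split=> /=; lra.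
pose F := connected_component (~` K) (y (e / 2)).
have fF : face G F by exists (y (e / 2)) => //; apply: ny; lra.
have Fy (s : R) : 0 < s -> s < e -> F (y s).
  move=> s0 se; apply: line_component => t t0 t1.
  have E : ((y (e / 2)).1 + t * ((y s).1 - (y (e / 2)).1),
            (y (e / 2)).2 + t * ((y s).2 - (y (e / 2)).2)) = y (e / 2 + t * (s - e / 2)).
    by rewrite /y /=; congr pair; ring.
  by rewrite E; apply: ny; nra.
have frv : frontier F (pos v).
  split; last first.
    move=> /interior_subset Fv; have [+ _] := face_point fF Fv; apply.
    by rewrite drawingE; exact: AD_vertex.
  move=> U /nbhs_close[r r0 HU]; have [s [s0 sr se]] := pos_min r0 e0.
  exists (y (s / 2)); split; first by apply: Fy; lra.
  by apply: HU; apply/closeP; split=> /=; lra.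
have [u [w [z [uw wz zu]]]] := HP fF; move: frv => /[swap] -> [[]|].
- exact: niso.
- exact: niso.
- exact: niso.
Qed.

Let Htri F (fF : face G F) (_ : bounded_set F) : bounded_by_triangle G F := HP fF.

(** Points of unbounded faces have trivial parities on all edges, so by [coboundary_component]
    nothing separates two such faces. *)
Lemma outer_face : exists (F : set P) t, [/\ face G F, ~ bounded_set F, tri_face F t &
  forall F', face G F' -> ~ bounded_set F' -> F' = F].
Proof.
have [M M0 bM] := drawing_far G.
pose q (L : R) : P := (L, 0).
have hq L : M <= L -> [|| M <= (q L).1, (q L).1 <= - M, M <= (q L).2 | (q L).2 <= - M].
  by move=> h; apply/orP; left.
have nq : ~ K (q M) by apply: (far_not_drawing bM); exact: hq.
pose F := connected_component (~` K) (q M).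
have fF : face G F by exists (q M).
have Fq L : M <= L -> F (q L).
  move=> ML; apply: line_component => t t0 t1; apply: (far_not_drawing bM).
  by apply/orP; left => /=; nra.
have ub : ~ bounded_set F.
  move=> [N [_ bF]].
  pose L := Num.max N 0 + Num.max M 0 + 1.
  have [h1 h2] : N < L /\ M <= L.
    have := le_max N N 0; have := le_max 0 N 0; have := le_max M M 0; have := le_max 0 M 0.
    by rewrite !lexx !orbT /= /L; split; lra.
  have h3 : M <= L + 1 by lra.
  have /= := bF L h1 _ (Fq _ h3); rewrite prod_normE ge_max /= => /andP[+ _].
  by rewrite ler_norml => /andP[_]; lra.
have [u [v [w [uv vw wu fr]]]] := HP fF.
exists F, [set u; v; w]%SET; split=> //; first by exists u, v, w.
move=> F' fF' ub'; have [p np Ep] := fF'.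
have F'p : F' p by rewrite Ep; exact: connected_component_refl.
have [hv H] := unbounded_coboundary fF ub (Fq M (lexx M)).
have [hv' H'] := unbounded_coboundary fF' ub' F'p.
apply: (face_eq fF' fF F'p).
have : connected_component (~` AD (fun _ _ : G => true)) (q M) p.
  apply: (@coboundary_component _ _ _ _ _ (fun a => hv a (+) hv' a)) => //; rewrite -?drawingE //.
  by move=> a b ab _; rewrite H // H' //; bxor.
by rewrite -drawingE.
Qed.

(** If the outer triangle did not wind around a point of a bounded face, that point would lie on the
    side of the unbounded face and so in [F]. *)
Lemma outer_kronecker F t0 t u v w : face G F -> ~ bounded_set F ->
  t0 = [set u; v; w]%SET -> adj u v -> adj v w -> adj w u -> tri_face F t0 ->
  t \in bfaces G -> tsum (cw (G := G) (bpoint t)) u v w.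
Proof.
move=> fF ub E0 uv vw wu [u' [v' [w' [uv' vw' wu' E' fr']]]] tB.
have [F' [fF' bF' tF' Fp]] := bpointP tB.
have [np _] := face_point fF' Fp.
rewrite (@tsum_perm _ _ _ u v w u' v' w') //; [|exact: cw_sym|by rewrite -E0].
apply: contrapT => /negP/negbTE s0.
have [q nq Eq] := fF.
have Fq : F q by rewrite Eq; exact: connected_component_refl.
have [hv H] := unbounded_coboundary fF ub Fq.
have Fb : F (bpoint t).
  apply: (tri_same_side fF uv' vw' wu' fr' Fq); first by move=> /AD_drawing.
  by rewrite s0 (tsum_cob H).
by apply: ub; rewrite (face_eq fF fF' Fb Fp).
Qed.

(** An arc has no interior, so some face [F'] comes near the middle [x] of [a b]. If no facial
    triangle contained [a b], the frontier of [F'] would stay away from [x], and [F'] would contain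
    this point of the drawing. *)
Lemma edge_in_face F t0 a b : face G F -> ~ bounded_set F -> tri_face F t0 ->
  (forall F', face G F' -> ~ bounded_set F' -> F' = F) -> adj a b ->
  (a \in t0) && (b \in t0) \/ exists2 t, t \in bfaces G & (a \in t) && (b \in t).
Proof.
move=> fF ub tF uniq ab; apply: contrapT => /not_orP[n0 nB].
have [x [xe xa xb]] := edge_middle ab.
pose D u v := [set u; v]%SET != [set a; b]%SET.
have sD : symmetric D by move=> u v; rewrite /D (finset.setUC [set u]%SET).
have nx : ~ AD D x by apply: (middle_notin ab xe xa xb) => u v /eqP.
have frD F' : face G F' -> frontier F' `<=` AD D.
  move=> fF'.
  have [t tF' nt] : exists2 t, tri_face F' t & ~~ ((a \in t) && (b \in t)).
    have [bF'|ub'] := pselect (bounded_set F'); last first.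
      by exists t0; [rewrite (uniq F') | exact/negP].
    have [u [v [w [uv vw wu fr]]]] := HP fF'.
    have tF' : tri_face F' [set u; v; w]%SET by exists u, v, w.
    exists [set u; v; w]%SET => //; apply/negP => h; apply: nB; exists [set u; v; w]%SET => //.
    by rewrite inE; apply/asboolP; exists F'.
  apply: subset_trans (tri_frontier tF') _; apply: AD_sub => u v uv /andP[ut vt].
  apply: contra nt => /eqP E; apply/andP; split.
    have : a \in [set u; v]%SET by rewrite E !inE eqxx.
    by rewrite !inE => /orP[]/eqP->.
  have : b \in [set u; v]%SET by rewrite E !inE eqxx orbT.
  by rewrite !inE => /orP[]/eqP->.
have [e e0 far] := closed_far (AD_closed (D := D)) nx.
have [y [cy nKy]] : exists y, close e x y /\ ~ K y.
  apply: contrapT => no; apply: (arc_no_interior (edge_arc ab) e0 (x := x)) => y cy.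
  have Ky : K y by apply: contrapT => nK; apply: no; exists y.
  have nAy : ~ AD D y by move=> /far/negP.
  move: Ky; rewrite /K drawingE => -[[v vG yv]|[[u v]]].
    by exfalso; apply: nAy; left; exists v.
  rewrite elistP => /and3P[uv _ _] /= ye.
  have [E|ne] := eqVneq [set u; v]%SET [set a; b]%SET; last first.
    by exfalso; apply: nAy; exact: (AD_edge sD uv ne ye).
  have : u \in [set a; b]%SET by rewrite -E !inE eqxx.
  have : v \in [set a; b]%SET by rewrite -E !inE eqxx orbT.
  rewrite !inE => /orP[]/eqP Ev /orP[]/eqP Eu; subst u v; rewrite ?adj_irr // in uv.
  by rewrite edge_sym.
pose F' := connected_component (~` K) y.
have fF' : face G F' by exists y.
have F'y : F' y by exact: connected_component_refl.
have F'x : F' x.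
  apply: (face_absorbs fF' (frD _ fF') F'y); apply: connected_component_sym.
  apply: (@component_near _ (AD D) x x e) => //; exact: connected_component_refl.
have [+ _] := face_point fF' F'x; apply; rewrite drawingE.
exact: (AD_edge _ ab _ xe).
Qed.

End Planar.

(** * The bounds *)

Lemma iota_le (G : sgraph) (S : {set G}) : is_ids (@adj G) S -> (iota_dom G <= #|S|)%N.
Proof.
move=> [SI SD]; rewrite /iota_dom; case: ex_minnP => k _; apply.
apply/existsP; exists S; rewrite eqxx andbT; apply/andP; split.
  by apply/forall_inP => u uS; apply/forall_inP => v vS; exact: SI.
apply/forallP => v; have [->//|[u uS uv]] := SD v.
by apply/orP; right; apply/existsP; exists u; rewrite uS.
Qed.

Lemma min_degree_le (G : sgraph) (v : G) : (min_degree G <= degree v)%N.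
Proof.
rewrite /min_degree; elim: (index_enum G) (mem_index_enum v) => // x r IH.
rewrite big_cons inE => /orP[/eqP<-|/IH]; first exact: geq_minl.
by move=> /(leq_trans (geq_minr _ _)).
Qed.

(** * The bound for near triangulations *)

Section Interface.
Variables (R : realType) (G : plane_graph R).
Hypothesis Htri : forall F, face G F -> bounded_set F -> bounded_by_triangle G F.
Implicit Types (a b u v w : G) (e t : {set G}).

(** Turns [cw], which lives on ordered pairs, into a cochain on two-element sets; [cw_sym] makes the
    order immaterial. *)
Definition ec t e := [exists a : G, exists b : G,
  [&& adj a b, e == [set a; b]%SET & cw (G := G) (bpoint t) a b]].

Lemma ecE t a b : adj a b -> ec t [set a; b]%SET = cw (G := G) (bpoint t) a b.
Proof.
move=> ab; apply/existsP/idP => [[a' /existsP[b' /and3P[ab' /eqP E h]]]|h].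
  by have [[-> ->]|[-> ->]] := set2_eq E; rewrite // cw_sym // adj_sym.
by exists a; apply/existsP; exists b; rewrite ab eqxx.
Qed.

Lemma ec_tsum t u v w : adj u v -> adj v w -> adj w u ->
  \big[addb/false]_(e in edges (@adj G)) ((e \subset [set u; v; w]%SET) && ec t e) =
  tsum (cw (G := G) (bpoint t)) u v w.
Proof. by move=> uv vw wu; rewrite (xor_tri _ (@adj_irr G)) // !ecE. Qed.

Lemma bfaces_tri t : t \in bfaces G -> is_tri (@adj G) t.
Proof. by move=> /bpointP[F [_ _ /tri_face_clique h _]]; exact/is_triP. Qed.

Lemma bfaces_le2 u v : adj u v -> (#|[set t in bfaces G | [set u; v]%SET \subset t]%SET| <= 2)%N.
Proof.
move=> uv; apply: leq_trans (edge_le2 uv); apply: subset_leq_card; apply/fintype.subsetP => t.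
by move=> /setIdP[tB]; rewrite subset_pair => h; apply/setIdP.
Qed.

Lemma bfaces_kron t t' : t \in bfaces G -> t' \in bfaces G ->
  \big[addb/false]_(e in edges (@adj G)) ((e \subset t') && ec t e) = (t == t').
Proof.
move=> tB t'B; have [F [_ _ [u [v [w [uv vw wu E _]]]] _]] := bpointP t'B.
by rewrite {1}E ec_tsum // (kronecker tB t'B E).
Qed.

Lemma bfaces_kspan e0 : e0 \in edges (@adj G) -> exists (X : {set {set G}}) (hv : G -> bool),
  X \subset bfaces G /\ forall e, e \in edges (@adj G) ->
    (e == e0) = \big[addb/false]_(t in X) ec t e (+) \big[addb/false]_(v in e) hv v.
Proof.
move=> /edgesP[u0 [v0 [uv0 ->]]]; have [X [hv [XB XE]]] := bfaces_span Htri uv0.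
exists X, hv; split=> // e /edgesP[a [b [ab ->]]].
have nab := adj_neq (@adj_irr G) ab.
under eq_bigr => t _ do rewrite ecE //.
rewrite finset.big_setU1 ?inE //= finset.big_set1 -XE //.
apply/eqP/orP => [/set2_eq[[-> ->]|[-> ->]]|[/eqP[-> ->]|/eqP[-> ->]]] //.
- by left.
- by right.
- by rewrite finset.setUC.
Qed.

Lemma bfaces_bspan C : (forall v, dv (@adj G) C v = false) ->
  exists X : {set {set G}}, X \subset bfaces G /\ forall e, e \in edges (@adj G) -> C e = bd X e.
Proof. exact: (kron_span (@adj_irr G) bfaces_tri bfaces_kron bfaces_kspan). Qed.

Lemma bfaces_bindep (X : {set {set G}}) : X \subset bfaces G ->
  (forall e, e \in edges (@adj G) -> bd X e = false) -> X = finset.set0.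
Proof. exact: (kron_indep bfaces_kron). Qed.

Lemma near_bound : k_connected G 2 -> (12 * iota_dom G <= 5 * #|G|)%N.
Proof.
move=> [G3 conn]; rewrite leqNgt; apply/negP => lt.
(* With [iota_dom G = m.+1], an independent dominating set of size at most [m] is a
   contradiction. *)
case E: (iota_dom G) lt => [|m] lt; first by rewrite muln0 in lt.
have [|S [/iota_le iS Sm]] := near_ids (@adj_sym G) (@adj_irr G) bfaces_tri bfaces_le2 bfaces_bspan
    bfaces_bindep G3 conn (m := m).
  by move: lt; clear; move: #|G| => n; lia.
by have := leq_trans iS Sm; rewrite E ltnn.
Qed.
End Interface.

(** * The bounds for planar triangulations *)

Section PlanarInterface.
Variables (R : realType) (G : plane_graph R).
Hypothesis HP : planar_triangulation G.
Implicit Types (a b u v w : G) (e t : {set G}).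

Let Htri : forall F, face G F -> bounded_set F -> bounded_by_triangle G F.
Proof. by move=> F fF _; exact: HP. Qed.

(** The outer triangle is a cycle and bounds some [X]. The coefficient of a bounded face in [X] is
    the parity with which the outer triangle winds around it, 1 by [outer_kronecker], so [X] is all
    of [bfaces G]. *)
Lemma planar_outer : exists t0 : {set G}, [/\ is_tri (@adj G) t0,
  forall e, e \in edges (@adj G) -> bd (bfaces G) e = (e \subset t0) &
  forall a b, adj a b -> [set a; b]%SET \subset t0 \/
    exists2 t, t \in bfaces G & [set a; b]%SET \subset t].
Proof.
have [F [t0 [fF ub tF uq]]] := outer_face HP; exists t0.
have tri0 : is_tri (@adj G) t0 by apply/is_triP; exact: tri_face_clique tF.
split=> // [e eE|a b ab].
  have [X [XB XE]] := bfaces_bspan Htri (fun v => dv_tri (@adj_irr G) v tri0).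
  suff -> : bfaces G = X by rewrite XE.
  apply/eqP; rewrite finset.eqEsubset XB andbT; apply/fintype.subsetP => t tB.
  rewrite -(kron_bd (@bfaces_kron _ G) XB tB).
  have [u [v [w [uv vw wu E _]]]] := tF.
  rewrite (eq_bigr (fun e => (e \subset [set u; v; w]%SET) && ec t e)); last first.
    by move=> e' e'E; rewrite -XE // E.
  by rewrite ec_tsum //; exact: outer_kronecker fF ub E uv vw wu tF tB.
have [h|[t tB h]] := edge_in_face HP fF ub tF uq ab; first by left; rewrite subset_pair.
by right; exists t; rewrite // subset_pair.
Qed.

Lemma planar_bound : (8 * iota_dom G < 3 * #|G|)%N.
Proof.
have [t0 [tri0 bdB ein]] := planar_outer.
have G0 := V_gt0 tri0; rewrite ltnNge; apply/negP => le.
case E: (iota_dom G) le => [|m] le.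
  by move: le G0; clear; move: #|G| => n; lia.
have [S [/iota_le iS Sm]] := closed_ids (@adj_sym G) (@adj_irr G) (@bfaces_tri _ G) tri0
  (@bfaces_le2 _ G) (bfaces_bspan Htri) (@bfaces_bindep _ G) bdB ein (isolated_free HP) le.
by have := leq_trans iS Sm; rewrite E ltnn.
Qed.

Lemma planar_bound5 : min_degree G = 5%N -> (3 * iota_dom G <= #|G|)%N.
Proof.
move=> d5; have [t0 [tri0 bdB ein]] := planar_outer.
rewrite leqNgt; apply/negP => lt.
case E: (iota_dom G) lt => [|m] lt; first by rewrite muln0 in lt.
have deg v : (5 <= #|nb (@adj G) v|)%N by rewrite -d5; exact: min_degree_le.
have [S [/iota_le iS Sm]] := closed_ids5 (@adj_sym G) (@adj_irr G) (@bfaces_tri _ G) tri0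
  (@bfaces_le2 _ G) (bfaces_bspan Htri) (@bfaces_bindep _ G) bdB ein (isolated_free HP) deg lt.
by have := leq_trans iS Sm; rewrite E ltnn.
Qed.
End PlanarInterface.

Theorem theorem3 (R : realType) (G : plane_graph R) :
  (near_triangulation G ->
     (iota_dom G)%:R <= 5 * #|G|%:R / 12 :> rat) /\
  (planar_triangulation G ->
     (iota_dom G)%:R < 3 * #|G|%:R / 8 :> rat) /\
  (planar_triangulation G -> min_degree G = 5%N ->
     (iota_dom G)%:R <= #|G|%:R / 3 :> rat).
Proof.
split; [|split].
- move=> [conn Htri]; rewrite ler_pdivlMr ?ltr0n // -!natrM ler_nat mulnC.
  exact: near_bound.
- move=> HP; rewrite ltr_pdivlMr ?ltr0n // -!natrM ltr_nat mulnC.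
  exact: planar_bound.
- move=> HP d5; rewrite ler_pdivlMr ?ltr0n // -!natrM ler_nat mulnC.
  exact: planar_bound5.
Qed.
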